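(* Every progressively measurable process $C$ with $C^{1-R}\in\mathbb{SO}_+$ is uniquely proper; that is, there exists exactly one proper solution associated to $C$.
   Context: Work on a filtered probability space $(\Omega,\mathcal F,(\mathcal F_t)_{t\ge0},\mathbb P)$ whose filtration is complete and continuous, with $\mathcal F_0$ trivial; processes are identified up to indistinguishability. $\mathscr P_+$ (resp. $\mathscr P_{++}$) denotes nonnegative (resp. strictly positive) progressively measurable processes. Parameters $R,S\in(0,1)\cup(1,\infty)$ satisfy $\theta:=\frac{1-R}{1-S}>1$; $\rho:=\frac{\theta-1}{\theta}$. The Epstein--Zin aggregator is $f_{EZ}(c,v)=\frac{c^{1-S}}{1-S}((1-R)v)^{\rho}$ for $c\ge0$, $v\in(1-R)[0,\infty)$. Given $C\in\mathscr P_+$, a solution associated to $C$ is a càdlàg progressively measurable process $V$ with values in $(1-R)[0,\infty)$ such that $\mathbb E\int_0^\infty|f_{EZ}(C_s,V_s)|\,ds<\infty$ and $V_t=\mathbb E[\int_t^\infty f_{EZ}(C_s,V_s)\,ds\mid\mathcal F_t]$ for all $t\ge0$. A solution $V$ is proper if for every $t\ge0$, up to null sets, $(1-R)V_t>0$ on $\{\mathbb E[\int_t^\infty C_s^{1-R}ds\mid\mathcal F_t]>0\}$. For $X\in\mathscr P_+$ let $J^X_t=\mathbb E[\int_t^\infty X_s\,ds\mid\mathcal F_t]$. $\mathbb{SO}$ is the set of $X\in\mathscr P_{++}$ with $\mathbb E\int_0^\infty X_t\,dt<\infty$ such that $kJ^X\le X\le KJ^X$ for some constants $0<k\le K<\infty$;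 $\mathbb{SO}_\nu$ ($\nu\ge0$) is the set of $X\in\mathbb{SO}$ with $(e^{\nu t}X_t)_{t\ge0}\in\mathbb{SO}$, and $\mathbb{SO}_+=\bigcup_{\nu>0}\mathbb{SO}_\nu$. *)

(* Defs.v *)
From HB Require Import structures.
From mathcomp Require Import all_boot all_order all_algebra.
From mathcomp Require Import all_classical all_reals all_analysis.
Import Order.TTheory GRing.Theory Num.Theory numFieldNormedType.Exports.

Set Implicit Arguments.
Unset Strict Implicit.
Unset Printing Implicit Defensive.

Local Open Scope classical_set_scope.
Local Open Scope ring_scope.

Section EZDefs.
Context {d : measure_display} {Omega : measurableType d} {R : realType}.
Variable P : probability Omega R.

(* A (real-valued) process indexed by time t (only t >= 0 is relevant). *)
Definition process := R -> Omega -> R.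

Definition is_filtration (F : R -> set (set Omega)) :=
  (forall t, 0 <= t -> sigma_algebra setT (F t) /\ F t `<=` measurable) /\
  (forall s t, 0 <= s -> s <= t -> F s `<=` F t).

Definition filtration_complete (F : R -> set (set Omega)) :=
  forall N, P.-negligible N -> F 0 N.

Definition F0_trivial (F : R -> set (set Omega)) :=
  forall A, F 0 A -> P A = 0%E \/ P A = 1%E.

Definition filtration_right_continuous (F : R -> set (set Omega)) :=
  forall t, 0 <= t -> F t = \bigcap_(s in `]t, +oo[%classic) F s.

Definition filtration_left_continuous (F : R -> set (set Omega)) :=
  forall t, 0 < t -> F t = <<s \bigcup_(s in `[0, t[%classic) F s >>.

(* progressive measurability: for every t >= 0, (s, w) |-> X s w restricted
   to [0,t] x Omega is B([0,t]) (x) F_t - measurable *)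
Definition progressive (F : R -> set (set Omega)) (X : process) :=
  forall t, 0 <= t -> forall B : set R, measurable B ->
    <<s [set Z : set (R * Omega) | exists (A : set R) (E : set Omega),
          [/\ measurable A, A `<=` `[0, t]%classic, F t E & Z = A `*` E]] >>
      [set p : R * Omega | `[0, t]%classic p.1 /\ B (X p.1 p.2)].

Definition cond_exp_version (G : set (set Omega)) (Y Z : Omega -> R) :=
  [/\ P.-integrable setT (EFin \o Y),
      (forall B : set R, measurable B -> G (Z @^-1` B)),
      P.-integrable setT (EFin \o Z) &
      forall A, G A -> (\int[P]_(x in A) (Z x)%:E = \int[P]_(x in A) (Y x)%:E)%E].

Definition tail_int (X : process) (t : R) : Omega -> R :=
  fun w => fine (\int[lebesgue_measure]_(s in `[t, +oo[%classic) (X s w)%:E)%E.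

Definition finite_expected_int (X : process) :=
  (\int[P]_w (\int[lebesgue_measure]_(s in `[0%R, +oo[%classic) (X s w)%:E) < +oo)%E.

Definition SO (F : R -> set (set Omega)) (X : process) :=
  [/\ progressive F X, (forall t w, 0 <= t -> 0 < X t w),
      finite_expected_int X &
      exists k K : R, [/\ 0 < k, k <= K &
        forall t, 0 <= t -> forall J, cond_exp_version (F t) (tail_int X t) J ->
          {ae P, forall w, k * J w <= X t w /\ X t w <= K * J w}]].

Definition SO_nu (F : R -> set (set Omega)) (nu : R) (X : process) :=
  SO F X /\ SO F (fun t w => expR (nu * t) * X t w).

Definition SO_plus (F : R -> set (set Omega)) (X : process) :=
  exists nu : R, 0 < nu /\ SO_nu F nu X.

Definition EZ_theta (Rp Sp : R) := (1 - Rp) / (1 - Sp).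
Definition EZ_rho (Rp Sp : R) := (EZ_theta Rp Sp - 1) / EZ_theta Rp Sp.
Definition f_EZ (Rp Sp : R) (c v : R) :=
  c `^ (1 - Sp) / (1 - Sp) * ((1 - Rp) * v) `^ (EZ_rho Rp Sp).

Definition cadlag (V : process) :=
  forall w t, 0 <= t ->
    ((fun s => V s w) @ t^'+ --> V t w) /\
    (0 < t -> exists l : R, (fun s => V s w) @ t^'- --> l).

Definition EZ_solution (F : R -> set (set Omega)) (Rp Sp : R) (C V : process) :=
  [/\ progressive F V, cadlag V,
      (forall t w, 0 <= t -> 0 <= (1 - Rp) * V t w),
      finite_expected_int (fun s w => `|f_EZ Rp Sp (C s w) (V s w)|) &
      forall t, 0 <= t ->
        cond_exp_version (F t) (tail_int (fun s w => f_EZ Rp Sp (C s w) (V s w)) t) (V t)].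

Definition EZ_proper (F : R -> set (set Omega)) (Rp Sp : R) (C V : process) :=
  EZ_solution F Rp Sp C V /\
  forall t, 0 <= t -> forall J,
    cond_exp_version (F t) (tail_int (fun s w => C s w `^ (1 - Rp)) t) J ->
    {ae P, forall w, 0 < J w -> 0 < (1 - Rp) * V t w}.

End EZDefs.

(* Main.v *)
(** Put [U = (1 - R) V], [r = rho] and [H = theta C ^ (1 - S)].  A solution is
    a nonnegative càdlàg process with
      [U_t = E[int_t^oo H U ^ r ds | F_t]],  where [0 < r < 1],
    and it is proper when [U_t > 0] almost surely for every [t].

    Uniqueness.  Let [U], [Y] be positive solutions and [G = U ^ (1 - r) Y ^ r].
    Since [(x, y) |-> x ^ (1 - r) y ^ r] is concave and homogeneous, conditional
    Jensen along dyadic partitions, right-continuity of the paths and Fatou give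
      [G_t >= E[int_t^oo H Y ^ r ((1 - r) + r G / Y) ds | F_t]].
    Hence [G >= m Y] implies [G >= (1 - r + r m) Y]; starting from [m = 0] this
    yields [G >= Y], that is [U >= Y], and the roles can be exchanged.

    Existence.  As [X = C ^ (1 - R)] is comparable to its own potential, suitable
    multiples of [X] are a subsolution and a supersolution, between which the
    iteration [U |-> E[int_t^oo H U ^ r ds | F_t]] increases to a solution. The
    càdlàg versions come from Doob's upcrossing inequality. *)

Require Import Defs.
From HB Require Import structures.
From mathcomp Require Import all_boot all_order all_algebra.
From mathcomp Require Import all_classical all_reals all_analysis.
From mathcomp Require Import measurable_realfun ring lra.
Import Order.TTheory GRing.Theory Num.Theory numFieldNormedType.Exports.
Set Implicit Arguments.
Unset Strict Implicit.
Unset Printing Implicit Defensive.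
Local Open Scope classical_set_scope.
Local Open Scope ring_scope.

(** * Conditional expectations *)

(** It does so through one cancellation, for which the exponents of [G] are chosen: the derivative
    of [x ^ (1 - r) y ^ r] in [x] contains [x ^ (- r)], which removes the factor [U ^ r] from the
    drift [H U ^ r]. What remains involves only [Y] and the ratio [G / Y], and [m |-> 1 - r + r m]
    contracts towards 1.

    In place of stochastic calculus there is a discrete decomposition: over a cell, [U] at the right
    end plus the integral of its integrand over the cell has [U] at the left end as conditional
    expectation. The gradient of the mean is used twice, at the left end for Jensen and at the
    padded right end to bound the gain from below. Approach from the right matches the one-sided
    continuity of the paths.

    A solution must be progressive and càdlàg on every path; conditional expectations chosen
    separately at each time do not give this, hence the upcrossing argument. *)

Lemma cvg_integral_nondecreasing d (T : measurableType d) (R : realType)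
    (mu : {measure set T -> \bar R}) (D : set T) (mD : measurable D)
    (g : nat -> T -> \bar R) (f : T -> \bar R) :
  (forall n, measurable_fun D (g n)) ->
  (forall n x, D x -> 0 <= g n x)%E ->
  (forall x, D x -> forall n m, (n <= m)%N -> (g n x <= g m x)%E) ->
  (forall x, D x -> g n x @[n --> \oo] --> f x) ->
  (\int[mu]_(x in D) g n x)%E @[n --> \oo] --> (\int[mu]_(x in D) f x)%E.
Proof.
move=> mg g0 ndg gf; rewrite (eq_integral (fun x => limn (g ^~ x))).
  by apply: cvg_monotone_convergence => // x Dx m n; exact: ndg.
by move=> x; rewrite inE => Dx; exact/esym/cvg_lim/gf.
Qed.

Section SubSigmaAlgebra.
Context {d : measure_display} {Omega : measurableType d} {R : realType}.
Variable P : probability Omega R.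
Variable G : set (set Omega).
Hypotheses (sG : sigma_algebra setT G) (Gm : G `<=` measurable).

Local Notation GT := (g_sigma_algebraType G).

(** Since [G] is already a sigma-algebra, generating from it adds nothing. Measurability with
    respect to [G] thus becomes ordinary measurability on the type [GT], which has the same points
    as [Omega]. *)
Lemma measurable_sub_sigma : (measurable : set (set GT)) = G.
Proof. exact: measurable_g_measurableTypeE. Qed.

Lemma measurable_sub_sigmaP (A : set Omega) :
  @measurable _ GT (A : set GT) <-> G A.
Proof. by rewrite measurable_sub_sigma. Qed.

Lemma adaptedP (Z : Omega -> R) :
  (forall B : set R, measurable B -> G (Z @^-1` B)) <->
  measurable_fun [set: GT] (Z : GT -> R).
Proof.
split=> [h _ B mB|h B mB].
  by rewrite setTI measurable_sub_sigma; exact: h.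
by have := h measurableT B mB; rewrite setTI measurable_sub_sigma.
Qed.

Lemma measurable_fun_sub_sigma d' (T : measurableType d') (D : set Omega)
    (f : Omega -> T) :
  G D -> measurable_fun (D : set GT) (f : GT -> T) -> measurable_fun D f.
Proof.
move=> GD mf mD B mB; apply: Gm; rewrite -measurable_sub_sigma.
by apply: mf; rewrite ?measurable_sub_sigma.
Qed.

Lemma sub_sigmaT : G setT.
Proof. by rewrite -measurable_sub_sigma; exact: measurableT. Qed.


Import HBNNSimple.

(** This plays the role of taking a known factor out of a conditional expectation, for a weight [h]
    that may be unbounded. The level sets of simple approximations of [h] lie in [G], where the
    hypothesis applies; monotone convergence does the rest. *)
Lemma le_integral_weight (Y1 Y2 : Omega -> R) (h : Omega -> R) :
  measurable_fun setT Y1 -> measurable_fun setT Y2 ->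
  (forall w, 0 <= Y1 w) -> (forall w, 0 <= Y2 w) ->
  (forall A, G A ->
    \int[P]_(w in A) (Y1 w)%:E <= \int[P]_(w in A) (Y2 w)%:E)%E ->
  measurable_fun [set: GT] (h : GT -> R) -> (forall w, 0 <= h w) ->
  forall A, G A ->
    (\int[P]_(w in A) (h w * Y1 w)%:E <= \int[P]_(w in A) (h w * Y2 w)%:E)%E.
Proof.
move=> mY1 mY2 Y10 Y20 Y12 mh h0 A GA.
have mA : measurable A by exact: Gm.
have mh' : measurable_fun [set: GT] (EFin \o h : GT -> \bar R).
  exact/measurable_EFinP.
pose f := nnsfun_approx (@measurableT _ GT) mh'.
have f_cvg x : (f n x)%:E @[n --> \oo] --> (h x)%:E.
  by apply: cvg_nnsfun_approx => // w _; rewrite lee_fin.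
have f_nd x m n : (m <= n)%N -> (f m x <= f n x)%R.
  by move=> mn; exact/lefP/nd_nnsfun_approx.
have mf n : measurable_fun [set: Omega] (f n : Omega -> R).
  by apply: measurable_fun_sub_sigma; [exact: sub_sigmaT | exact: measurable_funP].
have mcvg (Y : Omega -> R) : measurable_fun setT Y -> (forall w, 0 <= Y w) ->
    (\int[P]_(w in A) (f n w * Y w)%:E)%E @[n --> \oo] -->
    (\int[P]_(w in A) (h w * Y w)%:E)%E.
  move=> mY Y0.
  apply: (@cvg_integral_nondecreasing _ _ _ P A mA (fun n w => (f n w * Y w)%:E)) => //.
  - move=> n; apply/measurable_funTS/measurable_EFinP.
    exact: measurable_funM.
  - by move=> n w _; rewrite lee_fin mulr_ge0.
  - by move=> w _ m n mn; rewrite lee_fin ler_wpM2r//; exact: f_nd.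
  - by move=> w _; under eq_fun do rewrite EFinM; rewrite EFinM; exact: cvgeZr.
have mGf n y : G (f n @^-1` [set y]).
  by apply/measurable_sub_sigmaP; exact: measurable_funPTI.
have sumf n (Y : Omega -> R) : measurable_fun setT Y -> (forall w, 0 <= Y w) ->
    (\int[P]_(w in A) (f n w * Y w)%:E =
     \sum_(y \in range (f n)) y%:E * \int[P]_(w in A `&` f n @^-1` [set y]) (Y w)%:E)%E.
  move=> mY Y0.
  under eq_integral do rewrite fimfunE fsbig_finite//= big_distrl/= -sumEFin.
  rewrite ge0_integral_sum//=; last 2 first.
  - move=> y; apply/measurable_funTS/measurable_EFinP/measurable_funM => //.
    apply: measurable_funM => //; apply: measurable_indic.
    exact: Gm.
  - move=> y w _; rewrite lee_fin mulr_ge0//; exact: nnfun_muleindic_ge0.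
  rewrite fsbig_finite//=; apply: eq_bigr => y _.
  have [y0|y0] := leP 0 y; last first.
    rewrite preimage_nnfun0// setI0 integral_set0 mule0.
    by rewrite integral0_eq// => x _; rewrite indicE in_set0 mulr0 mul0r.
  rewrite integral_mkcondr -ge0_integralZl//; last first.
  - by move=> w _; rewrite patchE; case: ifP; rewrite ?lee_fin.
  - apply: (measurable_restrict _ _ _).1 => //; first exact: Gm.
    exact/measurable_funTS/measurable_EFinP.
  apply: eq_integral => w _; rewrite patchE indicE.
  by case: ifPn => _; rewrite ?mulr1 ?mulr0 ?mul0r ?mule0// EFinM.
have le_n n : (\int[P]_(w in A) (f n w * Y1 w)%:E <=
    \int[P]_(w in A) (f n w * Y2 w)%:E)%E.
  rewrite !sumf// !fsbig_finite//=; apply: lee_sum => y _.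
  have [y0|y0] := leP 0 y; last first.
    by rewrite preimage_nnfun0// setI0 !integral_set0.
  rewrite lee_wpmul2l ?lee_fin//; apply: Y12.
  by apply/measurable_sub_sigmaP; apply: measurableI; exact/measurable_sub_sigmaP.
apply: (lee_cvg_to (mcvg _ mY1 Y10) (mcvg _ mY2 Y20)).
exact: nearW.
Qed.

Lemma ae_le_of_le_integral (Z1 Z2 : Omega -> R) :
  measurable_fun [set: GT] (Z1 : GT -> R) -> measurable_fun [set: GT] (Z2 : GT -> R) ->
  (forall w, 0 <= Z1 w) -> (forall w, 0 <= Z2 w) ->
  (\int[P]_w (Z1 w)%:E < +oo)%E ->
  (forall A, G A ->
    \int[P]_(w in A) (Z1 w)%:E <= \int[P]_(w in A) (Z2 w)%:E)%E ->
  {ae P, forall w, Z1 w <= Z2 w}.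
Proof.
move=> mZ1 mZ2 Z10 Z20 Z1oo Z12.
have mZ1' : measurable_fun setT Z1 by exact: measurable_fun_sub_sigma sub_sigmaT mZ1.
have mZ2' : measurable_fun setT Z2 by exact: measurable_fun_sub_sigma sub_sigmaT mZ2.
(* On this set of [G] the hypothesis forces the integral of the positive difference [Z1 - Z2] to
   vanish; [Z2] is integrable there because it lies below [Z1]. *)
pose A := [set w | Z2 w < Z1 w].
have GA : G A.
  have := measurable_fun_ltr mZ2 mZ1.
  move=> /(_ measurableT [set true]); rewrite setTI measurable_sub_sigma; exact.
have mA : measurable A by exact: Gm.
have i1 : P.-integrable A (EFin \o Z1).
  apply: (@integrableS _ _ _ _ setT) => //; apply/integrableP; split.
    exact/measurable_EFinP.
  by under eq_integral do rewrite /= ger0_norm//.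
have i2 : P.-integrable A (EFin \o Z2).
  apply: le_integrable i1 => //.
  - exact/measurable_funTS/measurable_EFinP.
  - by move=> w Aw /=; rewrite !ger0_norm// lee_fin ltW.
have := Z12 _ GA => le12.
have : ((\int[P]_(w in A) ((Z1 w)%:E - (Z2 w)%:E)) = 0)%E.
  apply/eqP; rewrite eq_le; apply/andP; split; last first.
    by apply: integral_ge0 => w Aw; rewrite -EFinB lee_fin subr_ge0 ltW.
  rewrite integralB_EFin// sube_le0//.
move=> int0.
have /ae_eq_integral_abs : (\int[P]_(w in A) `|(Z1 w - Z2 w)%:E|%E = 0)%E.
  rewrite -int0; apply: eq_integral => w; rewrite inE => Aw.
  by rewrite gee0_abs ?EFinB// -EFinB lee_fin subr_ge0 ltW.
move=> /(_ mA); have mB : measurable_fun A (fun w => (Z1 w - Z2 w)%:E).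
  by apply/measurable_funTS/measurable_EFinP/measurable_funB.
move=> /(_ mB); apply: filterS => w h.
rewrite leNgt; apply/negP => Aw; have /= := h Aw.
by move=> [] /eqP; rewrite subr_eq0 => /eqP e; move: Aw; rewrite e ltxx.
Qed.


(** The identity from [Omega] to [GT] is measurable and pushes [P] forward to [mu], so this is a
    change of variables. *)
Lemma integral_restr_sub_sigma (mu : {measure set GT -> \bar R}) (f : Omega -> \bar R) :
  (forall A, G A -> mu A = P A) ->
  measurable_fun [set: GT] (f : GT -> \bar R) -> (forall w, 0 <= f w)%E ->
  forall A, G A -> (\int[mu]_(w in (A : set GT)) f w = \int[P]_(w in A) f w)%E.
Proof.
move=> muP mf f0 A GA.
pose id' : Omega -> GT := id.
have mid : measurable_fun [set: Omega] id'.
  by move=> _ B /measurable_sub_sigmaP GB; rewrite setTI; exact: Gm.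
have := @ge0_integral_pushforward _ _ _ _ R id' mid P (A : set GT) f _ _ _.
move=> <-//.
- by apply: eq_measure_integral => B /measurable_sub_sigmaP GB _; rewrite muP.
- exact/measurable_sub_sigmaP.
- exact: measurable_funTS.
Qed.

(** The conditional expectation is the Radon-Nikodym density, on [GT], of the finite measure
    integrating [Y] over sets of [G] with respect to the restriction of [P]. *)
Lemma cond_exp_exists (Y : Omega -> \bar R) :
  measurable_fun setT Y -> (forall w, 0 <= Y w)%E -> (\int[P]_w Y w < +oo)%E ->
  exists Z : Omega -> R, [/\ measurable_fun [set: GT] (Z : GT -> R),
    forall w, 0 <= Z w &
    forall A, G A -> (\int[P]_(w in A) (Z w)%:E = \int[P]_(w in A) Y w)%E].
Proof.
move=> mY Y0 Yoo.
pose P' (A : set GT) : \bar R := P A.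
have P'0 : P' set0 = 0%E by exact: measure0.
have P'ge0 A : (0 <= P' A)%E by exact: measure_ge0.
have P'sa : semi_sigma_additive P'.
  move=> A mA tA mUA; apply: (@measure_semi_sigma_additive _ _ _ P A) => //.
  - by move=> i; apply/Gm/measurable_sub_sigmaP.
  - by apply/Gm/measurable_sub_sigmaP.
pose mu1 : {measure set GT -> \bar R} :=
  HB.pack P' (isMeasure.Build _ GT R P' P'0 P'ge0 P'sa).
have mu1T : (mu1 setT = 1)%E by exact: probability_setT.
pose mu : {finite_measure set GT -> \bar R} := HB.pack (mu1 : set GT -> \bar R)
  mu1 (Measure_isProbability.Build _ GT R mu1 mu1T).
pose N' (A : set GT) : \bar R := (\int[P]_(w in A) Y w)%E.
have N'0 : N' set0 = 0%E by exact: integral_set0.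
have N'ge0 A : (0 <= N' A)%E by apply: integral_ge0.
have N'sa : semi_sigma_additive N'.
  move=> A mA tA mUA; apply: (semi_sigma_additive_nng_induced (mu := P) mY Y0) => //.
  - by move=> i; apply/Gm/measurable_sub_sigmaP.
  - by apply/Gm/measurable_sub_sigmaP.
pose nu1 : {measure set GT -> \bar R} :=
  HB.pack N' (isMeasure.Build _ GT R N' N'0 N'ge0 N'sa).
have nu1f : fin_num_fun nu1.
  move=> A /measurable_sub_sigmaP GA.
  rewrite ge0_fin_numE; last exact: N'ge0.
  apply: le_lt_trans Yoo; apply: ge0_subset_integral => //.
  exact: Gm.
pose nu : {finite_measure set GT -> \bar R} := HB.pack (nu1 : set GT -> \bar R)
  nu1 (Measure_isFinite.Build _ GT R nu1 nu1f).
have numu : nu `<< mu.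
  apply/null_content_dominatesP => A /measurable_sub_sigmaP GA muA.
  by apply: null_set_integral => //; [exact: Gm|exact: measurable_funTS].
have [f [f0 ffin fint fE]] := radon_nikodym_sigma_finite numu.
have mf : measurable_fun [set: GT] f by exact: measurable_int fint.
exists (fun w => fine (f w)); split.
- exact: measurableT_comp mf.
- by move=> w; exact: fine_ge0.
move=> A GA.
rewrite (_ : (\int[P]_(w in A) Y w)%E = nu A)// fE; last exact/measurable_sub_sigmaP.
rewrite -(@integral_restr_sub_sigma mu)//.
- by apply: eq_integral => w _; rewrite fineK.
- exact/measurable_EFinP/measurableT_comp.
- by move=> w; rewrite fineK.
Qed.
End SubSigmaAlgebra.

(** * Upcrossings and regularization of paths *)

Section Upcrossings.
Context {R : realType}.
Implicit Types (a b : R) (x : nat -> R).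

(* Doob's strategy: hold from a value at most [a] until the next value at least [b]. *)
Fixpoint holding a b x k : bool :=
  if k is k'.+1 then (if holding a b x k' then x k < b else x k <= a)
  else x 0%N <= a.

Fixpoint upcrossings a b x k : nat :=
  if k is k'.+1 then (upcrossings a b x k' + (holding a b x k' && (b <= x k)%R))%N
  else 0%N.

(** The value of an open position must be carried for the induction to close: it is nonpositive when
    the position is bought, moves with the gain while it is held, and is exchanged for at least
    [b - a] when it is sold. *)
Lemma upcrossings_gain a b x k :
  (b - a) * (upcrossings a b x k)%:R + (if holding a b x k then x k - a else 0)
  <= \sum_(i < k) (holding a b x i)%:R * (x i.+1 - x i).
Proof.
elim: k => [|k ih].
  by rewrite big_ord0/= mulr0 add0r; case: ifP => [?|_]; rewrite ?subr_le0.
rewrite big_ord_recr /=; set s := \sum_(i < k) _ in ih *.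
set u := upcrossings a b x k in ih *.
case: (holding a b x k) ih => /= ih.
  case: ltP => xb /=.
    by rewrite addn0 mul1r; lra.
  by rewrite addr0 natrD mulrDr mulr1 mul1r; lra.
by rewrite addn0 mul0r; have [xa|xa] := leP (x k.+1) a; lra.
Qed.

(** For nonnegative values an open position loses at most [|a|]. The two halves of the gain are put
    on opposite sides so that they can be integrated in the extended reals without subtraction. *)
Lemma upcrossings_le_gain a b x k : (forall i, 0 <= x i) ->
  (b - a) * (upcrossings a b x k)%:R + \sum_(i < k) (holding a b x i)%:R * x i <=
  \sum_(i < k) (holding a b x i)%:R * x i.+1 + `|a|.
Proof.
move=> x0; have := upcrossings_gain a b x k.
under eq_bigr do rewrite mulrBr.
rewrite sumrB; have := x0 k; have := ler_norm a; have := normr_ge0 a.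
by case: ifP => _; lra.
Qed.

Lemma upcrossings_nd a b x k m : (k <= m)%N ->
  (upcrossings a b x k <= upcrossings a b x m)%N.
Proof.
move=> /subnK <-; elim: (m - k)%N => [//|n ih].
by rewrite addSn /=; apply: leq_trans ih (leq_addr _ _).
Qed.

Lemma holding_le a b x k : a < b -> x k <= a -> holding a b x k.
Proof.
move=> ab xa; case: k xa => [//|k] xa /=.
by case: ifP => // _; exact: le_lt_trans ab.
Qed.

Lemma upcrossings_lt a b x i j : a < b -> (i < j)%N -> x i <= a -> b <= x j ->
  (upcrossings a b x i < upcrossings a b x j)%N.
Proof.
move=> ab ij xia xjb.
(* From index [i] on, either the position open at [i] is still open, or an upcrossing has been
   completed since. *)
have key m : holding a b x (i + m) \/
    (upcrossings a b x i < upcrossings a b x (i + m))%N.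
  elim: m => [|m [ih|ih]]; first by left; rewrite addn0; exact: holding_le.
    rewrite addnS /= ih; case: ltP => _; first by left.
    by right; rewrite addn1 ltnS upcrossings_nd// leq_addr.
  right; apply: leq_trans ih _; apply: upcrossings_nd; exact: leq_add.

have := key (j - i.+1)%N.
have jE : j = (i + (j - i.+1)).+1 by rewrite -addSn subnKC.
have : (i <= i + (j - i.+1))%N by exact: leq_addr.
move: (i + _)%N jE xjb => m -> xjb im /= [->|um].
  by rewrite xjb addn1 ltnS upcrossings_nd.
exact: leq_trans um (leq_addr _ _).
Qed.

(** * Dyadic times and chains of upcrossings *)

Definition dyadic (n i : nat) : R := i%:R / 2 ^+ n.

Lemma dyadic_refine n m i : (n <= m)%N -> dyadic n i = dyadic m (i * 2 ^ (m - n)).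
Proof.
move=> nm; rewrite /dyadic natrM natrX -{2}(subnK nm) exprD.
by field; rewrite !expf_neq0 ?pnatr_eq0.
Qed.

Lemma ltr_dyadic n i j : (dyadic n i < dyadic n j) = (i < j)%N.
Proof. by rewrite ltr_pM2r ?invr_gt0 ?exprn_gt0// ltr_nat. Qed.

Lemma dyadic_le n i j : (i <= j)%N -> dyadic n i <= dyadic n j.
Proof. by move=> ij; rewrite ler_wpM2r ?invr_ge0 ?exprn_ge0// ler_nat. Qed.

Lemma dyadic_ge0 n i : 0 <= dyadic n i.
Proof. by rewrite mulr_ge0// invr_ge0 exprn_ge0. Qed.

Definition isdyadic (q : R) := exists n i, q = dyadic n i.

Lemma isdyadic_eventually q : isdyadic q ->
  exists n0, forall n, (n0 <= n)%N -> exists i, q = dyadic n i.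
Proof.
move=> [n0 [i ->]]; exists n0 => n n0n; exists (i * 2 ^ (n - n0))%N.
exact: dyadic_refine.
Qed.

Lemma dyadic_dense (x y : R) : 0 <= x -> x < y ->
  exists q, [/\ isdyadic q, x < q & q < y].
Proof.
move=> x0 xy.
have [n nxy] : exists n, (2 ^+ n)^-1 < y - x.
  exists (Num.bound (y - x)^-1).
  rewrite invf_plt ?posrE ?exprn_gt0 ?subr_gt0//.
  apply: lt_le_trans (archi_boundP _) _; first by rewrite invr_ge0 subr_ge0 ltW.
  by rewrite -natrX ler_nat ltnW// ltn_expl.
exists (dyadic n (Num.truncn (x * 2 ^+ n)).+1); split; first by exists n, (Num.truncn (x * 2 ^+ n)).+1.
  rewrite ltr_pdivlMr ?exprn_gt0//.
  by have /andP[] := truncn_itv (mulr_ge0 x0 (exprn_ge0 n (ler0n _ 2))).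
have /andP[+ _] := truncn_itv (mulr_ge0 x0 (exprn_ge0 n (ler0n _ 2))).
rewrite -ler_pdivrMr ?exprn_gt0// /dyadic => h.
by rewrite -natr1 mulrDl mul1r; lra.
Qed.

(* [k] successive upcrossings of [f] at dyadic times between [l] and [r]. *)
Fixpoint upchain (f : R -> R) a b k l r : Prop :=
  if k is k'.+1 then exists q q', [/\ isdyadic q, isdyadic q', l < q, q < q' &
     [/\ q' < r, f q <= a, b <= f q' & upchain f a b k' q' r]]
  else True.

Lemma upchain_monol f a b k l l' r : l' <= l -> upchain f a b k l r -> upchain f a b k l' r.
Proof.
case: k => [//|k] ll /= [q [q' [Dq Dq' lq qq' h]]].
by exists q, q'; split => //; exact: le_lt_trans lq.
Qed.

Lemma upchain_widen f a b a' b' k l r : a <= a' -> b' <= b ->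
  upchain f a b k l r -> upchain f a' b' k l r.
Proof.
move=> aa bb; elim: k l => [//|k ih] l [q [q' [Dq Dq' lq qq' [qr fq fq' h]]]].
exists q, q'; split => //; split => //; [exact: le_trans aa|exact: le_trans fq'|].
exact: ih.
Qed.

(** The recursion of [upchain] adds links on the left; left limits require adding them on the
    right. *)
Lemma upchain_rcons f a b k l r q q' r' : upchain f a b k l r -> l < q ->
  isdyadic q -> isdyadic q' -> r <= q -> q < q' -> q' < r' -> f q <= a -> b <= f q' ->
  upchain f a b k.+1 l r'.
Proof.
move=> + + Dq Dq' rq qq' qr' fq fq'.
elim: k l => [|k ih] l; first by move=> _ lq; exists q, q'.
move=> [p [p' [Dp Dp' lp pp' [pr' fp fp' h]]]] lq.
exists p, p'; split => //; split => //; first by exact: lt_trans (lt_le_trans pr' rq) (lt_trans qq' qr').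
by apply: ih => //; exact: lt_le_trans rq.
Qed.

(** A chain uses finitely many dyadic times. On every fine enough grid they are all grid points, and
    each link forces one more upcrossing. *)
Lemma upchain_upcrossings f a b k l r : a < b -> upchain f a b k l r ->
  exists n0, forall n, (n0 <= n)%N -> forall i N, dyadic n i <= l -> (i <= N)%N ->
  r <= dyadic n N ->
  (upcrossings a b (f \o dyadic n) i + k <= upcrossings a b (f \o dyadic n) N)%N.
Proof.
move=> ab; elim: k l => [|k ih] l /=.
  by move=> _; exists 0%N => n _ i N _ iN _; rewrite addn0 upcrossings_nd.
move=> [q [q' [/isdyadic_eventually[n1 D1] /isdyadic_eventually[n2 D2] lq qq'
  [qr fq fq' /ih[n3 h3]]]]].
exists (maxn n1 (maxn n2 n3)) => n; rewrite !geq_max => /and3P[/D1[i1 q1] /D2[i2 q2] /h3 h].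
move=> i N il iN rN; rewrite addnS -addSn.
have i1i2 : (i1 < i2)%N by rewrite -(ltr_dyadic n) -q1 -q2.
have ii1 : (i <= i1)%N by rewrite ltnW// -(ltr_dyadic n) -q1; exact: le_lt_trans lq.
have i2N : (i2 <= N)%N by rewrite ltnW// -(ltr_dyadic n) -q2; exact: lt_le_trans rN.
have := h i2 N _ i2N rN; rewrite q2 => /(_ (lexx _)); apply: leq_trans.
rewrite leq_add2r.
apply: leq_ltn_trans (upcrossings_nd a b (f \o dyadic n) ii1) _.
by apply: upcrossings_lt => //=; rewrite -?q1 -?q2.
Qed.

(** [S e] stands for the dyadic times within [e] on one side of a point. A bounded [f] whose lower
    and upper limits along [S] are not separated by any pair [a < b] converges. *)
Lemma directed_limit (S : R -> set R) (f : R -> R) B :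
  (forall e : R, 0 < e -> S e !=set0) ->
  (forall e e' : R, 0 < e -> e <= e' -> S e `<=` S e') ->
  (forall q, S 1 q -> 0 <= f q <= B) ->
  (forall a b : R, a < b -> (forall e : R, 0 < e -> exists q, S e q /\ f q <= a) ->
     (forall e : R, 0 < e -> exists q, S e q /\ b <= f q) -> False) ->
  exists l, forall e : R, 0 < e -> exists2 dl : R, 0 < dl & forall q, S dl q -> `|f q - l| < e.
Proof.
move=> Sn0 Sm fB osc.
(* The supremum of this set is the upper limit of [f] along [S]. *)
pose A := [set x | forall e : R, 0 < e -> exists q, S e q /\ x <= f q].
have A0 : A 0.
  move=> e e0; have me : 0 < Num.min e 1 by rewrite lt_min e0 ltr01.
  have [q Sq] := Sn0 _ me; exists q; split; first by apply: Sm Sq => //; rewrite ge_min lexx.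
  have /fB/andP[]// : S 1 q by apply: Sm Sq => //; rewrite ge_min lexx orbT.
have Aub : ubound A B.
  by move=> x /(_ 1 ltr01)[q [/fB/andP[_ qB] xq]]; exact: le_trans qB.
have supA : has_sup A by split; [exists 0|exists B].
exists (sup A) => e e0.
have [d1 d10 h1] : exists2 d1 : R, 0 < d1 & forall q, S d1 q -> f q < sup A + e.
  apply: contrapT => h.
  have : A (sup A + e).
    move=> x x0; apply: contrapT => h'; apply: h; exists x => // q Sq.
    by rewrite ltNge; apply/negP => ?; apply: h'; exists q.
  by move=> /(ub_le_sup (ex_intro _ B Aub)); rewrite gerDl leNgt e0.
have [d2 d20 h2] : exists2 d2 : R, 0 < d2 & forall q, S d2 q -> sup A - e < f q.
  apply: contrapT => h.
  have e20 : 0 < e / 2 by lra.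
  have [x Ax xA] := sup_adherent e20 supA.
  apply: (osc (sup A - e) x); [lra| |exact: Ax].
  move=> y y0; apply: contrapT => h'; apply: h; exists y => // q Sq.
  by rewrite ltNge; apply/negP => ?; apply: h'; exists q.
exists (Num.min d1 d2); first by rewrite lt_min d10.
move=> q Sq; rewrite ltr_norml.
have /h1 ? : S d1 q by apply: Sm Sq; rewrite ?lt_min ?d10// ge_min lexx.
have /h2 ? : S d2 q by apply: Sm Sq; rewrite ?lt_min ?d10// ge_min lexx orbT.
lra.
Qed.

(** * One-sided limits and right regularization of a single path *)

Section regularization.
Variable f : R -> R.
Hypothesis f_ge0 : forall q, 0 <= f q.
Hypothesis f_bounded : forall T : nat, exists B, forall q, isdyadic q -> q <= T%:R -> f q <= B.
Hypothesis f_upc : forall (a b : rat) (T : nat), ratr a < ratr b :> R -> exists K : nat,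
  forall n0, exists2 n, (n0 <= n)%N &
  (upcrossings (ratr a) (ratr b) (f \o dyadic n) (T * 2 ^ n) <= K)%N.

Lemma upchain_bounded (a b : R) (T : nat) : a < b ->
  exists K : nat, forall l r, 0 <= l -> r <= T%:R -> upchain f a b K l r -> False.
Proof.
move=> ab.

(* Upcrossings are controlled at rational levels only, so two rationals are inserted between [a] and
   [b]; a chain for [a], [b] is also one for them. *)
have [a' aa'] := rat_in_itvoo ab; rewrite in_itv/= in aa'; have /andP[aa a'b] := aa'.
have [b' ab'] := rat_in_itvoo a'b; rewrite in_itv/= in ab'; have /andP[ab'' b'b] := ab'.
have [K hK] := f_upc T ab''.
exists K.+1 => l r l0 rT uc.
have [n0 h] := upchain_upcrossings ab'' (upchain_widen (ltW aa) (ltW b'b) uc).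
have [n n0n nK] := hK n0.
have : (upcrossings (ratr a') (ratr b') (f \o dyadic n) 0 + K.+1 <=
  upcrossings (ratr a') (ratr b') (f \o dyadic n) (T * 2 ^ n))%N.
  apply: h => //; first by rewrite /dyadic mul0r.
  by rewrite /dyadic natrM natrX mulfK// expf_neq0// pnatr_eq0.
by rewrite add0n => /leq_trans/(_ nK); rewrite ltnn.
Qed.

(** The oscillation accumulates at [t] from the right, so links are found from right to left: a high
    value before the current left end [l], then a low value still closer to [t]. *)
Lemma upchain_right t (a b : R) : 0 <= t ->
  (forall e : R, 0 < e -> exists q, (isdyadic q /\ t < q < t + e) /\ f q <= a) ->
  (forall e : R, 0 < e -> exists q, (isdyadic q /\ t < q < t + e) /\ b <= f q) ->
  forall k r, t < r -> exists2 l, t < l & l < r /\ upchain f a b k l r.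
Proof.
move=> t0 fa fb k r tr; elim: k => [|k [l tl [lr h]]].
  by exists ((t + r) / 2); [lra|split => //; lra].
have [|q' [[Dq' /andP[tq' q'l]] bq']] := fb (l - t); first lra.
have [|q [[Dq /andP[tq qq']] aq]] := fa (q' - t); first lra.
exists ((t + q) / 2); first lra.
split; first lra.
exists q, q'; split => //; [lra|lra|split => //; first lra].
by apply: upchain_monol h; lra.
Qed.

Lemma upchain_left t (a b : R) : 0 < t ->
  (forall e : R, 0 < e -> exists q, (isdyadic q /\ t - e < q < t) /\ f q <= a) ->
  (forall e : R, 0 < e -> exists q, (isdyadic q /\ t - e < q < t) /\ b <= f q) ->
  forall k l, l < t -> exists2 r, r < t & l < r /\ upchain f a b k l r.
Proof.
move=> t0 fa fb k l lt; elim: k => [|k [r rt [lr h]]].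
  by exists ((t + l) / 2); [lra|split => //; lra].
have [|q [[Dq /andP[tq qt]] aq]] := fa (t - r); first lra.
have [|q' [[Dq' /andP[tq' q't]] bq']] := fb (t - q); first lra.
exists ((t + q') / 2); first lra.
split; first lra.
by apply: (upchain_rcons h _ Dq Dq') => //; lra.
Qed.

Lemma dyadic_right_limit t : 0 <= t -> exists l, forall e : R, 0 < e ->
  exists2 dl : R, 0 < dl & forall q, isdyadic q -> t < q < t + dl -> `|f q - l| < e.
Proof.
move=> t0; have [B hB] := f_bounded (Num.truncn (t + 1)).+1.
have tB : t + 1 < (Num.truncn (t + 1)).+1%:R.
  by have /andP[] := truncn_itv (addr_ge0 t0 ler01).
have [|||a b ab fa fb|l hl] := @directed_limit (fun e => [set q | isdyadic q /\ t < q < t + e]) f B.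
- move=> e e0; have [|q [Dq tq qe]] := @dyadic_dense t (t + e) t0; first lra.
  by exists q; split => //; rewrite tq.
- by move=> e e' e0 ee' q [Dq /andP[tq qe]]; split => //; apply/andP; split; lra.
- move=> q [Dq /andP[tq qe]]; rewrite f_ge0 hB//; lra.
- have [K hK] := upchain_bounded (Num.truncn (t + 1)).+1 ab.
  have [|l tl [_ h]] := @upchain_right t a b t0 fa fb K (t + 1); first lra.
  by apply: hK h; lra.
- by exists l => e /hl[dl dl0 h]; exists dl => // q Dq tq; apply: h.
Qed.

Lemma dyadic_left_limit t : 0 < t -> exists l, forall e : R, 0 < e ->
  exists2 dl : R, 0 < dl & forall q, isdyadic q -> t - dl < q < t -> `|f q - l| < e.
Proof.
move=> t0; have [B hB] := f_bounded (Num.truncn (t + 1)).+1.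
have tB : t + 1 < (Num.truncn (t + 1)).+1%:R.
  by have /andP[] := truncn_itv (addr_ge0 (ltW t0) ler01).
have [|||a b ab fa fb|l hl] := @directed_limit (fun e => [set q | isdyadic q /\ t - e < q < t]) f B.
- move=> e e0; have [||q [Dq tq qe]] := @dyadic_dense (Num.max 0 (t - e)) t.
  + by rewrite le_max lexx.
  + by rewrite gt_max t0/=; lra.
  + exists q; split => //; apply/andP; split => //; apply: le_lt_trans tq.
    by rewrite le_max lexx orbT.
- by move=> e e' e0 ee' q [Dq /andP[tq qe]]; split => //; apply/andP; split; lra.
- move=> q [Dq /andP[tq qe]]; rewrite f_ge0 hB//; lra.
- have [K hK] := upchain_bounded (Num.truncn (t + 1)).+1 ab.
  have [|r rt [lr h]] := @upchain_left t a b t0 fa fb K (Num.max 0 (t - 1)).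
    by rewrite gt_max t0/=; lra.
  apply: hK h; [by rewrite le_max lexx|lra].
- by exists l => e /hl[dl dl0 h]; exists dl => // q Dq tq; apply: h.
Qed.

(** The successor makes this strictly larger than [t] even when [t] is dyadic, so that only the
    right limit at [t] is seen. *)
Definition dyadic_above n (t : R) : R := dyadic n (Num.truncn (t * 2 ^+ n)).+1.

Definition right_regularization (t : R) : R := limn (fun n => f (dyadic_above n t)).

Lemma dyadic_above_gt n t : 0 <= t -> t < dyadic_above n t.
Proof.
move=> t0; rewrite ltr_pdivlMr ?exprn_gt0//.
by have /andP[] := truncn_itv (mulr_ge0 t0 (exprn_ge0 n (ler0n _ 2))).
Qed.

Lemma dyadic_above_le n t : 0 <= t -> dyadic_above n t <= t + (2 ^+ n)^-1.
Proof.
move=> t0; have /andP[+ _] := truncn_itv (mulr_ge0 t0 (exprn_ge0 n (ler0n _ 2))).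
rewrite -ler_pdivrMr ?exprn_gt0// /dyadic_above /dyadic => h.
by rewrite -natr1 mulrDl mul1r; lra.
Qed.

Lemma near_dyadic_above t e : 0 <= t -> 0 < e ->
  \forall n \near \oo, t < dyadic_above n t < t + e.
Proof.
move=> t0 e0.
have : (fun n => (2 ^+ n : R)^-1) @ \oo --> (0:R).
  under eq_fun do rewrite -exprVn.
  by apply: cvg_expr; rewrite ger0_norm ?invr_ge0//; lra.
move=> /cvgrPdist_lt/(_ _ e0); apply: filterS => n.
rewrite sub0r normrN ger0_norm ?invr_ge0 ?exprn_ge0// => ne.
rewrite dyadic_above_gt//=; apply: le_lt_trans (dyadic_above_le _ _) _ => //.
by rewrite ltrD2l.
Qed.

Lemma right_regularizationP t : 0 <= t -> forall e : R, 0 < e ->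
  exists2 dl : R, 0 < dl & forall q, isdyadic q -> t < q < t + dl ->
  `|f q - right_regularization t| < e.
Proof.
move=> t0; have [l hl] := dyadic_right_limit t0.
suff -> : right_regularization t = l by [].
apply: cvg_lim => //; apply/cvgrPdist_lt => e /hl[dl dl0 h].
near=> n; rewrite distrC; apply: h; first by eexists; eexists.
near: n; exact: near_dyadic_above.
Unshelve. all: by end_near. Qed.

(** The regularized value at [s] is close to [f] at a dyadic time just after [s], where the bound
    applies. Taking [u] equal to [t], or slightly below [t], gives the two one-sided limits at
    [t]. *)
Lemma right_regularization_dist (s u y l e : R) : 0 <= s -> u <= s -> s < y ->
  (forall q, isdyadic q -> u < q < y -> `|f q - l| < e) ->
  `|right_regularization s - l| <= e.
Proof.
move=> s0 us sy h; apply/ler_addgt0Pr => e' e'0.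
have [dl dl0 hd] := right_regularizationP s0 e'0.
have [|q [Dq sq qy]] := @dyadic_dense s (Num.min y (s + dl)) s0.
  by rewrite lt_min sy; lra.
move: qy; rewrite lt_min => /andP[qy qd].
have h1 : `|f q - l| < e by apply: h => //; apply/andP; split; lra.
have h2 := hd q Dq; rewrite sq qd in h2; have {}h2 := h2 isT.
move: h1 h2; rewrite !ltr_norml => /andP[? ?] /andP[? ?].
by rewrite ler_norml; apply/andP; split; lra.
Qed.

Lemma right_regularization_cadlag t : 0 <= t ->
  (right_regularization s @[s --> t^'+] --> right_regularization t) /\
  (0 < t -> exists l : R, right_regularization s @[s --> t^'-] --> l).
Proof.
move=> t0; split.
  apply/cvgrPdist_le => e /(right_regularizationP t0)[dl dl0 h].
  near=> s; rewrite distrC.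
  have ts : t < s by [].
  apply: (right_regularization_dist (le_trans t0 (ltW ts)) (ltW ts) _ h).
  near: s; apply: nbhs_right_lt; lra.
move=> tp; have [l hl] := dyadic_left_limit tp; exists l.
apply/cvgrPdist_le => e /hl[dl dl0 h].
near=> s; rewrite distrC.
have st : s < t by [].
apply: (right_regularization_dist _ _ st h).
  near: s; exact: nbhs_left_ge.
near: s; apply: nbhs_left_ge; lra.
Unshelve. all: by end_near. Qed.

Lemma right_regularization_ge0 t : 0 <= t -> 0 <= right_regularization t.
Proof.
move=> t0; apply/ler_addgt0Pr => e /(right_regularizationP t0)[dl dl0 h].
have [|q [Dq tq qd]] := @dyadic_dense t (t + dl) t0; first lra.
have := h q Dq; rewrite tq qd => /(_ isT); rewrite ltr_norml => /andP[_].
by have := f_ge0 q; lra.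
Qed.

Lemma right_regularization_cvg t : 0 <= t ->
  f (dyadic_above n t) @[n --> \oo] --> right_regularization t.
Proof.
move=> t0; apply/cvgrPdist_lt => e /(right_regularizationP t0)[dl dl0 h].
near=> n; rewrite distrC; apply: h; first by eexists; eexists.
near: n; exact: near_dyadic_above.
Unshelve. all: by end_near. Qed.

End regularization.
End Upcrossings.

(** * Progressive processes *)

Section Progressive.
Context {d : measure_display} {Omega : measurableType d} {R : realType}.
Variable F : R -> set (set Omega).
Hypothesis hF : is_filtration F.

Local Notation FT t := (g_sigma_algebraType (F t)).

Lemma filtration_sigma t : 0 <= t -> sigma_algebra setT (F t).
Proof. by case: hF => h _ /h[]. Qed.

Lemma filtration_sub t : 0 <= t -> F t `<=` measurable.
Proof. by case: hF => h _ /h[]. Qed.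

Lemma filtration_le s t : 0 <= s -> s <= t -> F s `<=` F t.
Proof. by case: hF => _; exact. Qed.

Lemma measurable_fun_filtration_le s t d' (T : measurableType d') (f : Omega -> T) :
  0 <= s -> s <= t ->
  measurable_fun [set: FT s] (f : FT s -> T) -> measurable_fun [set: FT t] (f : FT t -> T).
Proof.
move=> s0 st mf _ B mB; rewrite setTI.
apply/(measurable_sub_sigmaP (filtration_sigma (le_trans s0 st))).
apply: (filtration_le s0 st); apply/(measurable_sub_sigmaP (filtration_sigma s0)).
by rewrite -[X in measurable X]setTI; exact: mf.
Qed.

Definition strip t : set (R * Omega) := `[0, t]%classic `*` setT.

Definition rectangles t := [set Z : set (R * Omega) | exists (A : set R) (E : set Omega),
  [/\ measurable A, A `<=` `[0, t]%classic, F t E & Z = A `*` E]].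

Lemma measurable_strip t : measurable (strip t : set (R * FT t)).
Proof. exact: measurableX. Qed.

Lemma rectangles_sub t : 0 <= t ->
  <<s rectangles t >> `<=` (measurable : set (set (R * FT t))).
Proof.
move=> t0; apply: smallest_sub; first exact: sigma_algebra_measurable.
move=> _ [A [E [mA _ FE ->]]]; apply: measurableX => //.
exact/(measurable_sub_sigmaP (filtration_sigma t0)).
Qed.

(** Good sets: those whose trace on the strip is generated by [rectangles t] form a sigma-algebra
    that contains all measurable rectangles. *)
Lemma sub_rectangles t (Z : set (R * Omega)) : 0 <= t ->
  measurable (Z : set (R * FT t)) -> <<s rectangles t >> (strip t `&` Z).
Proof.
move=> t0; rewrite measurable_prod_measurableType.
pose RT := g_sigma_algebraType (rectangles t).
have ms : measurable (strip t : set RT).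
  apply: sub_sigma_algebra; exists `[0, t]%classic, setT; split => //.
  exact: (sub_sigmaT (filtration_sigma t0)).
have -> : <<s rectangles t >> = (measurable : set (set RT)) by [].
apply: (@smallest_sub _ _ _ [set Z | measurable (strip t `&` Z : set RT)]); first split => /=.
- by rewrite setI0.
- move=> A mA; rewrite setTD -setDE.
  rewrite (_ : _ `\` _ = strip t `\` (strip t `&` A)); first exact: measurableD.
  by rewrite setDIr setDv set0U.
- by move=> A mA; rewrite setI_bigcupr; exact: bigcupT_measurable.
move=> _ [A mA] [E /(measurable_sub_sigmaP (filtration_sigma t0)) FE <-] /=.
rewrite -setXI setTI; apply: sub_sigma_algebra.
exists (`[0, t] `&` A), E; split => //; exact: measurableI.
Qed.

(** The rectangles inside the strip generate the trace of the product sigma-algebra on it, so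
    progressive measurability becomes plain measurability on the strip, stable under the usual
    operations. *)
Lemma progressiveP (X : R -> Omega -> R) : progressive F X <->
  forall t, 0 <= t ->
    measurable_fun (strip t : set (R * FT t)) (fun p : R * FT t => X p.1 p.2).
Proof.
have E t (B : set R) : [set p : R * Omega | `[0, t]%classic p.1 /\ B (X p.1 p.2)] =
    strip t `&` (fun p => X p.1 p.2) @^-1` B.
  by apply/seteqP; split=> [p [? ?]|p [[? _] ?]]; split.
split=> h t t0.
  by move=> _ B mB; apply: (rectangles_sub t0); rewrite -E; exact: h.
move=> B mB; rewrite E -(setIid (strip t)) -setIA; apply: (sub_rectangles t0).
by apply: h => //; exact: measurable_strip.
Qed.

Definition half_space : set (R * Omega) := `[0, +oo[%classic `*` setT.

Lemma measurable_half_space : measurable half_space.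
Proof. exact: measurableX. Qed.

Lemma progressive_measurable (X : R -> Omega -> R) : progressive F X ->
  measurable_fun half_space (fun p : R * Omega => X p.1 p.2).
Proof.
move=> pX.
have -> : half_space = \bigcup_n strip n%:R.
  apply/seteqP; split=> [[s w] [/= + _]|[s w] [n _ [/= + _]]].
    rewrite !in_itv/= andbT => s0; exists (Num.truncn s).+1 => //; split => //=.
    by rewrite in_itv/= s0/= ltW//; have /andP[] := truncn_itv s0.
  by rewrite in_itv/= => /andP[s0 _]; split => //=; rewrite in_itv/= s0.
apply/measurable_fun_bigcup => [n|n]; first exact: measurableX.
move=> _ B mB.
have : <<s rectangles n%:R >> [set p : R * Omega | `[0, n%:R]%classic p.1 /\ B (X p.1 p.2)].
  exact: pX.
have sub : <<s rectangles n%:R >> `<=` (measurable : set (set (R * Omega))).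
  apply: smallest_sub; first exact: sigma_algebra_measurable.
  move=> _ [A [E [mA _ FE ->]]]; apply: measurableX => //.
  exact: filtration_sub FE.
move=> /sub; congr measurable.
by apply/seteqP; split=> [p [? ?]|p [[? _] ?]]; split.
Qed.

Lemma progressive_adapted (X : R -> Omega -> R) t : 0 <= t -> progressive F X ->
  measurable_fun [set: FT t] (X t : FT t -> R).
Proof.
move=> t0 /progressiveP/(_ t t0) mX.
have := @measurable_comp _ _ _ _ _ _ (strip t : set (R * FT t)) (fun p : R * FT t => X p.1 p.2)
  setT (fun w : FT t => (t, w)).
apply => //; first exact: measurable_strip.
- by move=> _ [w _ <-]; split => //=; rewrite in_itv/= t0 lexx.
- exact: pair1_measurable.
Qed.

End Progressive.

(** * Progressive measurability of càdlàg paths and of running integrals *)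

Section RightContinuous.
Context {d : measure_display} {Omega : measurableType d} {R : realType}.
Variable F : R -> set (set Omega).
Hypothesis hF : is_filtration F.

Local Notation FT t := (g_sigma_algebraType (F t)).

Lemma cvg_dyadic_above (t : R) : 0 <= t -> dyadic_above n t @[n --> \oo] --> t.
Proof.
move=> t0; apply/cvgrPdist_lt => e e0.
near=> n; have /andP[h1 h2] : t < dyadic_above n t < t + e.
  by near: n; exact: near_dyadic_above.
by rewrite distrC gtr0_norm; lra.
Unshelve. all: by end_near. Qed.

(** Time is discretized from the right, capped at [t] so that every value used is [F t]-measurable.
    The approximation is constant in time on each dyadic cell and converges by right-continuity. *)
Lemma cadlag_progressive (V : R -> Omega -> R) : cadlag V ->
  (forall t, 0 <= t -> measurable_fun [set: FT t] (V t : FT t -> R)) ->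
  progressive F V.
Proof.
move=> cV aV; apply/(progressiveP hF) => t t0.
apply: (@measurable_fun_cvg _ _ _ (strip t : set (R * FT t))
  (fun n p => V (Num.min (dyadic_above n p.1) t) p.2)).
  move=> n.
  pose E i : set (R * FT t) := (`[0, t] `&` `[dyadic n i, dyadic n i.+1[)%classic `*` setT.
  have -> : strip t = \bigcup_i E i.
    apply/seteqP; split=> [[s w] [/= + _]|[s w] [n' _ [/= [? _] _]]]; last by split.
    rewrite in_itv/= => /andP[s0 st]; exists (Num.truncn (s * 2 ^+ n)) => //; split => //=.
    rewrite !in_itv/= s0 st; split => //.
    rewrite ler_pdivrMr ?exprn_gt0// ltr_pdivlMr ?exprn_gt0//.
    exact: truncn_itv (mulr_ge0 s0 (exprn_ge0 n (ler0n _ 2))).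
  apply/measurable_fun_bigcup => [i|i]; first by apply: measurableX => //; exact: measurableI.
  apply: (@eq_measurable_fun _ _ _ _ _ (fun p : R * FT t => V (Num.min (dyadic n i.+1) t) p.2)).
    move=> [s w]; rewrite inE => -[/= [st +] _]; rewrite in_itv/= => si.
    rewrite /dyadic_above (_ : Num.truncn _ = i)//.
    apply/eqP; rewrite truncn_eq; last first.
      by rewrite mulr_ge0 ?exprn_ge0//; move: st; rewrite in_itv/= => /andP[].
    by move: si; rewrite ler_pdivrMr ?exprn_gt0// ltr_pdivlMr ?exprn_gt0.
  apply: measurable_funTS.
  have c0 : 0 <= Num.min (dyadic n i.+1) t by rewrite le_min t0 dyadic_ge0.
  apply: (@measurableT_comp _ _ _ _ _ _ (V (Num.min (dyadic n i.+1) t) : FT t -> R)).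
    by apply: (measurable_fun_filtration_le hF c0 _ (aV _ c0)); rewrite ge_min lexx orbT.
  exact: measurable_snd.
(* At [s = t] the cap makes the sequence constant; for [s < t] the capped times still decrease to
   [s] strictly from the right. *)
move=> [s w] [/= + _]; rewrite in_itv/= => /andP[s0]; rewrite le_eqVlt => /predU1P[->|st].
  under eq_fun do rewrite min_r ?(ltW (dyadic_above_gt _ t0))//.
  exact: cvg_cst.
have [/cvg_at_rightP h _] := cV w s s0; apply: h; split.
  by move=> n; rewrite lt_min st dyadic_above_gt.
apply/cvgrPdist_lt => e e0; near=> n.
have /andP[h1 h2] : s < dyadic_above n s < s + e.
  by near: n; exact: near_dyadic_above.
have h3 : s < Num.min (dyadic_above n s) t by rewrite lt_min h1 st.
have h4 : Num.min (dyadic_above n s) t <= dyadic_above n s by rewrite ge_min lexx.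
by rewrite distrC gtr0_norm; lra.
Unshelve. all: by end_near. Qed.

(** Progressive measurability gives joint measurability with [F t] as second factor, and Tonelli on
    that product yields an [F t]-measurable integral. *)
Lemma running_integral_adapted (A : R -> Omega -> R) (t : R) : 0 <= t -> progressive F A ->
  (forall s w, 0 <= s -> 0 <= A s w) ->
  measurable_fun [set: FT t]
    ((fun w => \int[lebesgue_measure]_(s in `[0%R, t]) (A s w)%:E)%E : FT t -> \bar R).
Proof.
move=> t0 /(progressiveP hF)/(_ t t0) mA A0.
pose f : R * FT t -> \bar R := (fun p => (A p.1 p.2)%:E) \_ (strip t).
have mf : measurable_fun setT f.
  apply/(measurable_restrictT _ _).1; first exact: measurable_strip.
  exact/measurable_EFinP.
have f0 p : (0 <= f p)%E.
  by rewrite /f patchE; case: ifPn => //; rewrite inE => -[/=]; rewrite in_itv/= => /andP[? _] _; rewrite lee_fin A0.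
have := @measurable_fun_fubini_tonelli_G _ _ (measurableTypeR R) (FT t) R lebesgue_measure f mf f0.
apply: eq_measurable_fun => w _.
rewrite /fubini_G [RHS]integral_mkcond; apply: eq_integral => s _.
rewrite /f !patchE; case: ifPn => /=; rewrite ?inE ?notin_setE /=.
  by case=> h _; rewrite mem_set.
by move=> h; case: ifPn => //; rewrite inE/= => h'; exfalso; apply: h.
Qed.

End RightContinuous.

(** * Càdlàg versions of closed martingales *)

Section EventuallyLarge.
Local Open Scope ereal_scope.

Lemma limn_einf_ge (R : realType) (u : (\bar R)^nat) l n0 :
  (forall n, (n0 <= n)%N -> l <= u n) -> l <= limn_einf u.
Proof.
move=> h; rewrite limn_einf_lim; apply: lime_ge; first exact: is_cvg_einfs.
near=> n; apply: le_ereal_inf_tmp => _ [k /= nk <-]; apply: h.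
by apply: leq_trans nk; near: n; exists n0.
Unshelve. all: by end_near. Qed.

Lemma limn_einf_le (R : realType) (u : (\bar R)^nat) l :
  (forall n, u n <= l) -> limn_einf u <= l.
Proof.
move=> ul; rewrite limn_einf_lim; apply: lime_le; first exact: is_cvg_einfs.
apply: nearW => n; apply: le_trans (ul n).
by apply: ereal_inf_lbound; exists n => /=.
Qed.

Lemma measurable_fun_limn_einf d (T : measurableType d) (R : realType)
    (D : set T) (f : nat -> T -> \bar R) :
  (forall n, measurable_fun D (f n)) -> measurable_fun D (fun x => limn_einf (f ^~ x)).
Proof.
move=> mf.
have -> : (fun x => limn_einf (f ^~ x)) = (fun x => - limn_esup (fun n => - f n x)).
  by apply/funext => x; rewrite -limn_einfN; congr limn_einf; apply/funext => n; rewrite /= oppeK.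
apply: measurableT_comp => //; apply: measurable_fun_limn_esup => n.
exact: measurableT_comp.
Qed.

Context {d : measure_display} {Omega : measurableType d} {R : realType}.
Variable P : probability Omega R.

Definition eventually_ge (u : nat -> Omega -> nat) (K : nat) :=
  [set w | exists n0, forall n, (n0 <= n)%N -> (K <= u n w)%N].

(** Markov's inequality for the lower limit of the counts, which is at least [K] on the event and
    whose integral Fatou bounds by [C]. *)
Lemma eventually_ge_measure (u : nat -> Omega -> nat) (C : R) K :
  (forall n, measurable_fun setT (fun w => (u n w)%:R : R)) ->
  (forall n, \int[P]_w ((u n w)%:R)%:E <= C%:E) ->
  measurable (eventually_ge u K) /\ (K%:R)%:E * P (eventually_ge u K) <= C%:E.
Proof.
move=> mu uC.
have mZ : measurable (eventually_ge u K).
  have -> : eventually_ge u K =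
      \bigcup_n0 \bigcap_(n in [set n | (n0 <= n)%N]) [set w | (K%:R : R) <= (u n w)%:R]%R.
    apply/seteqP; split=> [w [n0 h]|w [n0 _ h]].
      by exists n0 => // n /= ?; rewrite ler_nat; exact: h.
    by exists n0 => n n0n; rewrite -(ler_nat R); exact: h.
  apply: bigcupT_measurable => n0; apply: bigcap_measurableType => n _.
  have := measurable_fun_ler (measurable_cst (K%:R : R)) (mu n).
  by move=> /(_ measurableT [set true]); rewrite setTI; exact.
split => //.
rewrite -integral_cst//.
apply: (@le_trans _ _ (\int[P]_w limn_einf (fun n => ((u n w)%:R : R)%:E))).
  rewrite integral_mkcond; apply: ge0_le_integral => //.
  - by move=> w _; rewrite patchE; case: ifP => // _; rewrite lee_fin.
  - by apply/(measurable_restrictT _ _).1.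
  - by apply: measurable_fun_limn_einf => n; exact/measurable_EFinP.
  - move=> w _; rewrite patchE; case: ifPn => [|_].
      rewrite inE => -[n0 h]; apply: (limn_einf_ge (n0 := n0)) => n /h.
      by rewrite lee_fin ler_nat.
    by apply: (limn_einf_ge (n0 := 0%N)) => n _; rewrite lee_fin.
have mEu n : measurable_fun setT (fun w => ((u n w)%:R : R)%:E).
  exact/measurable_EFinP.
apply: le_trans (fatou _ _ mEu _) _ => //.
exact: limn_einf_le.
Qed.

Lemma negligible_small (Z : set Omega) :
  (forall e : R, (0 < e)%R -> exists A, [/\ measurable A, Z `<=` A & P A <= e%:E]) ->
  P.-negligible Z.
Proof.
move=> h.
have /choice[A hA] : forall n : nat, exists A,
    [/\ measurable A, Z `<=` A & P A <= (n.+1%:R^-1)%R%:E].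
  by move=> n; apply: h; rewrite invr_gt0.
exists (\bigcap_n A n).
have mA : measurable (\bigcap_n A n) by apply: bigcapT_measurable => n; case: (hA n).
split => //; last by move=> w Zw n _; case: (hA n) => _ + _; exact.
apply/eqP; rewrite eq_le measure_ge0 andbT; apply/lee_addgt0Pr => e e0.
rewrite add0e.
pose n := Num.truncn e^-1.
have [mAn _ PA] := hA n.
apply: (@le_trans _ _ (P (A n))).
  by rewrite le_measure ?inE//; exact: bigcap_inf.
apply: le_trans PA _; rewrite lee_fin invf_ple ?posrE//.
by apply/ltW; have /andP[] := truncn_itv (ltW (eqbRL (invr_gt0 e) e0)).
Qed.

End EventuallyLarge.

Lemma cvg_min_cst {R : realType} (u : R^nat) (l c : R) :
  u @ \oo --> l -> Num.min (u n) c @[n --> \oo] --> Num.min l c.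
Proof.
move=> ul; apply/cvgrPdist_lt => e e0.
have /cvgrPdist_lt/(_ _ e0) := ul; apply: filterS => n.
rewrite !ltr_norml => /andP[? ?].
by have [?|?] := leP l c; have [?|?] := leP (u n) c; apply/andP; split; lra.
Qed.

Lemma negligible_bigcup_count d (T : measurableType d) (R : realType)
    (mu : {measure set T -> \bar R}) (I : countType) (A : I -> set T) :
  (forall i, mu.-negligible (A i)) -> mu.-negligible (\bigcup_i A i).
Proof.
move=> nA.
apply: (@negligibleS _ _ _ mu (\bigcup_n (if unpickle n is Some i then A i else set0))).
  by move=> w [i _ Ai]; exists (pickle i) => //; rewrite pickleK.
apply: negligible_bigcup => n; case: unpickle => [i|]; first exact: nA.
exact: negligible_set0.
Qed.

(** Rational levels keep the family of conditions countable. A bound on arbitrarily fine grids,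
    instead of all of them, is what the negation of [eventually_ge] provides. *)
Definition regularizable {R : realType} (f : R -> R) :=
  (forall T : nat, exists B, forall q, isdyadic q -> q <= T%:R -> f q <= B) /\
  (forall (a b : rat) (T : nat), ratr a < ratr b :> R -> exists K : nat,
    forall n0, exists2 n, (n0 <= n)%N &
    (upcrossings (ratr a) (ratr b) (f \o dyadic n) (T * 2 ^ n) <= K)%N).

(** * Regularization of a martingale closed by an integrable variable *)

Section MartingaleRegularization.
Context {d : measure_display} {Omega : measurableType d} {R : realType}.
Variables (P : probability Omega R) (F : R -> set (set Omega)).
Hypotheses (hF : is_filtration F) (cF : filtration_complete P F).
Hypothesis rF : filtration_right_continuous F.
Variable xi : Omega -> R.
Hypotheses (mxi : measurable_fun setT xi) (xi0 : forall w, 0 <= xi w).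
Hypothesis xioo : (\int[P]_w (xi w)%:E < +oo)%E.

Local Notation FT t := (g_sigma_algebraType (F t)).

Section fix_martingale.
Variable N : R -> Omega -> R.
Hypothesis aN : forall t, 0 <= t -> measurable_fun [set: FT t] (N t : FT t -> R).
Hypothesis N0 : forall t w, 0 <= N t w.
Hypothesis NE : forall t, 0 <= t -> forall A, F t A ->
  (\int[P]_(w in A) (N t w)%:E = \int[P]_(w in A) (xi w)%:E)%E.

Local Notation x n w := (fun i => N (dyadic n i) w).

Lemma adapted_measurable t (f : Omega -> R) : 0 <= t ->
  measurable_fun [set: FT t] (f : FT t -> R) -> measurable_fun setT f.
Proof.
move=> t0; apply: (measurable_fun_sub_sigma (filtration_sigma hF t0) (filtration_sub hF t0)).
exact: (sub_sigmaT (filtration_sigma hF t0)).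
Qed.

(** The decision at an index uses only values up to that time, so the martingale property applies on
    the set where the position is held. *)
Lemma measurable_holding a b n k :
  measurable_fun [set: FT (dyadic n k)]
    ((fun w => holding a b (x n w) k) : FT (dyadic n k) -> bool).
Proof.
elim: k => [|k ih] /=.
  by apply: measurable_fun_ler => //; apply: aN; exact: dyadic_ge0.
have mN : measurable_fun [set: FT (dyadic n k.+1)] (N (dyadic n k.+1) : FT (dyadic n k.+1) -> R).
  by apply: aN; exact: dyadic_ge0.
apply: measurable_fun_ifT; [|exact: measurable_fun_ltr|exact: measurable_fun_ler].
apply: measurable_fun_filtration_le ih; [exact: hF|exact: dyadic_ge0|exact: dyadic_le].
Qed.

Lemma measurable_upcrossings a b n k :
  measurable_fun setT (fun w => (upcrossings a b (x n w) k)%:R : R).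
Proof.
have mN i : measurable_fun setT (N (dyadic n i)).
  by apply: (adapted_measurable (t := dyadic n i)); [|apply: aN]; exact: dyadic_ge0.
have mh k' : measurable_fun setT (fun w => holding a b (x n w) k').
  elim: k' => [|k' ih] /=; first exact: measurable_fun_ler.
  apply: measurable_fun_ifT => //; [exact: measurable_fun_ltr|exact: measurable_fun_ler].
elim: k => [|k ih] /=; first exact: measurable_cst.
under eq_fun do rewrite natrD.
apply: measurable_funD => //.
have -> : (fun w => ((holding a b (x n w) k && (b <= N (dyadic n k.+1) w))%R)%:R : R) =
    (fun w => if holding a b (x n w) k && (b <= N (dyadic n k.+1) w) then 1 else 0 : R).
  by apply/funext => w; case: ifP.
apply: measurable_fun_ifT => //; apply: measurable_and => //.
exact: measurable_fun_ler.
Qed.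

(** A strategy decided in advance has mean gain 0: the two sums of [upcrossings_le_gain] integrate
    to the same finite [S], which cancels. The bound is uniform in the mesh and in the number of
    steps. *)
Lemma doob_upcrossing a b n k : a < b ->
  (\int[P]_w ((upcrossings a b (x n w) k)%:R)%:E <= (`|a| / (b - a))%:E)%E.
Proof.
move=> ab.
have mN i : measurable_fun setT (N (dyadic n i)).
  by apply: (adapted_measurable (t := dyadic n i)); [|apply: aN]; exact: dyadic_ge0.
pose H i : set Omega := [set w | holding a b (x n w) i].
have FH i : F (dyadic n i) (H i).
  apply/(measurable_sub_sigmaP (filtration_sigma hF (dyadic_ge0 n i))).
  have := @measurable_holding a b n i.
  by move=> /(_ measurableT [set true]); rewrite setTI; exact.
have mH i : measurable (H i) by apply: (filtration_sub hF (dyadic_ge0 n i)).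
have mholdN i j : measurable_fun setT (fun w => (holding a b (x n w) i)%:R * N (dyadic n j) w).
  apply: measurable_funM => //.
  have -> : (fun w => (holding a b (x n w) i)%:R : R) = \1_(H i).
    by apply/funext => w; rewrite indicE; case: (boolP (holding _ _ _ _)) => h;
       [rewrite mem_set|rewrite memNset//; exact/negP].
  exact: measurable_indic.
have intH i j : (i <= j)%N -> (\int[P]_w ((holding a b (x n w) i)%:R * N (dyadic n j) w)%:E =
    \int[P]_(w in H i) (xi w)%:E)%E.
  move=> ij; rewrite -(NE (dyadic_ge0 n j)); last first.
    exact: (filtration_le hF (dyadic_ge0 n i) (dyadic_le n ij)).
  rewrite [RHS]integral_mkcond; apply: eq_integral => w _; rewrite patchE.
  case: ifPn => [|]; first by rewrite inE /H/= => ->; rewrite mul1r.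
  by rewrite notin_setE /H/= => /negP/negbTE ->; rewrite mul0r.
have fin i : (\int[P]_(w in H i) (xi w)%:E \is a fin_num)%E.
  rewrite ge0_fin_numE; last by apply: integral_ge0 => w _; rewrite lee_fin.
  apply: le_lt_trans xioo; apply: ge0_subset_integral => //.
  + exact/measurable_EFinP.
  + by move=> w _; rewrite lee_fin.
pose S := (\sum_(i < k) \int[P]_(w in H i) (xi w)%:E)%E.
have finS : S \is a fin_num by apply/sum_fin_numP => i _ _.
have ba : 0 < b - a by rewrite subr_gt0.
(* Used with the identity and the successor: the price at the start and at the end of each step. *)
have sumE (l : nat -> nat) : (forall i, (i <= l i)%N) ->
    (\int[P]_w (\sum_(i < k) (holding a b (x n w) i)%:R * N (dyadic n (l i)) w)%:E = S)%E.
  move=> il; under eq_integral do rewrite -sumEFin.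
  rewrite ge0_integral_sum//.
  - by apply: eq_bigr => i _; exact: intH.
  - by move=> i; exact/measurable_EFinP.
  - by move=> i w _; rewrite lee_fin mulr_ge0.
have msum l : measurable_fun setT (fun w => \sum_(i < k) (holding a b (x n w) i)%:R * N (dyadic n (l i)) w).
  by apply: measurable_sum => i.
have : ((b - a)%:E * (\int[P]_w ((upcrossings a b (x n w) k)%:R)%:E) + S <= S + `|a|%:E)%E.
  rewrite -{1}(sumE id)// -(sumE succn)// -ge0_integralZl_EFin//; last first.
  - exact: ltW.
  - exact/measurable_EFinP/measurable_upcrossings.
  rewrite -ge0_integralD//; last 4 first.
  - by move=> w _; rewrite -EFinM lee_fin mulr_ge0// ltW.
  - apply: emeasurable_funM => //; exact/measurable_EFinP/measurable_upcrossings.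
  - by move=> w _; rewrite lee_fin sumr_ge0// => i _; rewrite mulr_ge0.
  - exact/measurable_EFinP.
  have -> : `|a|%:E = (\int[P]_w (cst (`|a|%:E : \bar R) w))%E.
    transitivity (`|a|%:E * P setT)%E; last exact/esym/integral_cst.
    by rewrite probability_setT mule1.
  rewrite -ge0_integralD//; [|
    by move=> w _; rewrite lee_fin sumr_ge0// => i _; rewrite mulr_ge0|
    exact/measurable_EFinP|by move=> w _; rewrite lee_fin].
  apply: ge0_le_integral => //.
  - move=> w _; rewrite -EFinM -EFinD lee_fin addr_ge0//; first by rewrite mulr_ge0// ltW.
    by apply: sumr_ge0 => i _; rewrite mulr_ge0.
  - apply: emeasurable_funD; last exact/measurable_EFinP.
    apply: emeasurable_funM => //; exact/measurable_EFinP/measurable_upcrossings.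
  - by apply: emeasurable_funD => //; exact/measurable_EFinP.
  - move=> w _; rewrite -EFinM -!EFinD lee_fin.
    by apply: upcrossings_le_gain => i; exact: N0.
rewrite [leRHS]addeC leeD2rE// EFinM muleC -lee_pdivlMr//.
Qed.

Local Notation upc T a b := (fun n w => upcrossings a b (x n w) (T * 2 ^ n)).

Lemma eventually_upcrossings_small (a b : R) T K : a < b ->
  measurable (eventually_ge (upc T a b) K) /\
  ((K%:R)%:E * P (eventually_ge (upc T a b) K) <= (`|a| / (b - a))%:E)%E.
Proof.
move=> ab; apply: eventually_ge_measure => n; first exact: measurable_upcrossings.
exact: doob_upcrossing.
Qed.

Lemma infinite_upcrossings_negligible (a b : R) T : a < b ->
  P.-negligible [set w | forall K, eventually_ge (upc T a b) K w].
Proof.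
move=> ab; apply: negligible_small => e e0.
pose C := `|a| / (b - a).
have C0 : 0 <= C by rewrite divr_ge0// subr_ge0 ltW.
(* Chosen so that [C / K <= e]. *)
pose K := (Num.truncn (C / e)).+1.
have [mK PK] := eventually_upcrossings_small T K ab.
exists (eventually_ge (upc T a b) K); split => //.
have K0 : (0 : R) < K%:R by rewrite ltr0n.
have K0' : (0 < (K%:R : R)%:E)%E by rewrite lte_fin.
rewrite -(lee_pmul2l _ K0')//.
apply: le_trans PK _; rewrite -EFinM lee_fin -ler_pdivrMr//.
by apply/ltW; have /andP[] := truncn_itv (divr_ge0 C0 (ltW e0)).
Qed.

(* A path starting below [a] and unbounded on dyadic times has an upcrossing of
   [[a, b]] for every [b], an event of probability at most [a / (b - a)]. *)
Lemma unbounded_negligible (a T : nat) :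
  P.-negligible [set w | forall b : nat, (a < b)%N -> eventually_ge (upc T a%:R b%:R) 1 w].
Proof.
apply: negligible_small => e e0.
(* Chosen so that [a / (b - a) <= e]. *)
pose b := (a + (Num.truncn (a%:R / e)).+1)%N.
have ab : (a < b)%N by rewrite /b -addSnnS leq_addr.
have ab' : (a%:R : R) < b%:R by rewrite ltr_nat.
have [mK PK] := eventually_upcrossings_small T 1 ab'.
exists (eventually_ge (upc T a%:R b%:R) 1); split => //; first by move=> w /(_ b ab).
rewrite mul1e in PK; apply: le_trans PK _; rewrite lee_fin.
rewrite /b natrD addrAC subrr add0r ger0_norm// ler_pdivrMr ?ltr0n// mulrC -ler_pdivrMr//.
by apply/ltW; have /andP[] := truncn_itv (divr_ge0 (ler0n R a) (ltW e0)).
Qed.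

Lemma negligible_not_regularizable :
  P.-negligible (~` [set w | regularizable (fun t => N t w)]).
Proof.
have n1 := @negligible_bigcup_count _ _ _ P (nat * nat)%type
  (fun i => [set w | forall b : nat, (i.1 < b)%N -> eventually_ge (upc i.2 i.1%:R b%:R) 1 w])
  (fun i => unbounded_negligible i.1 i.2).
have n2 := @negligible_bigcup_count _ _ _ P (rat * rat * nat)%type
  (fun i => if pselect (ratr i.1.1 < ratr i.1.2 :> R) then
     [set w | forall K, eventually_ge (upc i.2 (ratr i.1.1) (ratr i.1.2)) K w] else set0).
have {}n2 := n2 (fun i => match pselect _ as s return P.-negligible (if s then _ else _) with
   | left h => infinite_upcrossings_negligible i.2 h | right _ => negligible_set0 _ end).
apply: negligibleS (negligibleU n1 n2) => w; apply: contra_notP => /not_orP[w1 w2].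
split.
  move=> T.
  (* With the start below [a], a value above [b] at a dyadic time before [T] would complete an
     upcrossing of [[a, b]] on every fine grid; hence [b] bounds the path. *)
  have [a aN0] : exists a : nat, N 0 w <= a%:R.
    by exists (Num.truncn (N 0 w)).+1; apply/ltW; have /andP[] := truncn_itv (N0 0 w).
  have [b ab nb] : exists2 b : nat, (a < b)%N & ~ eventually_ge (upc T a%:R b%:R) 1 w.
    apply: contrapT => h; apply: w1; exists (a, T) => // b /= ab.
    by apply: contrapT => h'; apply: h; exists b.
  exists b%:R => q Dq qT; rewrite leNgt; apply/negP => bq; apply: nb.
  have [n0 hn0] := isdyadic_eventually Dq; exists n0 => n /hn0[i qi].
  have ab' : (a%:R : R) < b%:R by rewrite ltr_nat.
  have iT : (i <= T * 2 ^ n)%N.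
    rewrite leqNgt -(ltr_dyadic (R := R) n) -qi -leNgt; apply: le_trans qT _.
    by rewrite /dyadic natrM natrX mulfK// expf_neq0// pnatr_eq0.
  have aN0' : x n w 0%N <= a%:R by rewrite /= /dyadic mul0r.
  have i0 : (0 < i)%N.
    case: i qi {iT} => // qi; move: bq; rewrite qi /dyadic mul0r => bq.
    by move: (lt_le_trans bq aN0); rewrite ltr_nat ltnNge ltnW.
  apply: leq_trans (upcrossings_nd _ _ _ iT).
  apply: leq_ltn_trans (upcrossings_lt ab' i0 aN0' _) => //.
  by rewrite /= -qi ltW.
move=> a b T ab; apply: contrapT => h; apply: w2; exists (a, b, T) => //=.
case: pselect => // _ K /=; apply: contrapT => h'; apply: h; exists K => n0.
apply: contrapT => h''; apply: h'; exists n0 => n n0n.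
by rewrite leqNgt; apply/negP => nK; apply: h''; exists n => //; exact: ltnW.
Qed.

(** The value 0 on exceptional paths makes every path càdlàg, as [cadlag] asks. *)
Definition regularized (t : R) (w : Omega) : R :=
  if pselect (regularizable (fun t => N t w)) then right_regularization (fun t => N t w) t else 0.

Lemma regularized_cadlag : cadlag regularized.
Proof.
move=> w t t0; rewrite /regularized.
have [h|nh] := pselect (regularizable (fun t => N t w)).
  have [h1 h2] := right_regularization_cadlag (N0 ^~ w) h.1 h.2 t0.
  by case: pselect.
case: pselect => // nh'.
by split; [exact: cvg_cst|move=> _; exists 0; exact: cvg_cst].
Qed.

Lemma regularized_ge0 t w : 0 <= t -> 0 <= regularized t w.
Proof.
move=> t0; rewrite /regularized; case: pselect => // -[h1 h2].
exact: (right_regularization_ge0 (N0 ^~ w) h1 h2 t0).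
Qed.

Lemma regularized_cvg t : 0 <= t ->
  {ae P, forall w, N (dyadic_above n t) w @[n --> \oo] --> regularized t w}.
Proof.
move=> t0; have good : {ae P, forall w, regularizable (fun t => N t w)}.
  exact: negligible_not_regularizable.
apply: filterS good => w.
rewrite /regularized; case: pselect => // -[h1 h2] _.
exact: (right_regularization_cvg (N0 ^~ w) h1 h2 t0).
Qed.

(** By right-continuity of the filtration it suffices to be [F s]-measurable for each [s > t]. The
    approximating times eventually lie below [s], and the exceptional null set belongs to [F 0] by
    completeness. *)
Lemma regularized_adapted t : 0 <= t ->
  measurable_fun [set: FT t] (regularized t : FT t -> R).
Proof.
move=> t0; apply/(adaptedP (filtration_sigma hF t0)) => B mB.
rewrite (rF t0) => s /=; rewrite in_itv/= andbT => ts.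
have s0 : 0 <= s by apply: le_trans (ltW ts).
move: B mB; apply/(adaptedP (filtration_sigma hF s0)).
have [n0 _ hn0] := near_dyadic_above t0 (eqbRL (subr_gt0 t s) ts).
have mgood : measurable ([set w | regularizable (fun t => N t w)] : set (FT s)).
  rewrite -[X in measurable X]setCK; apply: measurableC.
  apply/(measurable_sub_sigmaP (filtration_sigma hF s0)).
  by apply: (filtration_le hF _ s0) => //; apply: cF; exact: negligible_not_regularizable.
(* The shift by [n0] keeps all the times [dyadic_above (n + n0) t] below [s]. *)
apply: (@measurable_fun_cvg _ _ _ [set: FT s] (fun n w =>
    \1_[set w | regularizable (fun t => N t w)] w * N (dyadic_above (n + n0) t) w)).
  move=> n; apply: measurable_funM; first exact: measurable_indic.
  have /andP[h1 h2] := hn0 (n + n0)%N (leq_addl _ _).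
  have h3 : 0 <= dyadic_above (n + n0) t by exact: dyadic_ge0.
  by apply: (measurable_fun_filtration_le hF h3 _ (aN h3)); lra.
move=> w _; rewrite /regularized indicE; case: pselect => [h|h].
  rewrite mem_set//; under eq_fun do rewrite mul1r.
  have := right_regularization_cvg (N0 ^~ w) h.1 h.2 t0.
  by rewrite -(cvg_shiftn n0).
rewrite memNset//; under eq_fun do rewrite mul0r.
exact: cvg_cst.
Qed.

(** Uniform integrability of a closed martingale: on the [F t]-set where [N t > c], the excess of
    [N t] over [c] integrates like that of [xi]. The last term is independent of [t]. *)
Lemma martingale_truncation t (c : R) A : 0 <= t -> 0 <= c -> F t A ->
  (\int[P]_(w in A) (xi w)%:E <= \int[P]_(w in A) (Num.min (N t w) c)%:E +
     \int[P]_w (Num.max (xi w - c) 0)%:E)%E.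
Proof.
move=> t0 c0 FA; rewrite -(NE t0)//.
have mN : measurable_fun setT (N t) by apply: adapted_measurable (aN t0).
have FE : F t [set w | c < N t w].
  apply/(measurable_sub_sigmaP (filtration_sigma hF t0)).
  have := measurable_fun_ltr (measurable_cst c) (aN t0).
  by move=> /(_ measurableT [set true]); rewrite setTI; exact.
set E := [set w | c < N t w] in FE.
have mA : measurable A by exact: (filtration_sub hF t0).
have mE : measurable E by exact: (filtration_sub hF t0).
have FAE : F t (A `&` E).
  apply/(measurable_sub_sigmaP (filtration_sigma hF t0)).
  by apply: measurableI; apply/(measurable_sub_sigmaP (filtration_sigma hF t0)).
have mAE : measurable (A `&` E) by exact: measurableI.
have mADE : measurable (A `\` E) by exact: measurableD.
have mEN : measurable_fun setT (fun w => (N t w)%:E) by exact/measurable_EFinP.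
have mEX : measurable_fun setT (fun w => (xi w)%:E) by exact/measurable_EFinP.
have mmin : measurable_fun setT (fun w => (Num.min (N t w) c)%:E).
  exact/measurable_EFinP/measurable_minr.
have mmax : measurable_fun setT (fun w => (Num.max (xi w - c) 0)%:E).
  apply/measurable_EFinP/measurable_maxr => //; exact: measurable_funB.
have min0 w : 0 <= Num.min (N t w) c by rewrite le_min N0.
have dj : [disjoint A `&` E & A `\` E].
  by apply/disj_set2P/seteqP; split=> // w [[_ ?] [_ ?]].
rewrite -[in leLHS](setUIDK A E) -[X in (_ <= \int[P]_(w in X) _ + _)%E](setUIDK A E).
rewrite !ge0_integral_setU//; [|exact: measurable_funTS|by move=> *; rewrite lee_fin|
  exact: measurable_funTS|by move=> *; rewrite lee_fin].
rewrite addeAC; apply: leeD; last first.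
  apply: ge0_le_integral => //; [by move=> *; rewrite lee_fin|exact: measurable_funTS..|].
  by move=> w [_ /negP]; rewrite -leNgt => wc; rewrite lee_fin min_l.
rewrite (NE t0)//.
apply: (@le_trans _ _ (\int[P]_(w in A `&` E) ((Num.min (N t w) c)%:E + (Num.max (xi w - c) 0)%:E))%E).
  apply: ge0_le_integral => //.
  - by move=> *; rewrite lee_fin.
  - exact: measurable_funTS.
  - by apply: measurable_funTS; exact: emeasurable_funD.
  - move=> w [_ /= wc]; rewrite -EFinD lee_fin min_r ?(ltW wc)//.
    have : xi w - c <= Num.max (xi w - c) 0 by rewrite le_max lexx.
    lra.
rewrite ge0_integralD//; first last.
- exact: measurable_funTS.
- by move=> w _; rewrite lee_fin le_max lexx orbT.
- exact: measurable_funTS.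
- by move=> *; rewrite lee_fin.
apply: leeD => //; apply: ge0_subset_integral => //.
by move=> w _; rewrite lee_fin le_max lexx orbT.
Qed.

Lemma integral_excess_cvg0 :
  (\int[P]_w (Num.max (xi w - n%:R) 0)%:E)%E @[n --> \oo] --> 0%E.
Proof.
have [] // := @dominated_convergence _ _ _ P setT measurableT
  (fun n w => (Num.max (xi w - n%:R) 0)%:E) (cst 0%E) (EFin \o xi).
- move=> n; apply/measurable_EFinP/measurable_maxr => //; exact: measurable_funB.
- apply: aeW => w _; apply: cvg_near_cst; exists (Num.truncn (xi w)).+1 => // n /= wn.
  congr EFin; apply: max_r; rewrite subr_le0.
  have /andP[_ h] := truncn_itv (xi0 w).
  by apply: le_trans (ltW h) _; rewrite ler_nat.
- apply/integrableP; split; first exact/measurable_EFinP.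
  by under eq_integral do rewrite /= ger0_norm//.
- apply: aeW => w n _; rewrite /= lee_fin ger0_norm; last by rewrite le_max lexx orbT.
  by rewrite ge_max xi0 andbT lerBlDr lerDl.
by move=> _ _; rewrite integral_cst// mul0e.
Qed.

(** Almost sure convergence along [dyadic_above n t] does not by itself move integrals to the limit.
    Truncation at a level makes dominated convergence available, and [martingale_truncation]
    controls the remainder. *)
Lemma regularizedE t A : 0 <= t -> F t A ->
  (\int[P]_(w in A) (regularized t w)%:E = \int[P]_(w in A) (xi w)%:E)%E.
Proof.
move=> t0 FA.
have mA : measurable A by exact: (filtration_sub hF t0).
pose q n := dyadic_above n t.
have q0 n : 0 <= q n by exact: dyadic_ge0.
have tq n : t <= q n by apply/ltW; exact: dyadic_above_gt.
have FqA n : F (q n) A by exact: (filtration_le hF t0 (tq n)).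
have mN n : measurable_fun setT (N (q n)) by exact: adapted_measurable (aN (q0 n)).
have mM : measurable_fun setT (regularized t).
  exact: adapted_measurable (regularized_adapted t0).
have M0 w : 0 <= regularized t w by exact: regularized_ge0.
have NM := regularized_cvg t0.
have mmin c : measurable_fun A (fun w => (Num.min (regularized t w) c)%:E).
  exact/measurable_funTS/measurable_EFinP/measurable_minr.
have min_cvg (c : R) : 0 <= c -> (\int[P]_(w in A) (Num.min (N (q n) w) c)%:E)%E @[n --> \oo] -->
    (\int[P]_(w in A) (Num.min (regularized t w) c)%:E)%E.
  move=> c0; have [] // := @dominated_convergence _ _ _ P A mA
    (fun n w => (Num.min (N (q n) w) c)%:E) (fun w => (Num.min (regularized t w) c)%:E) (EFin \o cst c).
  - by move=> n; exact/measurable_funTS/measurable_EFinP/measurable_minr.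
  - apply: filterS NM => w cw _; apply: cvg_EFin; first exact: nearW.
    exact: cvg_min_cst.
  - exact: finite_measure_integrable_cst.
  - apply: aeW => w n _; rewrite /= lee_fin ger0_norm ?le_min ?N0//.
    by rewrite ge_min lexx orbT.
have le_c n (c : R) : 0 <= c ->
    (\int[P]_(w in A) (Num.min (N (q n) w) c)%:E <= \int[P]_(w in A) (xi w)%:E)%E.
  move=> c0; rewrite -(NE (q0 n) (FqA n)); apply: ge0_le_integral => //.
  - by move=> w _; rewrite lee_fin le_min N0.
  - exact/measurable_funTS/measurable_EFinP/measurable_minr.
  - exact/measurable_funTS/measurable_EFinP.
  - by move=> w _; rewrite lee_fin ge_min lexx.
(* Upper bound: the truncations at [n] increase to the regularized value, and each is a limit of
   truncations of [N] whose integrals stay below that of [xi]. *)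
apply/eqP; rewrite eq_le; apply/andP; split.
  have cv : (\int[P]_(w in A) (Num.min (regularized t w) n%:R)%:E)%E @[n --> \oo] -->
      (\int[P]_(w in A) (regularized t w)%:E)%E.
    apply: cvg_integral_nondecreasing => //.
    - by move=> n w _; rewrite lee_fin le_min M0 ler0n.
    - move=> w _ n m nm; rewrite lee_fin le_min ge_min lexx/= ge_min.
      by rewrite ler_nat nm orbT.
    - move=> w _; apply: cvg_near_cst; exists (Num.truncn (regularized t w)).+1 => // n /= wn.
      congr EFin; apply: min_l.
      have /andP[_ h] := truncn_itv (M0 w).
      by apply: le_trans (ltW h) _; rewrite ler_nat.
  apply: (cvge_to_le cv); apply: nearW => n.
  by apply: (cvge_to_le (min_cvg _ (ler0n _ n))); apply: nearW => m; exact: le_c.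
(* Lower bound: truncating at [n] loses at most the mean excess of [xi] over [n], uniformly in the
   approximating times, and this tends to 0. *)
have cv : ((\int[P]_(w in A) (regularized t w)%:E) +
    (\int[P]_w (Num.max (xi w - n%:R) 0)%:E))%E @[n --> \oo] -->
    ((\int[P]_(w in A) (regularized t w)%:E) + 0)%E.
  apply: cvgeD; [|exact: cvg_cst|exact: integral_excess_cvg0].
  by rewrite ge0_adde_def// inE// integral_ge0// => w _; rewrite lee_fin.
rewrite adde0 in cv; apply: (cvge_to_ge cv); apply: nearW => n.
have cv2 : ((\int[P]_(w in A) (Num.min (N (q m) w) n%:R)%:E) +
    (\int[P]_w (Num.max (xi w - n%:R) 0)%:E))%E @[m --> \oo] -->
    ((\int[P]_(w in A) (Num.min (regularized t w) n%:R)%:E) +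
    (\int[P]_w (Num.max (xi w - n%:R) 0)%:E))%E.
  apply: cvgeD; [|exact: min_cvg|exact: cvg_cst].
  rewrite ge0_adde_def// inE integral_ge0// => w _; rewrite lee_fin ?le_min ?M0 ?ler0n//.
  by rewrite le_max lexx orbT.
apply: (@le_trans _ _ ((\int[P]_(w in A) (Num.min (regularized t w) n%:R)%:E) +
    (\int[P]_w (Num.max (xi w - n%:R) 0)%:E))%E).
  apply: (cvge_to_ge cv2); apply: nearW => m.
  exact: martingale_truncation.
apply: leeD => //; apply: ge0_le_integral => //.
- by move=> w _; rewrite lee_fin le_min M0 ler0n.
- exact/measurable_funTS/measurable_EFinP.
- by move=> w _; rewrite lee_fin ge_min lexx.
Qed.

End fix_martingale.

Theorem martingale_regularization : exists M : R -> Omega -> R,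
  [/\ cadlag M, forall t w, 0 <= t -> 0 <= M t w,
    forall t, 0 <= t -> measurable_fun [set: FT t] (M t : FT t -> R) &
    forall t A, 0 <= t -> F t A ->
      (\int[P]_(w in A) (M t w)%:E = \int[P]_(w in A) (xi w)%:E)%E].
Proof.
have : forall t : R, exists Z : Omega -> R, [/\
    (0 <= t -> measurable_fun [set: FT t] (Z : FT t -> R)),
    (forall w, 0 <= Z w) &
    (0 <= t -> forall A, F t A ->
       (\int[P]_(w in A) (Z w)%:E = \int[P]_(w in A) (xi w)%:E)%E)].
  move=> t; have [t0|t0] := leP 0 t; last first.
    (* A default at negative times, so that the choice ranges over all reals. *)
    by exists (cst 0); split => //.
  have [Z [mZ Z0 ZE]] := cond_exp_exists (filtration_sigma hF t0) (filtration_sub hF t0)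
    ((measurable_EFinP _ _).2 mxi) xi0 xioo.
  by exists Z; split.
move=> /choice[N hN].
have aN t : 0 <= t -> measurable_fun [set: FT t] (N t : FT t -> R) by case: (hN t).
have N0 t w : 0 <= N t w by case: (hN t).
have NE t : 0 <= t -> forall A, F t A ->
    (\int[P]_(w in A) (N t w)%:E = \int[P]_(w in A) (xi w)%:E)%E by case: (hN t).
exists (regularized N); split.
- exact: regularized_cadlag.
- by move=> t w; exact: regularized_ge0.
- by move=> t; exact: regularized_adapted.
- by move=> t A; exact: regularizedE.
Qed.

End MartingaleRegularization.

(** * Potentials of progressive processes *)

Section JointProcesses.
Context {d : measure_display} {Omega : measurableType d} {R : realType}.
Variable P : probability Omega R.
Variable A : R -> Omega -> R.
Hypothesis mA : measurable_fun half_space (fun p : R * Omega => A p.1 p.2).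
Hypothesis A0 : forall t w, 0 <= t -> 0 <= A t w.

Local Notation leb := (@lebesgue_measure R).

Lemma measurable_section (w : Omega) (D : set R) : measurable D -> D `<=` `[0, +oo[%classic ->
  measurable_fun D (fun s => A s w).
Proof.
move=> mD D0.
suff : measurable_fun (`[0, +oo[%classic : set R) (fun s => A s w) by apply: measurable_funS.
have := @measurable_comp _ _ _ _ _ _ half_space (fun p : R * Omega => A p.1 p.2)
  (`[0, +oo[%classic : set R) (fun s => (s, w)).
apply => //; first exact: measurable_half_space.
- by move=> _ [s s0 <-]; split.
- apply: measurable_funTS; exact: pair2_measurable.
Qed.

(** Tonelli is applied on the whole product, so the process is extended by 0 outside [D] times
    [B]. *)
Lemma measurable_joint_restrict (D : set R) (B : set Omega) : measurable D -> D `<=` `[0, +oo[%classic ->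
  measurable B -> measurable_fun [set: measurableTypeR R * Omega]
    ((fun p : R * Omega => (A p.1 p.2)%:E) \_ (D `*` B)).
Proof.
move=> mD D0 mB; apply/(measurable_restrictT _ _).1; first exact: measurableX.
apply/measurable_EFinP; apply: measurable_funS mA; first exact: measurable_half_space.
by move=> [s w] [/= /D0 ? _]; split.
Qed.

Lemma joint_restrict_ge0 (D : set R) (B : set Omega) p : D `<=` `[0, +oo[%classic ->
  (0 <= ((fun p : R * Omega => (A p.1 p.2)%:E) \_ (D `*` B)) p)%E.
Proof.
move=> D0; rewrite patchE; case: ifPn => //; rewrite inE => -[/D0/= + _].
by rewrite in_itv/= andbT lee_fin; exact: A0.
Qed.

Lemma measurable_time_integral (D : set R) : measurable D -> D `<=` `[0, +oo[%classic ->
  measurable_fun setT (fun w => \int[leb]_(s in D) (A s w)%:E)%E.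
Proof.
move=> mD D0.
have := @measurable_fun_fubini_tonelli_G _ _ (measurableTypeR R) Omega R leb _
  (measurable_joint_restrict mD D0 (@measurableT _ Omega)) (fun p => joint_restrict_ge0 setT p D0).
apply: eq_measurable_fun => w _.
rewrite /fubini_G [RHS]integral_mkcond; apply: eq_integral => s _.
by rewrite !patchE in_setX/= in_setT andbT.
Qed.

Lemma time_integral_ge0 (D : set R) w : D `<=` `[0, +oo[%classic ->
  (0 <= \int[leb]_(s in D) (A s w)%:E)%E.
Proof.
move=> D0; apply: integral_ge0 => s /D0/=.
by rewrite in_itv/= andbT lee_fin; exact: A0.
Qed.

Lemma fubini_time_integral (D : set R) (B : set Omega) : measurable D -> D `<=` `[0, +oo[%classic ->
  measurable B ->
  (\int[P]_(w in B) \int[leb]_(s in D) (A s w)%:E =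
   \int[leb]_(s in D) \int[P]_(w in B) (A s w)%:E)%E.
Proof.
move=> mD D0 mB.
have := @fubini_tonelli _ _ (measurableTypeR R) Omega R leb P _
  (measurable_joint_restrict mD D0 mB) (fun p => joint_restrict_ge0 B p D0).
rewrite [X in _ = X -> _](_ : _ = \int[P]_(w in B) \int[leb]_(s in D) (A s w)%:E)%E; last first.
  rewrite [RHS]integral_mkcond; apply: eq_integral => w _; rewrite patchE.
  case: ifPn => wB.
    rewrite [RHS]integral_mkcond; apply: eq_integral => s _.
    by rewrite !patchE in_setX/= wB andbT.
  by apply: integral0_eq => s _; rewrite patchE in_setX/= (negbTE wB) andbF.
move=> <-; rewrite [RHS]integral_mkcond; apply: eq_integral => s _; rewrite patchE.
case: ifPn => sD.
  rewrite [RHS]integral_mkcond; apply: eq_integral => w _.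
  by rewrite !patchE in_setX/= sD.
by apply: integral0_eq => w _; rewrite patchE in_setX/= (negbTE sD).
Qed.

End JointProcesses.

Lemma integrable_half_line {R : realType} (f : R -> R) :
  measurable_fun (`[0, +oo[%classic : set R) f ->
  (forall s, 0 <= s -> 0 <= f s) ->
  (\int[lebesgue_measure]_(s in `[0%R, +oo[) (f s)%:E < +oo)%E ->
  (@lebesgue_measure R).-integrable `[0, +oo[ (EFin \o f).
Proof.
move=> mf f0 foo; apply/integrableP; split; first by apply/measurable_EFinP; exact: mf.
rewrite (_ : (\int[_]_(_ in _) _)%E = (\int[lebesgue_measure]_(s in `[0%R, +oo[) (f s)%:E)%E)//.
apply: eq_integral => s; rewrite inE/= in_itv/= andbT => s0.
by rewrite ger0_norm//; exact: f0.
Qed.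

(** * Continuity and splitting of time integrals *)

Lemma running_integral_continuous_at {R : realType} (f : R -> R) (t : R) :
  (@lebesgue_measure R).-integrable `[0, +oo[ (EFin \o f) -> 0 < t ->
  {for t, continuous (fun x : R => \int[lebesgue_measure]_(s in `[0, x]) f s)%R}.
Proof.
move=> intf t0.
have t1 : 0 < t + 1 by lra.
have int1 : (@lebesgue_measure R).-integrable `[0, t + 1] (EFin \o f).
  apply: integrableS intf => //.
  by move=> x /=; rewrite !in_itv/= andbT => /andP[].
have /(continuous_within_itvP _ t1)[c1 _ _] := parameterized_integral_continuous (ltW t1) int1.
by apply: c1; rewrite in_itv/= t0/=; lra.
Qed.

Lemma running_integral_continuous {R : realType} (f : R -> R) (t : R) :
  (@lebesgue_measure R).-integrable `[0, +oo[ (EFin \o f) -> 0 <= t ->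
  let G x := (\int[lebesgue_measure]_(s in `[0, x]) f s)%R in
  G s @[s --> t^'+] --> G t /\ (0 < t -> G s @[s --> t^'-] --> G t).
Proof.
move=> intf; rewrite le_eqVlt => /predU1P[<-|t0] G.
  have int1 : (@lebesgue_measure R).-integrable `[0, 1] (EFin \o f).
    apply: integrableS intf => //.
    by move=> x /=; rewrite !in_itv/= andbT => /andP[].
  have /(continuous_within_itvP _ ltr01)[_ c2 _] := parameterized_integral_continuous ler01 int1.
  by split => //; rewrite ltxx.
have ct := running_integral_continuous_at intf t0.
by split => [|_]; [exact: cvg_at_right_filter|exact: cvg_at_left_filter].
Qed.

Section SplitIntegral.
Context {R : realType}.
Variable f : R -> R.
Hypothesis mf : measurable_fun (`[0, +oo[%classic : set R) f.
Hypothesis f0 : forall s, 0 <= s -> 0 <= f s.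
Local Notation leb := (@lebesgue_measure R).
Local Open Scope ereal_scope.

Lemma integral_split_cy a b : (0 <= a)%R -> (a <= b)%R ->
  \int[leb]_(s in `[a, +oo[) (f s)%:E =
  \int[leb]_(s in `[a, b]) (f s)%:E + \int[leb]_(s in `[b, +oo[) (f s)%:E.
Proof.
move=> a0 ab.
have sub (c : R) : (0 <= c)%R -> measurable_fun (`[c, +oo[%classic : set R) f.
  move=> c0; apply: measurable_funS mf => // s /=; rewrite !in_itv/= !andbT.
  exact: le_trans.
rewrite -(integral_itv_obnd_cbnd (r := b)); last first.
  apply/measurable_EFinP; apply: measurable_funS (sub b (le_trans a0 ab)) => //.
  by move=> s /=; rewrite !in_itv/= !andbT; exact: ltW.
rewrite -ge0_integral_setU//=.
- by rewrite -itv_bndbnd_setU// bnd_simp.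
- rewrite -itv_bndbnd_setU ?bnd_simp//. apply/measurable_EFinP; exact: sub.
- move=> s; rewrite !in_itv/= andbT lee_fin => -[/andP[as_ _]|bs]; apply: f0.
    exact: le_trans as_.
  exact: le_trans (le_trans a0 ab) (ltW bs).
- apply/disj_set2P/seteqP; split=> // s [/=]; rewrite !in_itv/= andbT => /andP[_ sb].
  by rewrite ltNge sb.
Qed.

Lemma integral_split_cc a b : (0 <= a)%R -> (a <= b)%R ->
  \int[leb]_(s in `[0%R, b]) (f s)%:E =
  \int[leb]_(s in `[0%R, a]) (f s)%:E + \int[leb]_(s in `[a, b]) (f s)%:E.
Proof.
move=> a0 ab.
have sub (c : R) : (0 <= c)%R -> measurable_fun (`[c, b]%classic : set R) f.
  move=> c0; apply: measurable_funS mf => // s /=; rewrite !in_itv/= andbT.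
  by move=> /andP[+ _]; exact: le_trans.
rewrite -(integral_itv_obnd_cbnd (r := a)); last first.
  apply/measurable_EFinP; apply: measurable_funS (sub a a0) => //.
  by move=> s /=; rewrite !in_itv/= => /andP[/ltW -> ->].
rewrite -ge0_integral_setU//=.
- by rewrite -itv_bndbnd_setU// bnd_simp.
- rewrite -itv_bndbnd_setU ?bnd_simp//. apply/measurable_EFinP; exact: sub.
- move=> s; rewrite !in_itv/= lee_fin => -[/andP[s0 _]|/andP[as_ _]]; apply: f0 => //.
  exact: le_trans (ltW as_).
- apply/disj_set2P/seteqP; split=> // s [/=]; rewrite !in_itv/= => /andP[_ sb].
  by rewrite ltNge sb.
Qed.

End SplitIntegral.

(** * The càdlàg potential of a progressive integrand *)

Section Potential.
Context {d : measure_display} {Omega : measurableType d} {R : realType}.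
Variables (P : probability Omega R) (F : R -> set (set Omega)).
Hypotheses (hF : is_filtration F) (cF : filtration_complete P F).
Hypothesis rF : filtration_right_continuous F.
Variable A : R -> Omega -> R.
Hypotheses (pA : progressive F A) (A0 : forall t w, 0 <= t -> 0 <= A t w).
Hypothesis Aoo : finite_expected_int P A.

Local Notation FT t := (g_sigma_algebraType (F t)).
Local Notation leb := (@lebesgue_measure R).
Local Notation tail t w := (\int[leb]_(s in `[t, +oo[) (A s w)%:E)%E.
Local Notation running t w := (\int[leb]_(s in `[0%R, t]) (A s w)%:E)%E.

Let mA := progressive_measurable hF pA.

Let mAw w : measurable_fun (`[0, +oo[%classic : set R) (fun s => A s w).
Proof. exact: measurable_section. Qed.

Lemma itvcy_sub (t : R) : 0 <= t -> `[t, +oo[%classic `<=` `[0, +oo[%classic.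
Proof. by move=> t0 s /=; rewrite !in_itv/= !andbT; exact: le_trans. Qed.

Lemma itvcc_sub (a b : R) : 0 <= a -> `[a, b]%classic `<=` `[0, +oo[%classic.
Proof. by move=> t0 s /=; rewrite !in_itv/= !andbT => /andP[+ _]; exact: le_trans. Qed.

Lemma measurable_tail t : 0 <= t -> measurable_fun setT (fun w => tail t w).
Proof. by move=> t0; apply: measurable_time_integral => //; exact: itvcy_sub. Qed.

Lemma tail_ge0 t w : 0 <= t -> (0 <= tail t w)%E.
Proof. by move=> t0; apply: time_integral_ge0 => //; exact: itvcy_sub. Qed.

Lemma running_ge0 t w : (0 <= running t w)%E.
Proof. by apply: time_integral_ge0 => //; exact: itvcc_sub. Qed.

Lemma tail_le t w : 0 <= t -> (tail t w <= tail 0%R w)%E.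
Proof.
move=> t0; rewrite (integral_split_cy (mAw w) (A0 ^~ w) (lexx 0) t0).
by apply: leeDr; exact: running_ge0.
Qed.

Lemma running_le t w : 0 <= t -> (running t w <= tail 0%R w)%E.
Proof.
move=> t0; rewrite (integral_split_cy (mAw w) (A0 ^~ w) (lexx 0) t0).
by apply: leeDl; exact: tail_ge0.
Qed.

Lemma ae_tail_fin : {ae P, forall w, (tail 0%R w < +oo)%E}.
Proof.
have : P.-integrable setT (fun w => tail 0%R w).
  apply/integrableP; split; first exact: measurable_tail.
  rewrite (eq_integral (fun w => tail 0%R w))//.
  by move=> w _; rewrite gee0_abs// tail_ge0.
move=> /(integrable_ae measurableT); apply: filterS => w /(_ Logic.I).
by rewrite ge0_fin_numE// tail_ge0.
Qed.

(** [fine] sends an infinite tail to 0, but the tails have finite expectation and hence are almost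
    surely finite. *)
Lemma tail_int_ae t : 0 <= t ->
  {ae P, forall w, (tail_int A t w)%:E = tail t w}.
Proof.
move=> t0; apply: filterS ae_tail_fin => w h.
by rewrite /tail_int fineK// ge0_fin_numE ?tail_ge0//; apply: le_lt_trans h; exact: tail_le.
Qed.

Lemma measurable_tail_int t : 0 <= t -> measurable_fun setT (tail_int A t).
Proof. by move=> t0; apply: measurableT_comp => //; exact: measurable_tail. Qed.

Lemma integral_tail_int t B : 0 <= t -> measurable B ->
  (\int[P]_(w in B) (tail_int A t w)%:E = \int[P]_(w in B) tail t w)%E.
Proof.
move=> t0 mB; apply: ge0_ae_eq_integral => //.
- exact/measurable_funTS/measurable_EFinP/measurable_tail_int.
- exact/measurable_funTS/measurable_tail.
- by move=> w _; rewrite lee_fin fine_ge0// tail_ge0.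
- by move=> w _; exact: tail_ge0.
- by apply: filterS (tail_int_ae t0) => w h _.
Qed.

Lemma integral_tail_lty t : 0 <= t -> (\int[P]_w tail t w < +oo)%E.
Proof.
move=> t0; apply: le_lt_trans Aoo; apply: ge0_le_integral => //.
- by move=> w _; exact: tail_ge0.
- exact: measurable_tail.
- exact: measurable_tail.
- by move=> w _; exact: tail_le.
Qed.

(** For nonnegative [Z] both integrability clauses follow from the equality of integrals, which can
    then be stated with the extended-real tail. *)
Lemma cond_exp_tailP t (Z : Omega -> R) : 0 <= t -> (forall w, 0 <= Z w) ->
  cond_exp_version P (F t) (tail_int A t) Z <->
  measurable_fun [set: FT t] (Z : FT t -> R) /\
  forall B, F t B -> (\int[P]_(w in B) (Z w)%:E = \int[P]_(w in B) tail t w)%E.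
Proof.
move=> t0 Z0.
have sFt := filtration_sigma hF t0; have Ftm := filtration_sub hF t0.
split=> [[_ mZ _ ZE]|[mZ ZE]].
  split; first exact/(adaptedP sFt).
  by move=> B FB; rewrite ZE// integral_tail_int//; exact: Ftm.
have FT := sub_sigmaT sFt.
split.
- apply/integrableP; split; first exact/measurable_EFinP/measurable_tail_int.
  rewrite (eq_integral (fun w => (tail_int A t w)%:E)); last first.
    by move=> w _; rewrite /= ger0_norm// fine_ge0// tail_ge0.
  have -> := integral_tail_int t0 (@measurableT _ Omega).
  exact: integral_tail_lty.
- exact/(adaptedP sFt).
- apply/integrableP; split.
    exact/measurable_EFinP/(measurable_fun_sub_sigma sFt Ftm).
  rewrite (eq_integral (fun w => (Z w)%:E)); last by move=> w _; rewrite /= ger0_norm.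
  rewrite (ZE _ FT). exact: integral_tail_lty.
- by move=> B FB; rewrite ZE// integral_tail_int//; exact: Ftm.
Qed.

Lemma fine_running_continuous w t : (tail 0%R w < +oo)%E -> 0 <= t ->
  (fine (running s w) @[s --> t^'+] --> fine (running t w)) /\
  (0 < t -> fine (running s w) @[s --> t^'-] --> fine (running t w)).
Proof.
move=> woo t0; apply: (@running_integral_continuous R (fun s => A s w)) => //.
apply: integrable_half_line => // s; exact: A0.
Qed.

Lemma running_fin w t : (tail 0%R w < +oo)%E -> 0 <= t -> running t w \is a fin_num.
Proof.
move=> h t0; rewrite ge0_fin_numE ?running_ge0//.
by apply: le_lt_trans h; exact: running_le.
Qed.

Lemma fine_running_nd w s t : (tail 0%R w < +oo)%E -> 0 <= s -> s <= t ->
  fine (running s w) <= fine (running t w).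
Proof.
move=> h s0 st; apply: fine_le; [exact: running_fin|exact/running_fin/(le_trans s0)|].
rewrite (integral_split_cc (mAw w) (A0 ^~ w) s0 st); apply: leeDl.
by apply: time_integral_ge0 => //; exact: itvcc_sub.
Qed.

Lemma fine_running_adapted t : 0 <= t ->
  measurable_fun [set: FT t] ((fun w => fine (running t w)) : FT t -> R).
Proof. by move=> t0; apply: measurableT_comp => //; exact: running_integral_adapted. Qed.

(** [M t] is the conditional expectation of the total integral, which dominates the adapted running
    integral. This settles dyadic times; right-continuity of [M] and monotonicity of the running
    integral give all times on one event. *)
Lemma ae_running_le (M : R -> Omega -> R) : cadlag M ->
  (forall t w, 0 <= t -> 0 <= M t w) ->
  (forall t, 0 <= t -> measurable_fun [set: FT t] (M t : FT t -> R)) ->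
  (forall t B, 0 <= t -> F t B ->
     (\int[P]_(w in B) (M t w)%:E = \int[P]_(w in B) tail 0%R w)%E) ->
  {ae P, forall w, (tail 0%R w < +oo)%E /\ forall t, 0 <= t -> fine (running t w) <= M t w}.
Proof.
move=> cM M0 aM ME.
have h n i : {ae P, forall w, fine (running (dyadic n i) w) <= M (dyadic n i) w}.
  have q0 : 0 <= dyadic n i :> R by exact: dyadic_ge0.
  have sF := filtration_sigma hF q0; have Fm := filtration_sub hF q0.
  have mrun : measurable_fun setT (fun w => (fine (running (dyadic n i) w))%:E).
    apply/measurable_EFinP/(measurable_fun_sub_sigma sF Fm (sub_sigmaT sF)).
    exact: fine_running_adapted.
  have runtail w : ((fine (running (dyadic n i) w))%:E <= tail 0%R w)%E.
    apply: le_trans (running_le w q0).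
    by have := running_ge0 (dyadic n i) w; case: (running _ w).
  apply: (ae_le_of_le_integral sF Fm).
  - exact: fine_running_adapted.
  - exact: aM.
  - by move=> w; rewrite fine_ge0// running_ge0.
  - by move=> w; exact: M0.
  - apply: le_lt_trans (integral_tail_lty (lexx 0)); apply: ge0_le_integral => //.
    + by move=> w _; rewrite lee_fin fine_ge0// running_ge0.
    + exact: measurable_tail.
  - move=> B FB; rewrite ME//; have mB := Fm _ FB; apply: ge0_le_integral => //.
    + by move=> w _; rewrite lee_fin fine_ge0// running_ge0.
    + exact: measurable_funTS.
    + exact/measurable_funTS/measurable_tail.
have {}h := ae_foralln (fun n => ae_foralln (h n)).
apply: filterS2 ae_tail_fin h => w woo h; split => // t t0.
have [/cvg_at_rightP cMt _] := cM w t t0.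
have {}cMt : M (dyadic_above n t) w @[n --> \oo] --> M t w.
  apply: cMt; split; first by move=> n; exact: dyadic_above_gt.
  exact: cvg_dyadic_above.
apply: (cvgr_to_ge cMt); apply: nearW => n.
apply: le_trans (h _ _); apply: fine_running_nd => //.
by apply/ltW; exact: dyadic_above_gt.
Qed.

(** The potential is the closed martingale of the total integral minus the running integral, which
    is continuous on paths with finite total. *)
Lemma potential_exists : exists U : R -> Omega -> R,
  [/\ progressive F U, cadlag U, forall t w, 0 <= t -> 0 <= U t w &
    forall t, 0 <= t -> cond_exp_version P (F t) (tail_int A t) (U t)].
Proof.
have xi0 w : 0 <= tail_int A 0 w by rewrite fine_ge0// tail_ge0.
have xioo : (\int[P]_w (tail_int A 0 w)%:E < +oo)%E.
  by rewrite integral_tail_int// integral_tail_lty.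
have [M [cM M0 aM ME]] := martingale_regularization hF cF rF
  (measurable_tail_int (lexx 0)) xi0 xioo.
have {}ME t B : 0 <= t -> F t B ->
    (\int[P]_(w in B) (M t w)%:E = \int[P]_(w in B) tail 0%R w)%E.
  move=> t0 FB; rewrite ME// integral_tail_int//; exact: (filtration_sub hF t0).
have good := ae_running_le cM M0 aM ME.
pose good_set := [set w | (tail 0%R w < +oo)%E /\ forall t, 0 <= t -> fine (running t w) <= M t w].
have FG t : 0 <= t -> F t (~` good_set).
  by move=> t0; apply: (filtration_le hF _ t0) => //; exact: cF.
(* Setting the exceptional paths to 0 secures the sign and the path regularity for every [w];
   completeness preserves adaptedness. *)
pose U t w := \1_good_set w * (M t w - fine (running t w)).
have aU t : 0 <= t -> measurable_fun [set: FT t] (U t : FT t -> R).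
  move=> t0; apply: measurable_funM.
    apply: measurable_indic; rewrite -[X in measurable X]setCK; apply: measurableC.
    exact/(measurable_sub_sigmaP (filtration_sigma hF t0))/FG.
  by apply: measurable_funB; [exact: aM|exact: fine_running_adapted].
have U0 t w : 0 <= t -> 0 <= U t w.
  move=> t0; rewrite /U indicE; case: (boolP (w \in good_set)) => [|_]; last by rewrite mul0r.
  by rewrite inE => -[_ h]; rewrite mul1r subr_ge0 h.
have cU : cadlag U.
  move=> w t t0; rewrite /U indicE; case: (boolP (w \in good_set)) => [|_]; last first.
    under eq_fun do rewrite mul0r; rewrite mul0r; split; first exact: cvg_cst.
    by move=> _; exists 0; exact: cvg_cst.
  rewrite inE => -[woo _]; under eq_fun do rewrite mul1r; rewrite mul1r.
  have [r1 r2] := fine_running_continuous woo t0; have [m1 m2] := cM w t t0.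
  split; first exact: cvgB.
  move=> tp; have [l hl] := m2 tp; exists (l - fine (running t w)).
  by apply: cvgB => //; exact: r2.
exists U; split => //; first exact: (cadlag_progressive hF cU aU).
move=> t t0; apply/cond_exp_tailP => //; first by move=> w; exact: U0.
split; first exact: aU.
move=> B FB; have sF := filtration_sigma hF t0; have Fm := filtration_sub hF t0.
have mB := Fm _ FB.
have mU := measurable_fun_sub_sigma sF Fm (sub_sigmaT sF) (aU t t0).
have mrun : measurable_fun setT (fun w => running t w).
  by apply: measurable_time_integral => //; exact: itvcc_sub.
have runfin : (\int[P]_(w in B) running t w)%E \is a fin_num.
  rewrite ge0_fin_numE; last by apply: integral_ge0 => w _; exact: running_ge0.
  apply: (@le_lt_trans _ _ (\int[P]_w tail 0%R w)%E); last exact: integral_tail_lty.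
  apply: (@le_trans _ _ (\int[P]_w running t w)%E).
    by apply: ge0_subset_integral => // w _; exact: running_ge0.
  apply: ge0_le_integral => //.
  - by move=> w _; exact: running_ge0.
  - exact: measurable_tail.
  - by move=> w _; exact: running_le.
(* Adding the finite running part to both sides leaves only integrals of nonnegative functions. *)
suff e : (\int[P]_(w in B) (U t w)%:E + \int[P]_(w in B) running t w =
    \int[P]_(w in B) tail t w + \int[P]_(w in B) running t w)%E.
  by rewrite -[LHS](addeK _ runfin) e addeK.
have -> : (\int[P]_(w in B) (U t w)%:E + \int[P]_(w in B) running t w =
    \int[P]_(w in B) ((U t w)%:E + running t w))%E.
  apply/esym/ge0_integralD => //.
  - by move=> w _; rewrite lee_fin U0.
  - exact/measurable_funTS/measurable_EFinP.
  - by move=> w _; exact: running_ge0.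
  - exact: measurable_funTS.
have -> : (\int[P]_(w in B) tail t w + \int[P]_(w in B) running t w =
    \int[P]_(w in B) (tail t w + running t w))%E.
  apply/esym/ge0_integralD => //.
  - by move=> w _; exact: tail_ge0.
  - by apply: measurable_funTS; exact: measurable_tail.
  - by move=> w _; exact: running_ge0.
  - exact: measurable_funTS.
transitivity (\int[P]_(w in B) (M t w)%:E)%E.
  apply: ge0_ae_eq_integral => //.
  - apply/measurable_funTS/emeasurable_funD => //; exact/measurable_EFinP.
  - apply/measurable_funTS/measurable_EFinP.
    exact: (measurable_fun_sub_sigma sF Fm (sub_sigmaT sF) (aM t t0)).
  - by move=> w _; rewrite adde_ge0// ?lee_fin ?U0// running_ge0.
  - by move=> w _; rewrite lee_fin M0.
  - apply: filterS good => w gw _.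
    rewrite -(fineK (running_fin gw.1 t0)) -EFinD /U indicE mem_set// mul1r; congr EFin; exact: subrK.
rewrite ME//; apply: eq_integral => w _.
by rewrite addeC -(integral_split_cy (mAw w) (A0 ^~ w) (lexx 0) t0).
Qed.

End Potential.

(** * The weighted geometric mean *)

Section GeometricMean.
Context {R : realType}.
Variable r : R.
Hypotheses (r0 : 0 < r) (r1 : r < 1).

Definition gmean (x y : R) := x `^ (1 - r) * y `^ r.
(** At positive arguments, [gmean_x] and [gmean_y] are the partial derivatives of [gmean]. *)
Definition gmean_x (x y : R) := (1 - r) * (y `^ r * x `^ (- r)).
Definition gmean_y (x y : R) := r * (x `^ (1 - r) * y `^ (- (1 - r))).

Lemma gmean_ge0 x y : 0 <= gmean x y.
Proof. by rewrite mulr_ge0// powR_ge0. Qed.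

Lemma gmean_x_ge0 x y : 0 <= gmean_x x y.
Proof. by rewrite !mulr_ge0 ?powR_ge0// subr_ge0 ltW. Qed.

Lemma gmean_y_ge0 x y : 0 <= gmean_y x y.
Proof. by rewrite !mulr_ge0 ?powR_ge0// ltW. Qed.

Let r1' : 0 < 1 - r. Proof. by rewrite subr_gt0. Qed.

Lemma powR_split x : 0 < x -> x `^ (1 - r) * x `^ r = x.
Proof.
move=> x0; rewrite -powRD; last by rewrite (gt_eqF x0) implybT.
by rewrite subrK powRr1// ltW.
Qed.

Lemma gmean_x_mul x y : 0 < x -> 0 < y -> gmean_x x y * x = (1 - r) * gmean x y.
Proof.
move=> x0 y0; rewrite /gmean_x /gmean powRN -{2}(powR_split x0).
by field; rewrite gt_eqF// powR_gt0.
Qed.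

Lemma gmean_y_mul x y : 0 < x -> 0 < y -> gmean_y x y * y = r * gmean x y.
Proof.
move=> x0 y0; rewrite /gmean_y /gmean powRN -{2}(powR_split y0).
by field; rewrite gt_eqF// powR_gt0.
Qed.

(** Euler's identity for a function homogeneous of degree 1. *)
Lemma gmean_euler x y : 0 < x -> 0 < y ->
  gmean_x x y * x + gmean_y x y * y = gmean x y.
Proof. by move=> x0 y0; rewrite gmean_x_mul// gmean_y_mul// -mulrDl subrK mul1r. Qed.

Lemma gmeanZ x y x' y' : 0 <= x -> 0 <= y -> 0 <= x' -> 0 <= y' ->
  gmean (x * x') (y * y') = gmean x y * gmean x' y'.
Proof. by move=> *; rewrite /gmean !powRM//; ring. Qed.

(** Young's inequality for the conjugate exponents [1 / (1 - r)] and [1 / r]. *)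
Lemma gmean_le_arith x y : 0 <= x -> 0 <= y -> gmean x y <= (1 - r) * x + r * y.
Proof.
move=> x0 y0.
have := @conjugate_powR R (x `^ (1 - r)) (y `^ r) (1 - r)^-1 r^-1
  (powR_ge0 _ _) (powR_ge0 _ _).
rewrite !invr_gt0 !invrK -!powRrM !mulfV ?gt_eqF// !powRr1// => h.
have := h r1' r0; rewrite subrK => /(_ erefl).
by rewrite /gmean [x * _]mulrC [y * _]mulrC.
Qed.

(** By homogeneity the tangent plane inequality is [gmean_le_arith] for [x / x'] and [y / y'],
    multiplied by [gmean x' y']. *)
Lemma gmean_tangent x y x' y' : 0 <= x -> 0 <= y -> 0 < x' -> 0 < y' ->
  gmean x y <= gmean_x x' y' * x + gmean_y x' y' * y.
Proof.
move=> x0 y0 x'0 y'0.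
have x'0' := ltW x'0; have y'0' := ltW y'0.
have xx' := divr_ge0 x0 x'0'; have yy' := divr_ge0 y0 y'0'.
have := gmean_le_arith xx' yy'.
move=> /(ler_wpM2l (gmean_ge0 x' y')); rewrite -gmeanZ//.
have -> : x' * (x / x') = x by field; rewrite gt_eqF.
have -> : y' * (y / y') = y by field; rewrite gt_eqF.
move=> /le_trans; apply.
have -> : gmean_x x' y' = (1 - r) * gmean x' y' / x'.
  by rewrite -gmean_x_mul// mulfK// gt_eqF.
have -> : gmean_y x' y' = r * gmean x' y' / y'.
  by rewrite -gmean_y_mul// mulfK// gt_eqF.
by rewrite le_eqVlt; apply/orP; left; apply/eqP; field; rewrite !gt_eqF.
Qed.

(** The tangent plane at the far point [(x + a, y + b)] is evaluated at [(x, y)], and Euler's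
    identity rewrites the value at the far point. *)
Lemma gmean_increment x y a b : 0 < x -> 0 < y -> 0 <= a -> 0 <= b ->
  gmean x y + (gmean_x (x + a) (y + b) * a + gmean_y (x + a) (y + b) * b) <=
  gmean (x + a) (y + b).
Proof.
move=> x0 y0 a0 b0.
have xa : 0 < x + a by exact: ltr_wpDr.
have yb : 0 < y + b by exact: ltr_wpDr.
rewrite -(gmean_euler xa yb) !mulrDr.
have := gmean_tangent (ltW x0) (ltW y0) xa yb; lra.
Qed.

(** [gmean_y x y] is [r] times the ratio [gmean x y / y]: a lower bound on the ratio becomes one on
    the drift. When [x = 0] the hypothesis forces [m <= 0]. *)
Lemma gmean_le x y m : 0 <= x -> 0 < y -> m * y <= gmean x y ->
  r * m <= gmean_y x y.
Proof.
move=> x0 y0 h; rewrite /gmean_y ler_pM2l//.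
move: x0; rewrite le_eqVlt => /predU1P[x0|x0].
  move: h; rewrite -x0 /gmean powR0 ?gt_eqF// mul0r pmulr_lle0// => /le_trans; apply.
  by rewrite mulr_ge0 ?powR_ge0.
rewrite powRN -(ler_pM2r y0); apply: le_trans h _.
rewrite /gmean -{3}(powR_split y0) le_eqVlt; apply/orP; left; apply/eqP.
by field; rewrite gt_eqF// powR_gt0.
Qed.

Lemma le_of_le_gmean x y : 0 <= x -> 0 < y -> y <= gmean x y -> y <= x.
Proof.
move=> x0 y0; rewrite /gmean -{1}(powR_split y0) ler_pM2r ?powR_gt0//.
move=> h; rewrite leNgt; apply/negP => xy.
by move: h; rewrite leNgt gt0_ltr_powR// ?nnegrE// ltW.
Qed.

Lemma cvg_powR (u : R^nat) (x p : R) : 0 < x ->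
  u @ \oo --> x -> u n `^ p @[n --> \oo] --> x `^ p.
Proof.
move=> x0 ux.
have dx : differentiable (@powR R ^~ p) x.
  by apply/derivable1_diffP/derivable_powR; rewrite in_itv/= andbT.
have cx : {for x, continuous (@powR R ^~ p)} by exact: differentiable_continuous.
exact: (cvg_comp _ _ ux cx).
Qed.

Lemma cvg_gmean_x (u v : R^nat) (x y : R) : 0 < x -> 0 < y ->
  u @ \oo --> x -> v @ \oo --> y -> gmean_x (u n) (v n) @[n --> \oo] --> gmean_x x y.
Proof.
move=> x0 y0 ux vy; apply: cvgM; first exact: cvg_cst.
by apply: cvgM; exact: cvg_powR.
Qed.

Lemma cvg_gmean_y (u v : R^nat) (x y : R) : 0 < x -> 0 < y ->
  u @ \oo --> x -> v @ \oo --> y -> gmean_y (u n) (v n) @[n --> \oo] --> gmean_y x y.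
Proof.
move=> x0 y0 ux vy; apply: cvgM; first exact: cvg_cst.
by apply: cvgM; exact: cvg_powR.
Qed.

End GeometricMean.

(** * Comparison of positive solutions *)

Section PathFatou.
Context {R : realType}.
Variables (r : R) (u y a b : R -> R) (t0 : R).
Hypotheses (r0 : 0 < r) (r1 : r < 1) (t00 : 0 <= t0).
Hypothesis cu : forall s, 0 <= s -> u x @[x --> s^'+] --> u s.
Hypothesis cy : forall s, 0 <= s -> y x @[x --> s^'+] --> y s.
Hypothesis ma : measurable_fun (`[0, +oo[%classic : set R) a.
Hypothesis mb : measurable_fun (`[0, +oo[%classic : set R) b.
Hypotheses (a0 : forall s, 0 <= s -> 0 <= a s) (b0 : forall s, 0 <= s -> 0 <= b s).
Local Notation leb := (@lebesgue_measure R).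
Hypothesis aoo : (\int[leb]_(s in `[0%R, +oo[) (a s)%:E < +oo)%E.
Hypothesis boo : (\int[leb]_(s in `[0%R, +oo[) (b s)%:E < +oo)%E.

Definition grid n i : R := t0 + dyadic n i.

Definition increment (f : R -> R) n i : R :=
  fine (\int[leb]_(s in `[grid n i, grid n i.+1]) (f s)%:E)%E.

(** The gradient sits at the right end of the cell, padded by the increments over the cell, as in
    [gmean_increment]. The padding vanishes as the mesh shrinks, and right-continuity handles the
    rest. *)
Definition weight_u n i :=
  gmean_x r (u (grid n i.+1) + increment a n i) (y (grid n i.+1) + increment b n i).

Definition weight_y n i :=
  gmean_y r (u (grid n i.+1) + increment a n i) (y (grid n i.+1) + increment b n i).

(** With [n * 2 ^ n] cells of length [2 ^ -n] the grid covers [[t0, t0 + n[]: the mesh tends to 0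
    while the horizon tends to infinity. *)
Definition riemann_sum n :=
  \sum_(i < n * 2 ^ n) (weight_u n i * increment a n i + weight_y n i * increment b n i).

Lemma grid_ge0 n i : 0 <= grid n i.
Proof. by rewrite addr_ge0// dyadic_ge0. Qed.

Lemma grid_le n i j : (i <= j)%N -> grid n i <= grid n j.
Proof. by move=> ij; rewrite lerD2l dyadic_le. Qed.

Section increments.
Variable f : R -> R.
Hypothesis mf : measurable_fun (`[0, +oo[%classic : set R) f.
Hypothesis f0 : forall s, 0 <= s -> 0 <= f s.
Hypothesis foo : (\int[leb]_(s in `[0%R, +oo[) (f s)%:E < +oo)%E.

Lemma integral_cc_fin s t : 0 <= s -> s <= t ->
  (\int[leb]_(x in `[s, t]) (f x)%:E)%E \is a fin_num.
Proof.
move=> s0 st; rewrite ge0_fin_numE; last first.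
  by apply: integral_ge0 => x /=; rewrite in_itv/= lee_fin => /andP[sx _]; apply: f0; lra.
apply: le_lt_trans foo; apply: ge0_subset_integral => //.
- exact/measurable_EFinP.
- by move=> x /=; rewrite in_itv/= andbT lee_fin; exact: f0.
- by move=> x /=; rewrite !in_itv/= andbT => /andP[sx _]; lra.
Qed.

Lemma incrementE n i :
  (increment f n i)%:E = (\int[leb]_(s in `[grid n i, grid n i.+1]) (f s)%:E)%E.
Proof. by rewrite fineK// integral_cc_fin// ?grid_ge0// grid_le. Qed.

Lemma increment_diff n i : increment f n i =
  (\int[leb]_(s in `[0, grid n i.+1]) f s)%R - (\int[leb]_(s in `[0, grid n i]) f s)%R.
Proof.
have h := integral_split_cc mf f0 (grid_ge0 n i) (grid_le n (leqnSn i)).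
rewrite /Rintegral h fineD ?integral_cc_fin// ?grid_ge0// ?grid_le//.
by rewrite addrAC subrr add0r.
Qed.

End increments.

Definition grid_index n s := Num.truncn ((s - t0) * 2 ^+ n).

Lemma grid_indexP n s i : t0 <= s ->
  (s \in `[grid n i, grid n i.+1[) = (grid_index n s == i).
Proof.
move=> ts; rewrite truncn_eq; last by rewrite mulr_ge0 ?exprn_ge0// subr_ge0.
rewrite in_itv/= /grid /dyadic -ler_pdivrMr ?exprn_gt0// -ltr_pdivlMr ?exprn_gt0//.
by rewrite lerBrDl ltrBlDl.
Qed.

Lemma cvg_grid_succ s : t0 <= s -> grid n (grid_index n s).+1 @[n --> \oo] --> s.
Proof.
move=> ts; have st : 0 <= s - t0 by rewrite subr_ge0.
have := cvgD (@cvg_cst _ t0 _ \oo _) (cvg_dyadic_above st).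
rewrite (_ : t0 + (s - t0) = s); last by ring.
exact.
Qed.

Lemma cvg_grid_index s : t0 <= s -> grid n (grid_index n s) @[n --> \oo] --> s.
Proof.
move=> ts.
have -> : (fun n => grid n (grid_index n s)) =
    (fun n => grid n (grid_index n s).+1 - 2^-1 ^+ n).
  apply/funext => n; rewrite /grid /dyadic -natr1 exprVn; ring.
have h : (2^-1 : R) ^+ n @[n --> \oo] --> 0.
  by apply: cvg_expr; rewrite ger0_norm ?invr_ge0//; lra.
by have := cvgB (cvg_grid_succ ts) h; rewrite subr0; exact.
Qed.

Lemma cvg_increment (f : R -> R) (s : R) : measurable_fun (`[0, +oo[%classic : set R) f ->
  (forall s, 0 <= s -> 0 <= f s) ->
  (\int[leb]_(s in `[0%R, +oo[) (f s)%:E < +oo)%E -> t0 < s ->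
  increment f n (grid_index n s) @[n --> \oo] --> 0.
Proof.
move=> mf f0 foo ts; under eq_fun do rewrite (increment_diff mf f0 foo).
pose G (x : R) : R := (\int[leb]_(s in `[0, x]) f s)%R.
have s0 : 0 < s by exact: le_lt_trans ts.
have cG : {for s, continuous G}.
  exact/running_integral_continuous_at/s0/integrable_half_line.
have := cvgB (cvg_comp _ _ (cvg_grid_succ (ltW ts)) cG)
  (cvg_comp _ _ (cvg_grid_index (ltW ts)) cG).
by rewrite subrr; exact.
Qed.

(** The weights are frozen on each cell while [a] and [b] are not, so the integral over time is
    exactly [riemann_sum n] and Fatou's lemma applies. *)
Definition step_integrand n s : R :=
  \sum_(i < n * 2 ^ n) \1_(`[grid n i, grid n i.+1[%classic : set R) s *
    (weight_u n i * a s + weight_y n i * b s).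

Lemma weight_u_ge0 n i : 0 <= weight_u n i.
Proof. exact: gmean_x_ge0. Qed.

Lemma weight_y_ge0 n i : 0 <= weight_y n i.
Proof. exact: gmean_y_ge0. Qed.

Lemma itv_t0_sub : `[t0, +oo[%classic `<=` (`[0, +oo[%classic : set R).
Proof. by move=> s /=; rewrite !in_itv/= !andbT; exact: le_trans. Qed.

Let ma' : measurable_fun (`[t0, +oo[%classic : set R) a.
Proof. by apply: measurable_funS ma => //; exact: itv_t0_sub. Qed.

Let mb' : measurable_fun (`[t0, +oo[%classic : set R) b.
Proof. by apply: measurable_funS mb => //; exact: itv_t0_sub. Qed.

Lemma measurable_step_term n i : measurable_fun (`[t0, +oo[%classic : set R)
  (fun s => \1_(`[grid n i, grid n i.+1[%classic : set R) s *
    (weight_u n i * a s + weight_y n i * b s)).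
Proof.
apply: measurable_funM; first exact: measurable_indic.
by apply: measurable_funD; apply: measurable_funM.
Qed.

Lemma step_term_ge0 n i s : t0 <= s -> 0 <= \1_(`[grid n i, grid n i.+1[%classic : set R) s *
    (weight_u n i * a s + weight_y n i * b s).
Proof.
move=> ts; have s0 := le_trans t00 ts.
rewrite mulr_ge0// addr_ge0// mulr_ge0 ?weight_u_ge0 ?weight_y_ge0//; [exact: a0|exact: b0].
Qed.

Lemma riemann_sumE n :
  ((riemann_sum n)%:E = \int[leb]_(s in `[t0, +oo[) (step_integrand n s)%:E)%E.
Proof.
under eq_integral do rewrite -sumEFin.
rewrite ge0_integral_sum//=; last 2 first.
- by move=> i; apply/measurable_EFinP; exact: measurable_step_term.
- by move=> i s; rewrite in_itv/= andbT lee_fin; exact: step_term_ge0.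
rewrite /riemann_sum -sumEFin; apply: eq_bigr => i _.
have git : t0 <= grid n i by rewrite lerDl dyadic_ge0.
have gi := grid_ge0 n i.
have sub f : measurable_fun (`[0, +oo[%classic : set R) f ->
    measurable_fun (`[grid n i, grid n i.+1]%classic : set R) f.
  move=> mf; apply: measurable_funS mf => // s /=; rewrite !in_itv/= andbT => /andP[h _].
  exact: le_trans h.
transitivity (\int[leb]_(s in `[grid n i, grid n i.+1[) (weight_u n i * a s + weight_y n i * b s)%:E)%E; last first.
  rewrite [RHS]integral_mkcond [LHS]integral_mkcond; apply: eq_integral => s _.
  rewrite !patchE indicE; case: ifPn => si.
    rewrite ifT ?mul1r//; move: si; rewrite !inE/= !in_itv/= andbT => /andP[h _].
    exact: le_trans h.
  by rewrite mul0r; case: ifP.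
rewrite integral_itv_bndo_bndc; last first.
  apply/measurable_EFinP; apply: measurable_funS (_ : measurable_fun (`[grid n i, grid n i.+1]%classic : set R) _) => //.
    by move=> s /=; rewrite !in_itv/= => /andP[-> /ltW].
  by apply: measurable_funD; apply: measurable_funM => //; exact: sub.
under eq_integral do rewrite EFinD.
rewrite ge0_integralD//=; last 4 first.
- move=> s; rewrite in_itv/= lee_fin => /andP[h _].
  by rewrite mulr_ge0 ?weight_u_ge0// a0//; exact: le_trans h.
- by apply/measurable_EFinP; apply: measurable_funM => //; exact: sub.
- move=> s; rewrite in_itv/= lee_fin => /andP[h _].
  by rewrite mulr_ge0 ?weight_y_ge0// b0//; exact: le_trans h.
- by apply/measurable_EFinP; apply: measurable_funM => //; exact: sub.
rewrite EFinD !EFinM (incrementE ma a0 aoo) (incrementE mb b0 boo); congr (_ + _)%E.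
- under [RHS]eq_integral do rewrite EFinM.
  rewrite ge0_integralZl_EFin//.
  + move=> s /=; rewrite in_itv/= lee_fin => /andP[h _]; apply: a0; exact: le_trans h.
  + by apply/measurable_EFinP; exact: sub.
  + exact: weight_u_ge0.
- under [RHS]eq_integral do rewrite EFinM.
  rewrite ge0_integralZl_EFin//.
  + move=> s /=; rewrite in_itv/= lee_fin => /andP[h _]; apply: b0; exact: le_trans h.
  + by apply/measurable_EFinP; exact: sub.
  + exact: weight_y_ge0.
Qed.

Lemma step_integrand_cvg s : t0 < s -> 0 < u s -> 0 < y s ->
  step_integrand n s @[n --> \oo] --> a s * gmean_x r (u s) (y s) + b s * gmean_y r (u s) (y s).
Proof.
move=> ts us ys.
have s0 : 0 <= s by apply/ltW; exact: le_lt_trans ts.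
have cvg_path (f g : R -> R) : (forall s, 0 <= s -> f x @[x --> s^'+] --> f s) ->
    measurable_fun (`[0, +oo[%classic : set R) g -> (forall s, 0 <= s -> 0 <= g s) ->
    (\int[leb]_(s in `[0%R, +oo[) (g s)%:E < +oo)%E ->
    f (grid n (grid_index n s).+1) + increment g n (grid_index n s) @[n --> \oo] --> f s.
  move=> cf mg g0 goo.
  suff cf' : f (grid n (grid_index n s).+1) @[n --> \oo] --> f s.
    by have := cvgD cf' (cvg_increment mg g0 goo ts); rewrite addr0; exact.
  have /cvg_at_rightP := cf s s0; apply; split; last exact/cvg_grid_succ/ltW.
  by move=> n; have := grid_indexP n (grid_index n s) (ltW ts); rewrite eqxx in_itv/= => /andP[].
have cu' := cvg_path _ _ cu ma a0 aoo.
have cy' := cvg_path _ _ cy mb b0 boo.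
have lim : weight_u n (grid_index n s) * a s + weight_y n (grid_index n s) * b s @[n --> \oo] -->
    a s * gmean_x r (u s) (y s) + b s * gmean_y r (u s) (y s).
  rewrite [a s * _]mulrC [b s * _]mulrC.
  apply: cvgD; apply: cvgM; [|exact: cvg_cst| |exact: cvg_cst].
    exact: cvg_gmean_x.
  exact: cvg_gmean_y.
apply: cvg_trans lim; apply: near_eq_cvg.
(* Once [n] exceeds [s - t0], the cell of [s] is among those summed, and it alone contributes at
   [s]. *)
exists (Num.truncn (s - t0)).+1 => // n /= sn.
have ib : (grid_index n s < n * 2 ^ n)%N.
  have st : 0 <= s - t0 by rewrite subr_ge0 ltW.
  rewrite /grid_index truncn_lt_nat; last by rewrite mulr_ge0 ?exprn_ge0.
  rewrite natrM natrX ltr_pM2r ?exprn_gt0//.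
  by have /andP[_ h] := truncn_itv st; apply: lt_le_trans h _; rewrite ler_nat.
rewrite /step_integrand (bigD1 (Ordinal ib))//= big1 ?addr0 => [|i ii0].
  rewrite indicE mem_set ?mul1r//=.
  by rewrite grid_indexP ?ltW.
rewrite indicE memNset ?mul0r//=.
rewrite grid_indexP ?ltW// => /eqP e; move: ii0; rewrite -val_eqE/= -e; by rewrite eqxx.
Qed.

Lemma path_fatou (k : R -> R) : measurable_fun (`[0, +oo[%classic : set R) k ->
  (forall s, 0 <= s -> 0 <= k s) ->
  {ae leb, forall s, t0 < s -> [/\ 0 < u s, 0 < y s &
    k s <= a s * gmean_x r (u s) (y s) + b s * gmean_y r (u s) (y s)]} ->
  (\int[leb]_(s in `[t0, +oo[) (k s)%:E <= limn_einf (fun n => (riemann_sum n)%:E))%E.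
Proof.
move=> mk k0 h.
have -> : (fun n => (riemann_sum n)%:E) =
    (fun n => \int[leb]_(s in `[t0, +oo[) (step_integrand n s)%:E)%E.
  by apply/funext => n; exact: riemann_sumE.
have mstep n : measurable_fun (`[t0, +oo[%classic : set R) (step_integrand n).
  by apply: measurable_sum => i; exact: measurable_step_term.
have step0 n s : t0 <= s -> 0 <= step_integrand n s.
  by move=> ts; apply: sumr_ge0 => i _; exact: step_term_ge0.
apply: le_trans (fatou _ _ _ _) => //; last first.
- by move=> n s /=; rewrite in_itv/= andbT lee_fin; exact: step0.
- by move=> n; apply/measurable_EFinP; exact: mstep.
apply: ae_ge0_le_integral => //.
- by move=> s /=; rewrite in_itv/= andbT lee_fin => ts; apply: k0; exact: le_trans ts.
- by apply/measurable_EFinP; apply: measurable_funS mk => //; exact: itv_t0_sub.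
- move=> s /=; rewrite in_itv/= andbT => ts; apply: (limn_einf_ge (n0 := 0%N)) => n _.
  by rewrite lee_fin; exact: step0.
- by apply: measurable_fun_limn_einf => n; apply/measurable_EFinP; exact: mstep.
(* Pointwise convergence is established at times [s > t0]; the initial time is a Lebesgue-null
   set. *)
have nt0 : {ae leb, forall s, s != t0}.
  exists [set t0]; split; [exact: measurable_set1|exact: lebesgue_measure_set1|].
  by move=> s /= /negP; rewrite negbK => /eqP.
apply: (@filterS2 _ _ (ae_filter_ringOfSetsType leb) _ _ _ _ h nt0) => s {}h st /=; rewrite in_itv/= andbT => ts.
have [|us ys ks] := h; first by rewrite lt_neqAle eq_sym st.
have ts' : t0 < s by rewrite lt_neqAle eq_sym st.
have cE : (step_integrand n s)%:E @[n --> \oo] -->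
    (a s * gmean_x r (u s) (y s) + b s * gmean_y r (u s) (y s))%:E.
  by apply: cvg_EFin; [exact: nearW|exact: step_integrand_cvg].
have [-> _] := cvg_limn_einf_sup cE.
by rewrite lee_fin.
Qed.

End PathFatou.

(** * From almost sure at each time to almost every time on almost every path *)

Section AlmostEverySlice.
Context {d : measure_display} {Omega : measurableType d} {R : realType}.
Variable P : probability Omega R.
Local Notation leb := (@lebesgue_measure R).

(** The indicator of the failure of [Q] has zero expectation at each time. By Tonelli its time
    integral has zero expectation, hence is 0 on almost every path. *)
Lemma ae_slice (Q : R -> Omega -> bool) :
  measurable_fun half_space (fun p : R * Omega => Q p.1 p.2) ->
  (forall t, 0 <= t -> {ae P, forall w, Q t w}) ->
  {ae P, forall w, {ae leb, forall s, 0 <= s -> Q s w}}.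
Proof.
move=> mQ hQ.
pose X (s : R) (w : Omega) : R := if Q s w then 0 else 1.
have mX : measurable_fun half_space (fun p : R * Omega => X p.1 p.2).
  have := @measurable_fun_if _ _ (R * Omega)%type R (cst 0) (cst 1) half_space
    measurable_half_space (fun p => Q p.1 p.2) mQ.
  by apply; exact: measurable_cst.
have X0 t w : 0 <= t -> 0 <= X t w by rewrite /X; case: ifP.
have D0 : `[0, +oo[%classic `<=` (`[0, +oo[%classic : set R) by [].
have mI := measurable_time_integral mX X0 (measurable_itv _) D0.
have I0 w := @time_integral_ge0 _ _ _ X X0 `[0, +oo[%classic w D0.
have int0 : (\int[P]_w \int[leb]_(s in `[0%R, +oo[) (X s w)%:E = 0)%E.
  rewrite (fubini_time_integral P mX X0)//.
  apply: integral0_eq => s /=; rewrite in_itv/= andbT => s0.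
  rewrite (_ : 0%E = \int[P]_w cst 0%E w)%E; last by rewrite integral0.
  apply: ge0_ae_eq_integral => //.
  - apply/measurable_EFinP.
    have := @measurable_comp _ _ _ _ _ _ half_space (fun p : R * Omega => X p.1 p.2)
      setT (fun w : Omega => (s, w)).
    apply => //; first exact: measurable_half_space.
    + by move=> _ [w _ <-]; split => //=; rewrite in_itv/= s0.
    + exact: pair1_measurable.
  - by move=> w _; rewrite lee_fin X0.
  - by apply: filterS (hQ _ s0) => w Qw _; rewrite /X Qw.
have /(ae_eq_integral_abs P measurableT mI) : (\int[P]_w `|\int[leb]_(s in `[0%R, +oo[) (X s w)%:E| = 0)%E.
  by rewrite -int0; apply: eq_integral => w _; rewrite gee0_abs.
apply: filterS => w /(_ Logic.I)/= Iw.
have mXw : measurable_fun (`[0, +oo[%classic : set R) (fun s => (X s w)%:E).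
  by apply/measurable_EFinP; exact: measurable_section.
have /(ae_eq_integral_abs leb (measurable_itv _) mXw) :
    (\int[leb]_(s in `[0%R, +oo[) `|(X s w)%:E| = 0)%E.
  rewrite -Iw; apply: eq_integral => s; rewrite inE/= in_itv/= andbT => s0.
  by rewrite ger0_norm// X0.
apply: (@filterS _ _ (ae_filter_ringOfSetsType leb)) => s h s0.
have := h _; rewrite /= in_itv/= andbT => /(_ s0).
by rewrite /X; case: ifP => // _ [] /eqP; rewrite oner_eq0.
Qed.

End AlmostEverySlice.

(** * Discrete decomposition of the mean of two potentials *)

Section Comparison.
Context {d : measure_display} {Omega : measurableType d} {R : realType}.
Variables (P : probability Omega R) (F : R -> set (set Omega)).
Hypothesis hF : is_filtration F.
Variable r : R.
Hypotheses (r0 : 0 < r) (r1 : r < 1).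
Local Notation FT t := (g_sigma_algebraType (F t)).
Local Notation leb := (@lebesgue_measure R).
Local Notation tail A t w := (\int[leb]_(s in `[t, +oo[) (A s w)%:E)%E.

(** The conditional expectation is kept in integrated form, with the tail in the extended reals;
    [potentialP] translates to [cond_exp_version]. *)
Record potential (U A : R -> Omega -> R) : Prop := Potential {
  potential_progressive : progressive F U;
  potential_cadlag : cadlag U;
  potential_ge0 : forall t w, 0 <= t -> 0 <= U t w;
  integrand_progressive : progressive F A;
  integrand_ge0 : forall t w, 0 <= t -> 0 <= A t w;
  integrand_finite : finite_expected_int P A;
  potentialE : forall t B, 0 <= t -> F t B ->
    (\int[P]_(w in B) (U t w)%:E = \int[P]_(w in B) tail A t w)%E }.

Section increment.
Variables U A : R -> Omega -> R.
Hypothesis hU : potential U A.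

Lemma potential_measurable t : 0 <= t -> measurable_fun setT (U t).
Proof.
move=> t0; have sF := filtration_sigma hF t0; have Fm := filtration_sub hF t0.
apply: (measurable_fun_sub_sigma sF Fm (sub_sigmaT sF)).
exact: (progressive_adapted hF t0 (potential_progressive hU)).
Qed.

Lemma potential_lty t : 0 <= t -> (\int[P]_w (U t w)%:E < +oo)%E.
Proof.
move=> t0; rewrite (potentialE hU t0); last exact: (sub_sigmaT (filtration_sigma hF t0)).
exact: (integral_tail_lty hF (integrand_progressive hU) (integrand_ge0 hU)
  (integrand_finite hU) t0).
Qed.

Definition time_increment s t w := fine (\int[leb]_(x in `[s, t]) (A x w)%:E)%E.

Let mA := progressive_measurable hF (integrand_progressive hU).
Let A0 := integrand_ge0 hU.

Lemma time_increment_ge0 s t w : 0 <= s -> 0 <= time_increment s t w.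
Proof. by move=> s0; apply/fine_ge0/time_integral_ge0 => //; exact: itvcc_sub. Qed.

Lemma measurable_time_increment s t : 0 <= s -> measurable_fun setT (time_increment s t).
Proof.
move=> s0; apply: measurableT_comp => //; apply: measurable_time_integral => //.
exact: itvcc_sub.
Qed.

(** This is the martingale property of the potential plus the running integral of its integrand. *)
Lemma integral_potential_increment s t B : 0 <= s -> s <= t -> F s B ->
  (\int[P]_(w in B) (U t w + time_increment s t w)%:E = \int[P]_(w in B) (U s w)%:E)%E.
Proof.
move=> s0 st FB; have t0 := le_trans s0 st.
have mB : measurable B by exact: (filtration_sub hF s0).
have mU := potential_measurable t0.
have minc := @measurable_time_increment s t s0.
have mint : measurable_fun setT (fun w => \int[leb]_(x in `[s, t]) (A x w)%:E)%E.
  by apply: measurable_time_integral => //; exact: itvcc_sub.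
have mtail : measurable_fun setT (fun w => tail A t w).
  by apply: measurable_time_integral => //; exact: itvcy_sub.
have int0 w : (0 <= \int[leb]_(x in `[s, t]) (A x w)%:E)%E.
  by apply: time_integral_ge0 => //; exact: itvcc_sub.
have tail0 w : (0 <= tail A t w)%E by apply: time_integral_ge0 => //; exact: itvcy_sub.
have mAw w : measurable_fun (`[0, +oo[%classic : set R) (fun s => A s w).
  exact: measurable_section.
under eq_integral do rewrite EFinD.
rewrite ge0_integralD//; last 4 first.
- by move=> w _; rewrite lee_fin; exact: potential_ge0 hU _ _ t0.
- exact/measurable_funTS/measurable_EFinP.
- by move=> w _; rewrite lee_fin time_increment_ge0.
- exact/measurable_funTS/measurable_EFinP.
rewrite (potentialE hU t0 (filtration_le hF s0 st FB)) (potentialE hU s0 FB).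
rewrite [X in (_ + X)%E](_ : _ = \int[P]_(w in B) \int[leb]_(x in `[s, t]) (A x w)%:E)%E; last first.
  apply: ge0_ae_eq_integral => //.
  - exact/measurable_funTS/measurable_EFinP.
  - exact: measurable_funTS.
  - by move=> w _; rewrite lee_fin time_increment_ge0.
  - have := ae_tail_fin hF (integrand_progressive hU) A0 (integrand_finite hU).
    apply: filterS => w woo _; rewrite fineK// ge0_fin_numE//.
    apply: le_lt_trans woo; apply: ge0_subset_integral => //.
    + by apply/measurable_EFinP; exact: mAw.
    + by move=> x /=; rewrite in_itv/= andbT lee_fin; exact: A0.
    + exact: itvcc_sub.
rewrite -ge0_integralD//; [|exact: measurable_funTS..].
apply: eq_integral => w _.
by rewrite [RHS](integral_split_cy (mAw w) (A0 ^~ w) s0 st) addeC.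
Qed.

End increment.

Variables U Y A B : R -> Omega -> R.
Hypotheses (hU : potential U A) (hY : potential Y B).
Hypothesis Upos : forall t, 0 <= t -> {ae P, forall w, 0 < U t w}.
Hypothesis Ypos : forall t, 0 <= t -> {ae P, forall w, 0 < Y t w}.

Local Notation alpha s t w := (time_increment A s t w).
Local Notation beta s t w := (time_increment B s t w).

(** The part of the mean at the padded right end that, by [gmean_increment], exceeds the mean
    without padding: a discrete drift. *)
Definition gmean_gain s t w :=
  gmean_x r (U t w + alpha s t w) (Y t w + beta s t w) * alpha s t w +
  gmean_y r (U t w + alpha s t w) (Y t w + beta s t w) * beta s t w.

Lemma measurable_gmean d' (T : measurableType d') (f g : T -> R) :
  measurable_fun setT f -> measurable_fun setT g ->
  [/\ measurable_fun setT (fun x => gmean r (f x) (g x)),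
   measurable_fun setT (fun x => gmean_x r (f x) (g x)) &
   measurable_fun setT (fun x => gmean_y r (f x) (g x))].
Proof.
move=> mf mg.
have mp (h : T -> R) p : measurable_fun setT h -> measurable_fun setT (fun x => h x `^ p).
  by move=> mh; apply: (@measurableT_comp _ _ _ _ _ _ (@powR R ^~ p)).
split; first by apply: measurable_funM; exact: mp.
- by apply: measurable_funM => //; apply: measurable_funM; exact: mp.
- by apply: measurable_funM => //; apply: measurable_funM; exact: mp.
Qed.

Lemma gmean_gain_ge0 s t w : 0 <= s -> 0 <= gmean_gain s t w.
Proof.
move=> s0; rewrite /gmean_gain addr_ge0// mulr_ge0 ?gmean_x_ge0 ?gmean_y_ge0//.
  exact: time_increment_ge0 hU _ _ _ s0.
exact: time_increment_ge0 hY _ _ _ s0.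
Qed.

Lemma measurable_gmean_gain s t : 0 <= s -> s <= t -> measurable_fun setT (gmean_gain s t).
Proof.
move=> s0 st; have t0 := le_trans s0 st.
have mU := potential_measurable hU t0; have mY := potential_measurable hY t0.
have ma := @measurable_time_increment U A hU s t s0.
have mb := @measurable_time_increment Y B hY s t s0.
have [_ mx my] := measurable_gmean (measurable_funD mU ma) (measurable_funD mY mb).
by apply: measurable_funD; apply: measurable_funM.
Qed.

Lemma measurable_gmean_potential t : 0 <= t ->
  measurable_fun setT (fun w => gmean r (U t w) (Y t w)).
Proof.
move=> t0; have [] // := measurable_gmean (potential_measurable hU t0) (potential_measurable hY t0).
Qed.

(* Conditional Jensen for the concave function [gmean], through its tangent plane
   at the [F s]-measurable point [(U s, Y s)]. *)
Lemma integral_gmean_increment s t E : 0 <= s -> s <= t -> F s E ->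
  (\int[P]_(w in E) (gmean r (U t w + alpha s t w) (Y t w + beta s t w))%:E <=
   \int[P]_(w in E) (gmean r (U s w) (Y s w))%:E)%E.
Proof.
move=> s0 st FE; have t0 := le_trans s0 st.
have sF := filtration_sigma hF s0; have Fm := filtration_sub hF s0.
have mE := Fm _ FE.
have mUt := potential_measurable hU t0; have mYt := potential_measurable hY t0.
have ma := @measurable_time_increment U A hU s t s0.
have mb := @measurable_time_increment Y B hY s t s0.
have mua := measurable_funD mUt ma; have myb := measurable_funD mYt mb.
have mUs := potential_measurable hU s0; have mYs := potential_measurable hY s0.
have Ut0 w := potential_ge0 hU w t0; have Yt0 w := potential_ge0 hY w t0.
have Us0 w := potential_ge0 hU w s0; have Ys0 w := potential_ge0 hY w s0.
have a0 w := @time_increment_ge0 U A hU s t w s0.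
have b0 w := @time_increment_ge0 Y B hY s t w s0.
have ua0 w : 0 <= U t w + alpha s t w by rewrite addr_ge0.
have yb0 w : 0 <= Y t w + beta s t w by rewrite addr_ge0.
have [mg _ _] := measurable_gmean mua myb.
have [mgs mxs mys] := measurable_gmean mUs mYs.
have [_ axs ays] := measurable_gmean (progressive_adapted hF s0 (potential_progressive hU))
  (progressive_adapted hF s0 (potential_progressive hY)).
pose p w := gmean_x r (U s w) (Y s w); pose q w := gmean_y r (U s w) (Y s w).
have p0 w : 0 <= p w by exact: gmean_x_ge0.
have q0 w : 0 <= q w by exact: gmean_y_ge0.
have mE' (f : Omega -> R) : measurable_fun setT f -> measurable_fun E (fun w => (f w)%:E).
  by move=> mf; exact/measurable_funTS/measurable_EFinP.
have mpM (f g : Omega -> R) : measurable_fun setT f -> measurable_fun setT g ->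
    measurable_fun E (fun w => (f w * g w)%:E).
  by move=> mf mg'; apply: mE'; exact: measurable_funM.
apply: (@le_trans _ _ (\int[P]_(w in E) (p w * (U t w + alpha s t w))%:E +
    \int[P]_(w in E) (q w * (Y t w + beta s t w))%:E)%E).
  rewrite -ge0_integralD//; [|by move=> w _; rewrite lee_fin mulr_ge0|exact: mpM|
    by move=> w _; rewrite lee_fin mulr_ge0|exact: mpM].
  apply: ae_ge0_le_integral => //.
  - by move=> w _; rewrite lee_fin gmean_ge0.
  - exact: mE'.
  - by move=> w _; rewrite adde_ge0// lee_fin mulr_ge0.
  - by apply: emeasurable_funD; exact: mpM.
  - apply: filterS2 (Upos s0) (Ypos s0) => w us ys _.
    by rewrite -EFinD lee_fin; exact: gmean_tangent.
apply: (@le_trans _ _ (\int[P]_(w in E) (p w * U s w)%:E +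
    \int[P]_(w in E) (q w * Y s w)%:E)%E).
  apply: leeD; apply: (le_integral_weight sF Fm) => //.
  - by move=> C FC; rewrite (integral_potential_increment hU).
  - by move=> C FC; rewrite (integral_potential_increment hY).
rewrite -ge0_integralD//; [|by move=> w _; rewrite lee_fin mulr_ge0|exact: mpM|
    by move=> w _; rewrite lee_fin mulr_ge0|exact: mpM].
rewrite le_eqVlt; apply/orP; left; apply/eqP; apply: ge0_ae_eq_integral => //.
- by apply: emeasurable_funD; exact: mpM.
- exact: mE'.
- by move=> w _; rewrite adde_ge0// lee_fin mulr_ge0.
- by move=> w _; rewrite lee_fin gmean_ge0.
apply: filterS2 (Upos s0) (Ypos s0) => w us ys _.
by rewrite -EFinD gmean_euler.
Qed.

(** The padded mean is squeezed: from above by Jensen at time [s], from below by the tangent plane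
    at the padded point at time [t]. *)
Lemma integral_gmean_step s t E : 0 <= s -> s <= t -> F s E ->
  (\int[P]_(w in E) (gmean r (U t w) (Y t w))%:E + \int[P]_(w in E) (gmean_gain s t w)%:E <=
   \int[P]_(w in E) (gmean r (U s w) (Y s w))%:E)%E.
Proof.
move=> s0 st FE; have t0 := le_trans s0 st.
have mE := filtration_sub hF s0 FE.
have mUt := potential_measurable hU t0; have mYt := potential_measurable hY t0.
have ma := @measurable_time_increment U A hU s t s0.
have mb := @measurable_time_increment Y B hY s t s0.
have a0 w := @time_increment_ge0 U A hU s t w s0.
have b0 w := @time_increment_ge0 Y B hY s t w s0.
have [mg _ _] := measurable_gmean (measurable_funD mUt ma) (measurable_funD mYt mb).
have mgt := measurable_gmean_potential t0.
have mgain := measurable_gmean_gain s0 st.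
apply: le_trans (integral_gmean_increment s0 st FE).
rewrite -ge0_integralD//; last first.
- exact/measurable_funTS/measurable_EFinP.
- by move=> w _; rewrite lee_fin gmean_gain_ge0.
- exact/measurable_funTS/measurable_EFinP.
- by move=> w _; rewrite lee_fin gmean_ge0.
apply: ae_ge0_le_integral => //.
- by move=> w _; rewrite adde_ge0// lee_fin ?gmean_ge0// gmean_gain_ge0.
- by apply: emeasurable_funD; exact/measurable_funTS/measurable_EFinP.
- by move=> w _; rewrite lee_fin gmean_ge0.
- exact/measurable_funTS/measurable_EFinP.
apply: filterS2 (Upos t0) (Ypos t0) => w us ys _.
by rewrite -EFinD lee_fin; exact: gmean_increment.
Qed.

Lemma integral_gmean_gain_sum (t0 : R) n N E : 0 <= t0 -> F t0 E ->
  (\int[P]_(w in E) (gmean r (U (grid t0 n N) w) (Y (grid t0 n N) w))%:E +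
   \int[P]_(w in E) (\sum_(i < N) gmean_gain (grid t0 n i) (grid t0 n i.+1) w)%:E <=
   \int[P]_(w in E) (gmean r (U t0 w) (Y t0 w))%:E)%E.
Proof.
move=> t00 FE; have mE := filtration_sub hF t00 FE.
have g0 i := grid_ge0 t00 n i.
have gi i : grid t0 n i <= grid t0 n i.+1 by exact: grid_le.
have tg i : t0 <= grid t0 n i by rewrite lerDl dyadic_ge0.
elim: N => [|N ih].
  rewrite [X in (_ + X)%E](_ : _ = 0%E); last first.
    by apply: integral0_eq => w _; rewrite big_ord0.
  by rewrite adde0 /grid /dyadic mul0r addr0.
apply: le_trans ih.
under [X in (_ + X <= _)%E]eq_integral do rewrite big_ord_recr/= EFinD.
rewrite ge0_integralD//; first last.
- exact/measurable_funTS/measurable_EFinP/measurable_gmean_gain.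
- by move=> w _; rewrite lee_fin gmean_gain_ge0.
- apply/measurable_funTS/measurable_EFinP/measurable_sum => i.
  exact: measurable_gmean_gain.
- by move=> w _; rewrite lee_fin sumr_ge0// => i _; exact: gmean_gain_ge0.
rewrite addeA addeAC; apply: leeD => //.
by apply: integral_gmean_step => //; exact: (filtration_le hF t00 (tg N)).
Qed.

Hypothesis AB : forall s w, 0 <= s -> 0 < U s w -> 0 < Y s w ->
  A s w * gmean_x r (U s w) (Y s w) = (1 - r) * B s w.

(** Fatou is used twice, in time along each path and then over [Omega]. In the limiting drift [AB]
    turns the [U]-term into [(1 - r) B], and the assumed bound [m] on the ratio makes the [Y]-term
    at least [r m B]. *)
Lemma integral_gmean_lower_bound (m t0 : R) E : 0 <= m -> 0 <= t0 -> F t0 E ->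
  (forall t, 0 <= t -> {ae P, forall w, m * Y t w <= gmean r (U t w) (Y t w)}) ->
  (\int[P]_(w in E) ((1 - r + r * m) * Y t0 w)%:E <=
   \int[P]_(w in E) (gmean r (U t0 w) (Y t0 w))%:E)%E.
Proof.
move=> m0 t00 FE hm; have mE := filtration_sub hF t00 FE.
set c := 1 - r + r * m.
have c0 : 0 <= c by rewrite addr_ge0 ?mulr_ge0 ?subr_ge0// ltW.
have mA := progressive_measurable hF (integrand_progressive hU).
have mB := progressive_measurable hF (integrand_progressive hY).
have mUj := progressive_measurable hF (potential_progressive hU).
have mYj := progressive_measurable hF (potential_progressive hY).
have A0 := integrand_ge0 hU; have B0 := integrand_ge0 hY.
have mAw w : measurable_fun (`[0, +oo[%classic : set R) (A ^~ w) by exact: measurable_section.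
have mBw w : measurable_fun (`[0, +oo[%classic : set R) (B ^~ w) by exact: measurable_section.
have mtail : measurable_fun setT (fun w => tail B t0 w).
  by apply: measurable_time_integral => //; exact: itvcy_sub.
have tail0 w : (0 <= tail B t0 w)%E by apply: time_integral_ge0 => //; exact: itvcy_sub.
pose S n w := \sum_(i < n * 2 ^ n) gmean_gain (grid t0 n i) (grid t0 n i.+1) w.
have S0 n w : 0 <= S n w.
  by apply: sumr_ge0 => i _; apply: gmean_gain_ge0; exact: grid_ge0.
have mS n : measurable_fun setT (S n).
  by apply: measurable_sum => i; apply: measurable_gmean_gain; [exact: grid_ge0|exact: grid_le].
have mSE n : measurable_fun E (fun w => (S n w)%:E).
  exact/measurable_funTS/measurable_EFinP.
have -> : (\int[P]_(w in E) (c * Y t0 w)%:E = \int[P]_(w in E) (c%:E * tail B t0 w))%E.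
  under eq_integral do rewrite EFinM.
  rewrite !ge0_integralZl_EFin//; [|exact: measurable_funTS| |].
  - by rewrite (potentialE hY t00 FE).
  - by move=> w _; rewrite lee_fin; exact: potential_ge0 hY _ _ t00.
  - exact/measurable_funTS/measurable_EFinP/(potential_measurable hY).
apply: (@le_trans _ _ (\int[P]_(w in E) limn_einf (fun n => (S n w)%:E))%E); last first.
  apply: le_trans (fatou _ _ _ _) _ => //; first by move=> n w _; rewrite lee_fin.
  apply: limn_einf_le => n; apply: le_trans (integral_gmean_gain_sum n (n * 2 ^ n) t00 FE).
  by apply: leeDr; apply: integral_ge0 => w _; rewrite lee_fin gmean_ge0.
apply: ae_ge0_le_integral => //.
- by move=> w _; rewrite mule_ge0.
- by apply: emeasurable_funM => //; exact: measurable_funTS.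
- by move=> w _; apply: (limn_einf_ge (n0 := 0%N)) => n _; rewrite lee_fin.
- exact: measurable_fun_limn_einf.
have hQ : {ae P, forall w, {ae leb, forall s, 0 <= s ->
    [&& 0 < U s w, 0 < Y s w & m * Y s w <= gmean r (U s w) (Y s w)]}}.
  apply: (@ae_slice _ _ _ P (fun s w =>
    [&& 0 < U s w, 0 < Y s w & m * Y s w <= gmean r (U s w) (Y s w)])).
    have mp (h : R * Omega -> R) p : measurable_fun half_space h ->
        measurable_fun half_space (fun x => h x `^ p).
      by move=> mh; apply: (@measurableT_comp _ _ _ _ _ _ (@powR R ^~ p)).
    apply: measurable_and; first exact: measurable_fun_ltr.
    apply: measurable_and; first exact: measurable_fun_ltr.
    apply: measurable_fun_ler; first by apply: measurable_funM.
    by apply: measurable_funM; exact: mp.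
  move=> t t0'; apply: filterS3 (Upos t0') (Ypos t0') (hm _ t0') => w -> -> ->.
  by [].
have fA := ae_tail_fin hF (integrand_progressive hU) A0 (integrand_finite hU).
have fB := ae_tail_fin hF (integrand_progressive hY) B0 (integrand_finite hY).
apply: filterS3 hQ fA fB => w hQ fA fB _.
have -> : (c%:E * tail B t0 w = \int[leb]_(s in `[t0, +oo[) (c * B s w)%:E)%E.
  under [RHS]eq_integral do rewrite EFinM.
  rewrite ge0_integralZl_EFin//.
  - move=> s /=; rewrite in_itv/= andbT lee_fin => ts; apply: B0; exact: le_trans ts.
  - by apply/measurable_EFinP; apply: measurable_funS (mBw w) => //; exact: itvcy_sub.
apply: (@path_fatou R r (U ^~ w) (Y ^~ w) (A ^~ w) (B ^~ w) t0 r0 r1 t00) => //.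
- by move=> s s0; have [] := potential_cadlag hU w s0.
- by move=> s s0; have [] := potential_cadlag hY w s0.
- by move=> s; exact: A0.
- by move=> s; exact: B0.
- by apply: measurable_funM => //; exact: mBw.
- by move=> s s0; rewrite mulr_ge0// B0.
apply: (@filterS _ _ (ae_filter_ringOfSetsType leb)) hQ => s hs ts.
have s0 : 0 <= s by exact: le_trans (ltW ts).
have /and3P[us ys mys] := hs s0; split => //.
rewrite (AB s0 us ys) /c mulrDl lerD2l mulrC ler_wpM2l ?B0//.
exact: gmean_le (ltW us) ys mys.
Qed.

Lemma gmean_lower_bound (m : R) : 0 <= m ->
  (forall t, 0 <= t -> {ae P, forall w, m * Y t w <= gmean r (U t w) (Y t w)}) ->
  forall t, 0 <= t -> {ae P, forall w, (1 - r + r * m) * Y t w <= gmean r (U t w) (Y t w)}.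
Proof.
move=> m0 hm t t0.
have sF := filtration_sigma hF t0; have Fm := filtration_sub hF t0.
have aU := progressive_adapted hF t0 (potential_progressive hU).
have aY := progressive_adapted hF t0 (potential_progressive hY).
have c0 : 0 <= 1 - r + r * m by rewrite addr_ge0 ?mulr_ge0 ?subr_ge0// ltW.
apply: (ae_le_of_le_integral sF Fm).
- exact: measurable_funM.
- by have [] := measurable_gmean aU aY.
- by move=> w; rewrite mulr_ge0//; exact: potential_ge0 hY _ _ t0.
- by move=> w; exact: gmean_ge0.
- under eq_integral do rewrite EFinM.
  rewrite ge0_integralZl_EFin//.
  + by rewrite lte_mul_pinfty//; exact: (potential_lty hY).
  + by move=> w _; rewrite lee_fin; exact: potential_ge0 hY _ _ t0.
  + exact/measurable_EFinP/(potential_measurable hY).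
- by move=> E FE; exact: integral_gmean_lower_bound.
Qed.

(* Iterating [m |-> 1 - r + r m] from [0] gives [m = 1 - r ^ j], which tends to 1. *)
Lemma potential_le t : 0 <= t -> {ae P, forall w, Y t w <= U t w}.
Proof.
move=> t0.
have h j : forall t, 0 <= t ->
    {ae P, forall w, (1 - r ^+ j) * Y t w <= gmean r (U t w) (Y t w)}.
  elim: j => [|j ih] s s0.
    by apply: aeW => w; rewrite expr0 subrr mul0r gmean_ge0.
  rewrite (_ : 1 - r ^+ j.+1 = 1 - r + r * (1 - r ^+ j)); last by rewrite exprS; ring.
  apply: gmean_lower_bound => //.
  by rewrite subr_ge0 exprn_ile1// ltW.
have {}h := ae_foralln (fun j => h j t t0).
apply: filterS3 h (Upos t0) (Ypos t0) => w h us ys.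
apply: (@le_of_le_gmean R r) => //; first exact: ltW.
have c : (1 - r ^+ j) * Y t w @[j --> \oo] --> (1 - 0) * Y t w.
  apply: cvgM; last exact: cvg_cst.
  apply: cvgB; first exact: cvg_cst.
  by apply: cvg_expr; rewrite ger0_norm// ltW.
rewrite subr0 mul1r in c; apply: (cvgr_to_le c); exact: nearW.
Qed.

End Comparison.

(** * Existence by monotone iteration *)

Section PotentialOrder.
Context {d : measure_display} {Omega : measurableType d} {R : realType}.
Variables (P : probability Omega R) (F : R -> set (set Omega)).
Hypothesis hF : is_filtration F.
Local Notation FT t := (g_sigma_algebraType (F t)).
Local Notation leb := (@lebesgue_measure R).
Local Notation tail A t w := (\int[leb]_(s in `[t, +oo[) (A s w)%:E)%E.
Local Notation joint A := (measurable_fun half_space (fun p : R * Omega => A p.1 p.2)).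
Implicit Types (U A B X : R -> Omega -> R).

Lemma progressive_comp2 (phi : R -> R -> R) A B :
  (forall d' (T : measurableType d') (D : set T) (f g : T -> R), measurable_fun D f ->
     measurable_fun D g -> measurable_fun D (fun x => phi (f x) (g x))) ->
  progressive F A -> progressive F B -> progressive F (fun t w => phi (A t w) (B t w)).
Proof.
move=> mphi /(progressiveP hF) pA /(progressiveP hF) pB; apply/(progressiveP hF) => t t0.
exact: mphi (pA t t0) (pB t t0).
Qed.

Lemma progressiveZ c A : progressive F A -> progressive F (fun t w => c * A t w).
Proof.
move=> pA; apply: (@progressive_comp2 (fun x _ => c * x) A A) => // d' T D f g mf _.
exact: measurable_funM.
Qed.

Lemma progressive_powR p A : progressive F A -> progressive F (fun t w => A t w `^ p).
Proof.
move=> pA; apply: (@progressive_comp2 (fun x _ => x `^ p) A A) => // d' T D f g mf _.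
by apply: (@measurableT_comp _ _ _ _ _ _ (@powR R ^~ p)).
Qed.

Lemma progressiveM A B : progressive F A -> progressive F B ->
  progressive F (fun t w => A t w * B t w).
Proof.
by apply: (@progressive_comp2 (fun x y => x * y)) => d' T D f g; exact: measurable_funM.
Qed.

(** The null set in the hypothesis depends on the time; [ae_slice] moves the exception to a null set
    of times on almost every path. *)
Lemma time_integral_ae_le A B (D : set R) : joint A -> joint B ->
  (forall t w, 0 <= t -> 0 <= A t w) -> (forall t w, 0 <= t -> 0 <= B t w) ->
  (forall t, 0 <= t -> {ae P, forall w, A t w <= B t w}) ->
  measurable D -> D `<=` `[0, +oo[%classic ->
  {ae P, forall w, (\int[leb]_(s in D) (A s w)%:E <= \int[leb]_(s in D) (B s w)%:E)%E}.
Proof.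
move=> mA mB A0 B0 AB mD D0.
have h : {ae P, forall w, {ae leb, forall s, 0 <= s -> A s w <= B s w}}.
  by apply: (@ae_slice _ _ _ P (fun s w => A s w <= B s w)) => //; exact: measurable_fun_ler.
apply: filterS h => w h; apply: ae_ge0_le_integral => //.
- by move=> s /D0 /=; rewrite in_itv/= andbT lee_fin; exact: A0.
- by apply/measurable_EFinP; exact: measurable_section.
- by move=> s /D0 /=; rewrite in_itv/= andbT lee_fin; exact: B0.
- by apply/measurable_EFinP; exact: measurable_section.
apply: (@filterS _ _ (ae_filter_ringOfSetsType leb)) h => s hs /D0/=.
by rewrite in_itv/= andbT lee_fin; exact: hs.
Qed.

Lemma expected_time_integral_le A B (D : set R) E : joint A -> joint B ->
  (forall t w, 0 <= t -> 0 <= A t w) -> (forall t w, 0 <= t -> 0 <= B t w) ->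
  (forall t, 0 <= t -> {ae P, forall w, A t w <= B t w}) ->
  measurable D -> D `<=` `[0, +oo[%classic -> measurable E ->
  (\int[P]_(w in E) \int[leb]_(s in D) (A s w)%:E <=
   \int[P]_(w in E) \int[leb]_(s in D) (B s w)%:E)%E.
Proof.
move=> mA mB A0 B0 AB mD D0 mE; apply: ae_ge0_le_integral => //.
- by move=> w _; exact: time_integral_ge0.
- by apply: measurable_funTS; exact: measurable_time_integral.
- by move=> w _; exact: time_integral_ge0.
- by apply: measurable_funTS; exact: measurable_time_integral.
by apply: filterS (time_integral_ae_le mA mB A0 B0 AB mD D0) => w h _.
Qed.

Lemma finite_expected_int_le A B : joint A -> joint B ->
  (forall t w, 0 <= t -> 0 <= A t w) -> (forall t w, 0 <= t -> 0 <= B t w) ->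
  (forall t, 0 <= t -> {ae P, forall w, A t w <= B t w}) ->
  finite_expected_int P B -> finite_expected_int P A.
Proof.
move=> mA mB A0 B0 AB; apply: le_lt_trans.
exact: expected_time_integral_le.
Qed.

(** Both signs of [c] matter, because the factor [(1 - R)^-1] of the aggregator is negative when
    [R > 1]. *)
Lemma time_integralZ A (D : set R) c w : joint A ->
  (forall t w, 0 <= t -> 0 <= A t w) -> measurable D -> D `<=` `[0, +oo[%classic ->
  (\int[leb]_(s in D) (c * A s w)%:E = c%:E * \int[leb]_(s in D) (A s w)%:E)%E.
Proof.
move=> mA A0 mD D0.
have mAw : measurable_fun D (fun s => (A s w)%:E).
  by apply/measurable_EFinP; exact: measurable_section.
have Aw0 s : D s -> (0 <= (A s w)%:E)%E.
  by move=> /D0/=; rewrite in_itv/= andbT lee_fin; exact: A0.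
under eq_integral do rewrite EFinM.
have [c0|c0] := leP 0 c; first exact: ge0_integralZl_EFin.
have Nc0 : 0 <= - c by rewrite oppr_ge0 ltW.
transitivity (\int[leb]_(s in D) - ((- c)%:E * (A s w)%:E))%E.
  by apply: eq_integral => s _; rewrite -!EFinM -EFinN mulNr opprK.
rewrite integral_ge0N; last by move=> s Ds; rewrite mule_ge0// Aw0.
by rewrite ge0_integralZl_EFin// EFinN mulNe oppeK.
Qed.

Lemma finite_expected_intZ A c : joint A -> (forall t w, 0 <= t -> 0 <= A t w) -> 0 <= c ->
  finite_expected_int P A -> finite_expected_int P (fun t w => c * A t w).
Proof.
move=> mA A0 c0 Aoo; rewrite /finite_expected_int.
have D0 : `[0, +oo[%classic `<=` (`[0, +oo[%classic : set R) by [].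
rewrite (eq_integral (fun w => c%:E * tail A 0%R w)%E); last first.
  by move=> w _; exact: (time_integralZ _ _ mA A0).
rewrite ge0_integralZl_EFin//.
- by rewrite lte_mul_pinfty.
- by move=> w _; exact: time_integral_ge0.
- exact: measurable_time_integral.
Qed.

Lemma potentialZ U A c : 0 <= c -> potential P F U A ->
  potential P F (fun t w => c * U t w) (fun t w => c * A t w).
Proof.
move=> c0 hU.
have mA := progressive_measurable hF (integrand_progressive hU).
have A0 := integrand_ge0 hU.
split.
- by apply: progressiveZ; exact: (potential_progressive hU).
- move=> w t t0; have [h1 h2] := potential_cadlag hU w t0.
  split; first by apply: cvgM => //; exact: cvg_cst.
  move=> /h2[l hl]; exists (c * l); by apply: cvgM => //; exact: cvg_cst.
- by move=> t w t0; rewrite mulr_ge0//; exact: potential_ge0 hU _ _ t0.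
- by apply: progressiveZ; exact: (integrand_progressive hU).
- by move=> t w t0; rewrite mulr_ge0// A0.
- exact: finite_expected_intZ (integrand_finite hU).
move=> t E t0 FE; have mE := filtration_sub hF t0 FE.
under eq_integral do rewrite EFinM.
rewrite ge0_integralZl_EFin//; last 2 first.
- by move=> w _; rewrite lee_fin; exact: potential_ge0 hU _ _ t0.
- exact/measurable_funTS/measurable_EFinP/(potential_measurable hF hU).
rewrite (potentialE hU t0 FE) -ge0_integralZl_EFin//.
- by apply: eq_integral => w _; rewrite time_integralZ//; exact: itvcy_sub.
- by move=> w _; apply: time_integral_ge0 => //; exact: itvcy_sub.
- by apply: measurable_funTS; apply: measurable_time_integral => //; exact: itvcy_sub.
Qed.

Lemma potential_mono U U' A A' : potential P F U A -> potential P F U' A' ->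
  (forall t, 0 <= t -> {ae P, forall w, A t w <= A' t w}) ->
  forall t, 0 <= t -> {ae P, forall w, U t w <= U' t w}.
Proof.
move=> hU hU' AA' t t0.
apply: (ae_le_of_le_integral (filtration_sigma hF t0) (filtration_sub hF t0)).
- exact: progressive_adapted (potential_progressive hU).
- exact: progressive_adapted (potential_progressive hU').
- by move=> w; exact: potential_ge0 hU _ _ t0.
- by move=> w; exact: potential_ge0 hU' _ _ t0.
- exact: potential_lty hF _ _ hU _ t0.
- move=> E FE; rewrite (potentialE hU t0 FE) (potentialE hU' t0 FE).
  apply: expected_time_integral_le => //.
  + exact: progressive_measurable (integrand_progressive hU).
  + exact: progressive_measurable (integrand_progressive hU').
  + exact: integrand_ge0 hU.
  + exact: integrand_ge0 hU'.
  + exact: itvcy_sub.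
  + exact: filtration_sub FE.
Qed.

(** This closes the fixed point: a càdlàg version agrees with the limit of the iteration only almost
    surely at each time. *)
Lemma potential_ae_eq_integrand U A A' : potential P F U A -> progressive F A' ->
  (forall t w, 0 <= t -> 0 <= A' t w) ->
  (forall t, 0 <= t -> {ae P, forall w, A t w = A' t w}) ->
  potential P F U A'.
Proof.
move=> hU pA' A'0 AA'.
have mA := progressive_measurable hF (integrand_progressive hU).
have mA' := progressive_measurable hF pA'.
have A0 := integrand_ge0 hU.
have le1 t : 0 <= t -> {ae P, forall w, A t w <= A' t w}.
  by move=> t0; apply: filterS (AA' _ t0) => w ->.
have le2 t : 0 <= t -> {ae P, forall w, A' t w <= A t w}.
  by move=> t0; apply: filterS (AA' _ t0) => w ->.
split => //; [exact: potential_progressive hU|exact: potential_cadlag hU|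
  exact: potential_ge0 hU| |].
- exact: finite_expected_int_le (integrand_finite hU).
move=> t E t0 FE; rewrite (potentialE hU t0 FE).
have mE := filtration_sub hF t0 FE.
by apply/eqP; rewrite eq_le; apply/andP; split; apply: expected_time_integral_le => //; exact: itvcy_sub.
Qed.

Lemma potentialP U A : progressive F U -> cadlag U ->
  (forall t w, 0 <= t -> 0 <= U t w) -> progressive F A ->
  (forall t w, 0 <= t -> 0 <= A t w) -> finite_expected_int P A ->
  potential P F U A <->
  (forall t, 0 <= t -> cond_exp_version P (F t) (tail_int A t) (U t)).
Proof.
move=> pU cU U0 pA A0 Aoo; split=> [h t t0|h].
  apply/(cond_exp_tailP hF pA A0 Aoo t0 (fun w => U0 t w t0)); split.
    exact: progressive_adapted pU.
  by move=> E FE; exact: potentialE h _ _ t0 FE.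
split => // t E t0 FE.
by have /(cond_exp_tailP hF pA A0 Aoo t0 (fun w => U0 t w t0))[_] := h t t0; exact.
Qed.

End PotentialOrder.

(** * Iteration between a subsolution and a supersolution *)

Section Existence.
Context {d : measure_display} {Omega : measurableType d} {R : realType}.
Variables (P : probability Omega R) (F : R -> set (set Omega)).
Hypotheses (hF : is_filtration F) (cF : filtration_complete P F).
Hypothesis rF : filtration_right_continuous F.
Local Notation leb := (@lebesgue_measure R).
Local Notation tail A t w := (\int[leb]_(s in `[t, +oo[) (A s w)%:E)%E.

Variables (r th k K : R) (H X J : R -> Omega -> R).
Hypotheses (r0 : 0 < r) (r1 : r < 1) (th0 : 0 < th) (k0 : 0 < k) (kK : k <= K).
Hypotheses (pH : progressive F H) (H0 : forall t w, 0 <= t -> 0 <= H t w).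
Hypotheses (pX : progressive F X) (X0 : forall t w, 0 <= t -> 0 < X t w).
Hypothesis HX : forall t w, 0 <= t -> H t w * X t w `^ r = th * X t w.
Hypothesis hJ : potential P F J X.
Hypothesis JX : forall t, 0 <= t -> {ae P, forall w, k * J t w <= X t w /\ X t w <= K * J t w}.

Definition generator (U : R -> Omega -> R) t w := H t w * U t w `^ r.

(* The constant making [scale K * X] a subsolution and [scale k * X] a
   supersolution, see [scaleE]. *)
Definition scale (c : R) : R := (th / c) `^ (1 - r)^-1.

Lemma scale_gt0 c : 0 < c -> 0 < scale c.
Proof. by move=> c0; rewrite powR_gt0// divr_gt0. Qed.

Lemma scaleE c : 0 < c -> th * scale c `^ r = c * scale c.
Proof.
move=> c0; have s0 := scale_gt0 c0.
have e : scale c `^ (1 - r) = th / c.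
  rewrite /scale -powRrM mulVf ?powRr1 ?divr_ge0 ?ltW//.
  by rewrite gt_eqF// subr_gt0.
rewrite -[in RHS](powR_split r s0) e; field; rewrite gt_eqF//.
Qed.

Lemma generator_ge0 U t w : 0 <= t -> 0 <= generator U t w.
Proof. by move=> t0; rewrite mulr_ge0 ?powR_ge0// H0. Qed.

Lemma generator_progressive U : progressive F U -> progressive F (generator U).
Proof. by move=> pU; apply: progressiveM => //; exact: progressive_powR. Qed.

Lemma generator_le U V t w : 0 <= t -> 0 <= U t w -> U t w <= V t w ->
  generator U t w <= generator V t w.
Proof.
move=> t0 U0 UV; rewrite ler_wpM2l ?H0// ge0_ler_powR ?nnegrE//; first exact: ltW.
exact: le_trans UV.
Qed.

Lemma generatorX c t w : 0 <= c -> 0 <= t ->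
  generator (fun t w => c * X t w) t w = th * c `^ r * X t w.
Proof.
move=> c0 t0; rewrite /generator powRM// ?ltW ?X0//.
by rewrite mulrCA HX//; ring.
Qed.

Let a := scale K.
Let b := scale k.
Let K0 : 0 < K. Proof. exact: lt_le_trans kK. Qed.
Let a0 : 0 < a. Proof. exact: scale_gt0. Qed.
Let b0 : 0 < b. Proof. exact: scale_gt0. Qed.

(** No path regularity is asked, since neither the start [a * X] nor a pointwise limit of iterates
    has to be càdlàg. *)
Definition admissible (U : R -> Omega -> R) :=
  [/\ progressive F U, forall t w, 0 <= t -> 0 <= U t w &
      forall t, 0 <= t -> {ae P, forall w, U t w <= b * X t w}].

Let jX := progressive_measurable hF pX.

Lemma generator_admissible_le U : admissible U ->
  forall t, 0 <= t -> {ae P, forall w, generator U t w <= th * b `^ r * X t w}.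
Proof.
move=> [_ U0 Ub] t t0; apply: filterS (Ub _ t0) => w h.
by rewrite -generatorX ?(ltW b0)//; apply: generator_le => //; exact: U0.
Qed.

Lemma generator_finite U : admissible U -> finite_expected_int P (generator U).
Proof.
move=> aU; have [pU U0 Ub] := aU.
have c0 : 0 <= th * b `^ r by rewrite mulr_ge0 ?powR_ge0// ltW.
have X0' t w : 0 <= t -> 0 <= X t w by move=> /X0/ltW; exact.
have := finite_expected_intZ jX X0' c0 (integrand_finite hJ).
apply: finite_expected_int_le.
- exact: (progressive_measurable hF (generator_progressive pU)).
- exact: (progressive_measurable hF (progressiveZ hF _ pX)).
- by move=> *; exact: generator_ge0.
- by move=> t w t0; rewrite mulr_ge0// X0'.
- exact: generator_admissible_le.
Qed.

(** The bound [b * X] is preserved: the new potential is at most [th * b ^ r * J], equal to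
    [k * b * J] by [scaleE], and [k * J <= X]. *)
Lemma admissible_step U : admissible U ->
  exists V, admissible V /\ potential P F V (generator U).
Proof.
move=> aU; have [pU U0 Ub] := aU.
have pG := generator_progressive pU.
have G0 := generator_ge0 U.
have Goo := generator_finite aU.
have [V [pV cV V0 VE]] := potential_exists hF cF rF pG G0 Goo.
have hV : potential P F V (generator U) by apply/(potentialP hF).
exists V; split => //; split => // t t0.
have c0 : 0 <= th * b `^ r by rewrite mulr_ge0 ?powR_ge0// ltW.
have := potential_mono hF hV (potentialZ hF c0 hJ) (generator_admissible_le aU) t0.
apply: filterS2 (JX t0) => w [kJ _] /le_trans; apply.
by rewrite scaleE// [k * _]mulrC -mulrA ler_pM2l.
Qed.

Lemma iteration_exists : exists U : nat -> R -> Omega -> R,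
  [/\ U 0%N = (fun t w => a * X t w), forall n, admissible (U n) &
      forall n, potential P F (U n.+1) (generator (U n))].
Proof.
(* Choice needs a total map, so a process that is not admissible is sent to itself. *)
have /choice[step hstep] : forall U, exists V, admissible U ->
    admissible V /\ potential P F V (generator U).
  move=> U; have [/admissible_step[V hV]|nU] := pselect (admissible U).
    by exists V.
  by exists U.
pose U n := iter n step (fun t w => a * X t w).
have aU n : admissible (U n).
  elim: n => [|n ih]; last by have [] := hstep _ ih.
  split => /=.
  - exact: progressiveZ.
  - by move=> t w t0; rewrite mulr_ge0 ?ltW ?X0.
  (* The start lies below the barrier, [a <= b], because [scale] is decreasing and [k <= K]. *)
  - move=> t t0; apply: aeW => w; rewrite ler_pM2r ?X0//.
    apply: ge0_ler_powR.
    + by rewrite invr_ge0 subr_ge0 ltW.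
    + by rewrite nnegrE divr_ge0// ltW.
    + by rewrite nnegrE divr_ge0// ltW.
    + by rewrite ler_pM2l// lef_pV2 ?posrE.
by exists U; split => // n; have [] := hstep _ (aU n).
Qed.

Section limit.
Variable U : nat -> R -> Omega -> R.
Hypothesis U_0 : U 0%N = (fun t w => a * X t w).
Hypothesis aU : forall n, admissible (U n).
Hypothesis hU : forall n, potential P F (U n.+1) (generator (U n)).

Let U0 n t w : 0 <= t -> 0 <= U n t w.
Proof. by have [_ h _] := aU n; exact: h. Qed.

(** The first step is the subsolution property: [U 1] is at least [th * a ^ r * J], equal to
    [K * a * J], and [X <= K * J]. Monotonicity of the generator propagates it. *)
Lemma iteration_nd n : forall t, 0 <= t -> {ae P, forall w, U n t w <= U n.+1 t w}.
Proof.
elim: n => [|n ih] t t0.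
  have c0 : 0 <= th * a `^ r by rewrite mulr_ge0 ?powR_ge0// ltW.
  have h : forall t, 0 <= t -> {ae P, forall w, th * a `^ r * X t w <= generator (U 0%N) t w}.
    by move=> s s0; apply: aeW => w; rewrite U_0 generatorX// ltW.
  have := potential_mono hF (potentialZ hF c0 hJ) (hU 0) h t0.
  apply: filterS2 (JX t0) => w [_ XJ]; apply: le_trans.
  by rewrite U_0 scaleE// [K * _]mulrC -mulrA ler_pM2l.
apply: (potential_mono hF (hU n) (hU n.+1)) => // s s0.
by apply: filterS (ih _ s0) => w h; apply: generator_le => //; exact: U0.
Qed.

(** The iterates are ordered only almost surely at each time. The upper limit is defined everywhere,
    which makes the limit progressive without an exceptional set. *)
Definition limit_process t w := fine (limn_esup (fun n => (U n t w)%:E)).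

Lemma limit_process_cvg t : 0 <= t -> {ae P, forall w,
  [/\ forall n, U n t w <= limit_process t w, limit_process t w <= b * X t w &
      U n t w @[n --> \oo] --> limit_process t w]}.
Proof.
move=> t0.
have h1 := ae_foralln (fun n => iteration_nd n t0).
have h2 : {ae P, forall w, forall n, U n t w <= b * X t w}.
  by apply: ae_foralln => n; have [_ _ h] := aU n; exact: h.
apply: filterS2 h1 h2 => w h1 h2.
have nd : nondecreasing_seq (fun n => U n t w) by apply/nondecreasing_seqP.
have cv : cvgn (fun n => U n t w).
  apply: nondecreasing_is_cvgn => //; exists (b * X t w) => _ [n _ <-]; exact: h2.
have cE : (U n t w)%:E @[n --> \oo] --> (limn (fun n => U n t w))%:E.
  by apply: cvg_EFin; [exact: nearW|exact: cv].
have -> : limit_process t w = limn (fun n => U n t w).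
  by rewrite /limit_process; have [_ ->] := cvg_limn_einf_sup cE.
split => //.
- by move=> n; exact: nondecreasing_cvgn_le.
- by apply: limr_le => //; exact: nearW.
Qed.

Lemma limit_process_progressive : progressive F limit_process.
Proof.
apply/(progressiveP hF) => t t0.
apply: (@measurableT_comp _ _ _ _ _ _ (@fine R)); first exact: fine_measurable.
apply: measurable_fun_limn_esup => n; apply/measurable_EFinP.
by have [+ _ _] := aU n => /(progressiveP hF)/(_ t t0).
Qed.

Lemma limit_process_ge0 t w : 0 <= t -> 0 <= limit_process t w.
Proof.
move=> t0; apply: fine_ge0; apply: le_trans (limn_einf_sup _).
by apply: (limn_einf_ge (n0 := 0%N)) => n _; rewrite lee_fin U0.
Qed.

Lemma limit_process_admissible : admissible limit_process.
Proof.
split; [exact: limit_process_progressive|by move=> *; exact: limit_process_ge0|].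
by move=> t t0; apply: filterS (limit_process_cvg t0) => w [].
Qed.

Lemma limit_process_gt0 t : 0 <= t -> {ae P, forall w, 0 < limit_process t w}.
Proof.
move=> t0; apply: filterS (limit_process_cvg t0) => w [/(_ 0%N) + _ _].
by rewrite U_0; apply: lt_le_trans; rewrite mulr_gt0// X0.
Qed.

(** [L <= V] because each iterate has a smaller integrand than [V]. Conversely, Fatou in time and
    over [Omega] bounds [V] by the lower limit of the iterates, which stay below [L]. *)
Lemma limit_process_fixed V : potential P F V (generator limit_process) ->
  forall t, 0 <= t -> {ae P, forall w, V t w = limit_process t w}.
Proof.
move=> hV t t0; set L := limit_process.
have sF := filtration_sigma hF t0; have Fm := filtration_sub hF t0.
have LV : {ae P, forall w, L t w <= V t w}.
  have h n : {ae P, forall w, U n.+1 t w <= V t w}.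
    apply: (potential_mono hF (hU n) hV) => // s s0.
    apply: filterS (limit_process_cvg s0) => w [h _ _].
    by apply: generator_le => //; exact: U0.
  apply: filterS2 (ae_foralln h) (limit_process_cvg t0) => w {}h [_ _ cv].
  apply: (cvgr_to_le cv); exists 1%N => // -[//|n] _; exact: h.
(* The power is shown continuous at positive points, and the lower barrier [a * X] keeps the limit
   positive. *)
have gcv : forall s, 0 <= s -> {ae P, forall w,
    generator (U n) s w @[n --> \oo] --> generator L s w}.
  move=> s s0; apply: filterS2 (limit_process_cvg s0) (limit_process_gt0 s0) => w [_ _ cv] L0.
  by apply: cvgM; [exact: cvg_cst|exact: cvg_powR].
have jU n := progressive_measurable hF (integrand_progressive (hU n)).
have jL := progressive_measurable hF (integrand_progressive hV).
have tail_ge0 n w : (0 <= tail (generator (U n)) t w)%E.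
  by apply: time_integral_ge0; [move=> *; exact: generator_ge0|exact: itvcy_sub].
have tailL_ge0 w : (0 <= tail (generator L) t w)%E.
  by apply: time_integral_ge0; [move=> *; exact: generator_ge0|exact: itvcy_sub].
have mtail n : measurable_fun setT (fun w => tail (generator (U n)) t w).
  apply: measurable_time_integral => //; last exact: itvcy_sub.
  by move=> *; exact: generator_ge0.
have tail_le : {ae P, forall w, (tail (generator L) t w <=
    limn_einf (fun n => tail (generator (U n)) t w))%E}.
  (* The comparison of time integrals takes real-valued processes. Where the lower limit is infinite
     [fine] gives 0, which is still below it. *)
  pose B s w := fine (limn_einf (fun n => (generator (U n) s w)%:E)).
  have inf_ge0 s w : 0 <= s -> (0 <= limn_einf (fun n => (generator (U n) s w)%:E))%E.
    by move=> s0; apply: (limn_einf_ge (n0 := 0%N)) => n _; rewrite lee_fin generator_ge0.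
  have mB : measurable_fun half_space (fun p : R * Omega => B p.1 p.2).
    apply: (@measurableT_comp _ _ _ _ _ _ (@fine R)); first exact: fine_measurable.
    by apply: measurable_fun_limn_einf => n; apply/measurable_EFinP; exact: jU.
  have B0 s w : 0 <= s -> 0 <= B s w by move=> s0; rewrite fine_ge0// inf_ge0.
  have LB s : 0 <= s -> {ae P, forall w, generator L s w <= B s w}.
    move=> s0; apply: filterS (gcv s s0) => w cv.
    have cE : (generator (U n) s w)%:E @[n --> \oo] --> (generator L s w)%:E.
      by apply: cvg_EFin; [exact: nearW|exact: cv].
    by rewrite /B; have [-> _] := cvg_limn_einf_sup cE.
  have := time_integral_ae_le jL mB (@generator_ge0 L) B0 LB (measurable_itv `[t, +oo[) (itvcy_sub t0).
  apply: filterS => w /le_trans; apply.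
  have mUw n : measurable_fun (`[t, +oo[%classic : set R) (fun s => (generator (U n) s w)%:E).
    by apply/measurable_EFinP; apply: (measurable_section (jU n)) => //; exact: itvcy_sub.
  apply: (@le_trans _ _ (\int[leb]_(s in `[t, +oo[) limn_einf (fun n => (generator (U n) s w)%:E))%E).
    apply: ge0_le_integral => //.
    - by move=> s /=; rewrite in_itv/= andbT => ts; rewrite lee_fin B0// (le_trans t0).
    - by apply/measurable_EFinP; apply: (measurable_section mB) => //; exact: itvcy_sub.
    - exact: measurable_fun_limn_einf.
    move=> s /=; rewrite in_itv/= andbT => ts.
    by have := inf_ge0 s w (le_trans t0 ts); rewrite /B; case: (limn_einf _).
  apply: fatou => // n s /=; rewrite in_itv/= andbT => ts.
  by rewrite lee_fin generator_ge0// (le_trans t0).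
have VL : {ae P, forall w, V t w <= L t w}.
  apply: (ae_le_of_le_integral sF Fm).
  - exact: (progressive_adapted hF t0 (potential_progressive hV)).
  - exact: (progressive_adapted hF t0 limit_process_progressive).
  - by move=> w; exact: (potential_ge0 hV w t0).
  - by move=> w; exact: limit_process_ge0.
  - exact: (potential_lty hF hV t0).
  move=> E FE; have mE := Fm _ FE; rewrite (potentialE hV t0 FE).
  apply: (@le_trans _ _ (\int[P]_(w in E) limn_einf (fun n => tail (generator (U n)) t w))%E).
    apply: ae_ge0_le_integral => //.
    - apply: measurable_funTS; apply: measurable_time_integral => //; last exact: itvcy_sub.
      by move=> *; exact: generator_ge0.
    - by move=> w _; exact: (limn_einf_ge (n0 := 0%N)).
    - by apply: measurable_fun_limn_einf => n; exact: measurable_funTS.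
    - by apply: filterS tail_le.
  apply: le_trans (fatou _ _ _ _) _ => //; first by move=> n; exact: measurable_funTS.
  apply: limn_einf_le => n; rewrite -(potentialE (hU n) t0 FE).
  apply: ae_ge0_le_integral => //.
  - by move=> w _; rewrite lee_fin U0.
  - exact/measurable_funTS/measurable_EFinP/(potential_measurable hF (hU n)).
  - by move=> w _; rewrite lee_fin limit_process_ge0.
  - apply/measurable_funTS/measurable_EFinP.
    exact: (measurable_fun_sub_sigma sF Fm (sub_sigmaT sF) (progressive_adapted hF t0 limit_process_progressive)).
  - by apply: filterS (limit_process_cvg t0) => w [h _ _] _; rewrite lee_fin h.
by apply: filterS2 LV VL => w h1 h2; apply/eqP; rewrite eq_le h1 h2.
Qed.

End limit.

(** One more step from the limit yields a càdlàg modification of it, which is then a potential of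
    its own generator. *)
Theorem potential_generator_exists : exists V,
  potential P F V (generator V) /\ forall t, 0 <= t -> {ae P, forall w, 0 < V t w}.
Proof.
have [U [U_0 aU hU]] := iteration_exists.
have [V [[pV V0 _] hV]] := admissible_step (limit_process_admissible U_0 aU hU).
have VL := limit_process_fixed U_0 aU hU hV.
exists V; split.
  apply: (potential_ae_eq_integrand hF hV).
  - exact: generator_progressive.
  - by move=> *; exact: generator_ge0.
  - by move=> t t0; apply: filterS (VL t t0) => w e; rewrite /generator e.
by move=> t t0; apply: filterS2 (VL t t0) (limit_process_gt0 U_0 aU hU t0) => w ->.
Qed.

End Existence.

(** * Epstein-Zin solutions *)

Section EpsteinZin.
Context {d : measure_display} {Omega : measurableType d} {R : realType}.
Variables (P : probability Omega R) (F : R -> set (set Omega)).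
Hypotheses (hF : is_filtration F).
Variables (Rp Sp : R) (C : R -> Omega -> R).
Hypotheses (Rp1 : Rp != 1) (Sp1 : Sp != 1) (th1 : 1 < EZ_theta Rp Sp).
Hypothesis pC : progressive F C.

Local Notation th := (EZ_theta Rp Sp).
Local Notation r := (EZ_rho Rp Sp).
Local Notation leb := (@lebesgue_measure R).

Lemma cond_exp_versionZ (G : set (set Omega)) (Y Z : Omega -> R) c :
  G `<=` measurable -> cond_exp_version P G Y Z ->
  cond_exp_version P G (fun w => c * Y w) (fun w => c * Z w).
Proof.
move=> Gm [iY mZ iZ ZY].
have E (f : Omega -> R) : EFin \o (fun w => c * f w) = (fun w => c%:E * (EFin \o f) w)%E.
  by apply/funext => w /=; rewrite EFinM.
split.
- by rewrite E; exact: integrableZl.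
- move=> B mB; have mc : measurable_fun [set: R] ( *%R c) by exact: mulrl_measurable.
  have := mZ _ (mc measurableT B mB); rewrite setTI; exact.
- by rewrite E; exact: integrableZl.
move=> A GA; have mA := Gm _ GA.
under eq_integral do rewrite EFinM; under [in RHS]eq_integral do rewrite EFinM.
have iZA := integrableS measurableT mA (@subsetT _ A) iZ.
have iYA := integrableS measurableT mA (@subsetT _ A) iY.
by rewrite !integralZl// ZY.
Qed.

(** The identity holds on every path: an infinite tail gives 0 on both sides, since [fine] sends
    both infinities to 0. *)
Lemma tail_intZ (A : R -> Omega -> R) c t :
  measurable_fun half_space (fun p : R * Omega => A p.1 p.2) ->
  (forall t w, 0 <= t -> 0 <= A t w) -> 0 <= t ->
  tail_int (fun s w => c * A s w) t = (fun w => c * tail_int A t w).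
Proof.
move=> mA A0 t0; apply/funext => w; rewrite /tail_int.
rewrite time_integralZ//; last exact: itvcy_sub.
have := @time_integral_ge0 _ _ _ A A0 _ w (itvcy_sub t0).
case: (integral _ _ _) => [x _| _ |//]; first by rewrite -EFinM.
rewrite /= mulr0; case: (ltgtP c 0) => [c0|c0|->].
- by rewrite lt0_muley ?lte_fin.
- by rewrite gt0_muley ?lte_fin.
- by rewrite mul0e.
Qed.

Lemma theta_gt0 : 0 < th. Proof. exact: lt_trans th1. Qed.

Lemma rho_gt0 : 0 < r.
Proof. by rewrite divr_gt0 ?subr_gt0// theta_gt0. Qed.

Lemma rho_lt1 : r < 1.
Proof. by rewrite ltr_pdivrMr ?theta_gt0// mul1r; lra. Qed.

Let q := 1 - Rp.
Let q0 : q != 0. Proof. by rewrite subr_eq0 eq_sym. Qed.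
Let s0 : 1 - Sp != 0. Proof. by rewrite subr_eq0 eq_sym. Qed.

Definition EZ_weight t w := th * C t w `^ (1 - Sp).

Lemma EZ_weight_ge0 t w : 0 <= EZ_weight t w.
Proof. by rewrite mulr_ge0 ?powR_ge0// ltW// theta_gt0. Qed.

Lemma EZ_weight_progressive : progressive F EZ_weight.
Proof. by apply: progressiveZ => //; exact: progressive_powR. Qed.

(** The constants match because [theta / (1 - R) = 1 / (1 - S)]. *)
Lemma f_EZE (V : R -> Omega -> R) t w : f_EZ Rp Sp (C t w) (V t w) =
  q^-1 * generator r EZ_weight (fun t w => q * V t w) t w.
Proof. by rewrite /f_EZ /generator /EZ_weight /EZ_theta -/q; field; rewrite q0 s0. Qed.

Lemma EZ_solutionP (V : R -> Omega -> R) : let U t w := q * V t w in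
  EZ_solution P F Rp Sp C V <-> potential P F U (generator r EZ_weight U).
Proof.
move=> U; pose A := generator r EZ_weight U.
have H0 t w : 0 <= t -> 0 <= EZ_weight t w by move=> _; exact: EZ_weight_ge0.
have A0 t w : 0 <= t -> 0 <= A t w by exact: generator_ge0.
have A0' t w : 0 <= A t w by rewrite mulr_ge0 ?EZ_weight_ge0 ?powR_ge0.
have VU : V = (fun t w => q^-1 * U t w).
  by apply/funext => t; apply/funext => w; rewrite /U mulKf.
have fA : (fun s w => f_EZ Rp Sp (C s w) (V s w)) = (fun s w => q^-1 * A s w).
  by apply/funext => t; apply/funext => w; exact: f_EZE.
have absf : (fun s w => `|f_EZ Rp Sp (C s w) (V s w)|) = (fun s w => `|q^-1| * A s w).
  by apply/funext => t; apply/funext => w; rewrite f_EZE normrM (ger0_norm (A0' _ _)).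
have cadlagZ (c : R) (W : R -> Omega -> R) : cadlag W -> cadlag (fun t w => c * W t w).
  move=> cW w t t0; have [h1 h2] := cW w t t0; split.
    by apply: cvgM => //; exact: cvg_cst.
  by move=> /h2[l hl]; exists (c * l); apply: cvgM => //; exact: cvg_cst.
have pA (W : R -> Omega -> R) : progressive F W -> progressive F (generator r EZ_weight W).
  by move=> pW; apply: generator_progressive => //; exact: EZ_weight_progressive.
split=> [[pV cV V0 fin VE]|hU].
  have pU : progressive F U by exact: progressiveZ.
  have jA := progressive_measurable hF (pA _ pU).
  have Aoo : finite_expected_int P A.
    have jf : measurable_fun half_space (fun p : R * Omega => `|q^-1| * A p.1 p.2).
      by apply: measurable_funM.
    rewrite absf in fin.
    (* The integrand of [U] is recovered from the absolute value of the aggregator by the factor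
       [|q|]. *)
    have := finite_expected_intZ jf (fun t w t0 => mulr_ge0 (normr_ge0 _) (A0 t w t0)) (normr_ge0 q) fin.
    congr finite_expected_int; apply/funext => t; apply/funext => w.
    by rewrite mulrA -normrM mulfV// normr1 mul1r.
  apply/(potentialP hF) => //; [exact: cadlagZ|exact: pA|].
  move=> t t0; have := cond_exp_versionZ q (filtration_sub hF t0) (VE t t0).
  rewrite fA tail_intZ//; congr (cond_exp_version _ _ _ _).
  by apply/funext => w; rewrite mulrA mulfV// mul1r.
have jA := progressive_measurable hF (integrand_progressive hU).
split.
- by rewrite VU; apply: progressiveZ => //; exact: (potential_progressive hU).
- by rewrite VU; apply: cadlagZ; exact: (potential_cadlag hU).
- by move=> t w t0; exact: (potential_ge0 hU w t0).
- by rewrite absf; apply: finite_expected_intZ => //; exact: (integrand_finite hU).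
move=> t t0; rewrite fA tail_intZ// VU; apply: cond_exp_versionZ; first exact: filtration_sub.
have /(potentialP hF) : potential P F U A by [].
apply => //; [exact: (potential_progressive hU)|exact: (potential_cadlag hU)|
  exact: (potential_ge0 hU)|exact: (integrand_progressive hU)|exact: (integrand_finite hU)].
Qed.

End EpsteinZin.

(** * Existence and comparison of proper solutions *)

Section ProperSolutions.
Context {d : measure_display} {Omega : measurableType d} {R : realType}.
Variables (P : probability Omega R) (F : R -> set (set Omega)).
Hypotheses (hF : is_filtration F) (cF : filtration_complete P F).
Hypothesis rF : filtration_right_continuous F.
Variables (Rp Sp : R) (C : R -> Omega -> R).
Hypotheses (Rp1 : Rp != 1) (Sp1 : Sp != 1) (th1 : 1 < EZ_theta Rp Sp).
Hypothesis pC : progressive F C.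
Local Notation X := (fun t w => C t w `^ (1 - Rp)).
Hypothesis soX : SO P F X.

Local Notation th := (EZ_theta Rp Sp).
Local Notation r := (EZ_rho Rp Sp).
Local Notation H := (EZ_weight Rp Sp C).

(** The bounds in [SO] hold for every version of the conditional expectations, so in particular for
    a càdlàg one, whose existence they do not assert. *)
Lemma SO_potential : exists J k K, [/\ 0 < k, k <= K, potential P F J X &
  forall t, 0 <= t -> cond_exp_version P (F t) (tail_int X t) (J t) /\
    {ae P, forall w, k * J t w <= X t w /\ X t w <= K * J t w}].
Proof.
have [pX X0 Xoo [k [K [k0 kK JX]]]] := soX.
have X0' t w : 0 <= t -> 0 <= X t w by move=> /X0/ltW; exact.
have [J [pJ cJ J0 JE]] := potential_exists hF cF rF pX X0' Xoo.
exists J, k, K; split => //; first exact/(potentialP hF).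
by move=> t t0; split; [exact: JE|apply: JX => //; exact: JE].
Qed.

(** The bound [X <= K * J] with [X > 0] makes [J] positive almost surely, so the condition in the
    definition of a proper solution is met almost everywhere. *)
Lemma EZ_proper_gt0 V : EZ_proper P F Rp Sp C V ->
  forall t, 0 <= t -> {ae P, forall w, 0 < (1 - Rp) * V t w}.
Proof.
move=> [_ VJ] t t0; have [_ X0 _ _] := soX.
have [J [k [K [k0 kK hJ JX]]]] := SO_potential.
have [JE JXt] := JX t t0.
apply: filterS2 (VJ t t0 _ JE) JXt => w h [_ XK]; apply: h.
have K0 := lt_le_trans k0 kK.
by rewrite -(pmulr_rgt0 _ K0); apply: lt_le_trans XK; exact: X0.
Qed.

(** The exponents add up: [(1 - S) + (1 - R) rho = 1 - R], because [(1 - R) / theta = 1 - S]. *)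
Lemma EZ_weightX t w : 0 <= t -> H t w * X t w `^ r = th * X t w.
Proof.
move=> t0; have [_ X0 _ _] := soX.
have q0 : 1 - Rp != 0 by rewrite subr_eq0 eq_sym.
have s0 : 1 - Sp != 0 by rewrite subr_eq0 eq_sym.
have Cn0 : C t w != 0.
  by apply/eqP => e; have := X0 t w t0; rewrite e powR0// ltxx.
rewrite /EZ_weight -mulrA -powRrM -powRD; last by rewrite Cn0 implybT.
congr (_ * _ `^ _).
have thn0 : th != 0 by rewrite gt_eqF// theta_gt0.
by rewrite /EZ_rho /EZ_theta; field; rewrite q0 s0.
Qed.

Lemma EZ_proper_le V1 V2 : EZ_proper P F Rp Sp C V1 -> EZ_proper P F Rp Sp C V2 ->
  forall t, 0 <= t -> {ae P, forall w, (1 - Rp) * V1 t w <= (1 - Rp) * V2 t w}.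
Proof.
move=> h1 h2.
have /(EZ_solutionP P hF Rp1 Sp1 th1 pC) U1 := h1.1.
have /(EZ_solutionP P hF Rp1 Sp1 th1 pC) U2 := h2.1.
apply: (@potential_le _ _ _ P F hF r (rho_gt0 th1) (rho_lt1 th1) _ _ _ _ U2 U1
  (EZ_proper_gt0 h2) (EZ_proper_gt0 h1)).
(* The cancellation behind the exponents: [H U ^ r] times [(1 - r) Y ^ r U ^ (- r)] is
   [(1 - r) H Y ^ r]. *)
move=> s w s0 u0 y0; rewrite /generator /gmean_x powRN.
by field; rewrite gt_eqF// powR_gt0.
Qed.

Lemma EZ_proper_exists : exists V, EZ_proper P F Rp Sp C V.
Proof.
have [pX X0 Xoo _] := soX.
have [J [k [K [k0 kK hJ JX]]]] := SO_potential.
have H0 t w : 0 <= t -> 0 <= H t w by move=> _; exact: EZ_weight_ge0.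
have [U [hU U0]] := potential_generator_exists hF cF rF (rho_gt0 th1) (rho_lt1 th1)
  (theta_gt0 th1) k0 kK (EZ_weight_progressive hF Rp Sp pC) H0 pX X0 EZ_weightX hJ
  (fun t t0 => (JX t t0).2).
have q0 : 1 - Rp != 0 by rewrite subr_eq0 eq_sym.
have UE : (fun t w => (1 - Rp) * ((1 - Rp)^-1 * U t w)) = U.
  by apply/funext => t; apply/funext => w; rewrite mulVKf.
exists (fun t w => (1 - Rp)^-1 * U t w); split.
  by apply/(EZ_solutionP P hF Rp1 Sp1 th1 pC); rewrite UE.
move=> t t0 J' _; apply: filterS (U0 t t0) => w u0 _.
by rewrite mulVKf.
Qed.

(** The paths agree at all dyadic times outside one null set, and a value at any time is the limit
    of values at later dyadic times. *)
Lemma cadlag_indistinguishable (V1 V2 : R -> Omega -> R) : cadlag V1 -> cadlag V2 ->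
  (forall t, 0 <= t -> {ae P, forall w, V1 t w = V2 t w}) ->
  {ae P, forall w, forall t, 0 <= t -> V1 t w = V2 t w}.
Proof.
move=> c1 c2 V12.
have h := ae_foralln (fun n => ae_foralln (fun i => V12 (dyadic n i) (dyadic_ge0 n i))).
apply: filterS h => w h t t0.
have lim (V : R -> Omega -> R) : cadlag V -> V (dyadic_above n t) w @[n --> \oo] --> V t w.
  move=> cV; have [/cvg_at_rightP cVt _] := cV w t t0.
  apply: cVt; split; first by move=> n; exact: dyadic_above_gt.
  exact: cvg_dyadic_above.
have l2 := lim _ c2; apply: (cvg_unique _ (lim _ c1)) => //.
by move: l2; under eq_fun do rewrite -h.
Qed.

End ProperSolutions.

Theorem theorem4p5 (d : measure_display) (Omega : measurableType d)
  (R : realType) (P : probability Omega R) (F : R -> set (set Omega))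
  (Rp Sp : R) (C : R -> Omega -> R) :
  is_filtration F -> filtration_complete P F -> F0_trivial P F ->
  filtration_right_continuous F -> filtration_left_continuous F ->
  0 < Rp -> Rp != 1 -> 0 < Sp -> Sp != 1 -> 1 < EZ_theta Rp Sp ->
  progressive F C -> (forall t w, 0 <= t -> 0 <= C t w) ->
  SO_plus P F (fun t w => C t w `^ (1 - Rp)) ->
  (exists V, EZ_proper P F Rp Sp C V) /\
  (forall V1 V2, EZ_proper P F Rp Sp C V1 -> EZ_proper P F Rp Sp C V2 ->
     {ae P, forall w, forall t, 0 <= t -> V1 t w = V2 t w}).
Proof.
move=> hF cF _ rF _ _ Rp1 _ Sp1 th1 pC C0 [nu [_ [soX _]]].
split; first exact: EZ_proper_exists.
move=> V1 V2 h1 h2.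
apply: cadlag_indistinguishable; [by case: h1 => -[]|by case: h2 => -[]|].
move=> t t0.
have le12 := EZ_proper_le hF cF rF Rp1 Sp1 th1 pC soX h1 h2 t0.
have le21 := EZ_proper_le hF cF rF Rp1 Sp1 th1 pC soX h2 h1 t0.
apply: filterS2 le12 le21 => w le12 le21.
have q0 : 1 - Rp != 0 by rewrite subr_eq0 eq_sym.
by apply: (mulfI q0); apply/eqP; rewrite eq_le le12 le21.
Qed.
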